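(* Let $(X,\lambda)$ and $(X',\lambda')$ be two weighted polyhedra of the same type which are W-homotopy equivalent. (a) If $(X,\lambda)$ and $(X',\lambda')$ are of ascending type, then $H^{AW}_*(X,\lambda)\cong H^{AW}_*(X',\lambda')$. (b) If $(X,\lambda)$ and $(X',\lambda')$ are of descending type, then $H^{DW}_*(X,\lambda)\cong H^{DW}_*(X',\lambda')$. (c) If $(X,\lambda)$ and $(X',\lambda')$ are strongly W-homotopy equivalent, then $H^{AW}_*(X,\lambda)\cong H^{AW}_*(X',\lambda')$ and $H^{DW}_*(X,\lambda)\cong H^{DW}_*(X',\lambda')$.
   Context: Conventions: simplicial complexes are finite, weighted polyhedra are compact, homology has integer coefficients. Weighted complexes. An ascending weight on a simplicial complex $K$ is a function $\mu$ from the simplices of $K$ to the positive integers with $\mu(\sigma')\mid\mu(\sigma)$ whenever $\sigma'$ is a face of $\sigma$; a descending weight satisfies instead $\mu(\sigma)\mid\mu(\sigma')$. A weighted simplicial complex $(K,\mu)$ has a weight of one of these two types. On the oriented simplicial chain groups $C_n(K)$ put $\partial^{\mu}\sigma=\sum_{j=0}^n(-1)^jc_j\,\partial_j\sigma$, where $\partial_j[v_0,\dots,v_n]=[v_0,\dots,\widehat{v}_j,\dots,v_n]$ and $c_j=\mu(\sigma)/\mu(\partial_j\sigma)$ if $\mu$ is ascending, $c_j=\mu(\partial_j\sigma)/\mu(\sigma)$ if $\mu$ is descending; $H_*(K,\partial^\mu)$ is the homology of $(C_*(K),\partial^\mu)$. Divisible weights. A weight $\xi$ is divisible if the vertices of every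 simplex $\sigma$ can be ordered $v_0,\dots,v_k$ with $\xi(v_0)\mid\cdots\mid\xi(v_k)$ and $\xi(\sigma)=\xi(v_k)$ (ascending case) or $\xi(\sigma)=\xi(v_0)$ (descending case). The inversion $\widehat{\xi}$ of a divisible weight $\xi$ is the divisible weight of the opposite type with the same values on vertices. Weighted polyhedra. For $x\in|K|$ let $\mathrm{Car}_K(x)$ be the unique simplex containing $x$ in its relative interior, and put $\lambda_\mu(x)=\mu(\mathrm{Car}_K(x))$. A weighted polyhedron is a pair $(X,\lambda)$, $X$ a space and $\lambda:X\to\mathbb{Z}_{+}$ a function, for which there is a weight-preserving homeomorphism to $(|K|,\lambda_\mu)$ for some weighted simplicial complex $(K,\mu)$, called a weighted triangulation (a divisibly weighted triangulation if $\mu$ is divisible; these always exist); its type is that of $\mu$. AW- and DW-homology. Let $(K,\xi)$ be a divisibly weighted triangulation of $(X,\lambda)$. If $(X,\lambda)$ is of ascending type, $H^{AW}_*(X,\lambda)=H_*(K,\partial^{\xi})$ and $H^{DW}_*(X,\lambda)=H_*(K,\partial^{\widehat{\xi}})$; if it is of descending type, $H^{AW}_*(X,\lambda)=H_*(K,\partial^{\widehat{\xi}})$ and $H^{DW}_*(X,\lambda)=H_*(K,\partial^{\xi})$. Up to isomorphism these do not depend on $(K,\xi)$. Maps. For weighted polyhedra of the same type, a W-continuous map $f:(X,\lambda)\to(X',\lambda')$ is a continuous map with $\lambda'(f(x))\mid\lambda(x)$ (ascending type) or $\lambda(x)\mid\lambda'(f(x))$ (descending type) for all $x\in X$; it is weight-preserving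 if $\lambda'(f(x))=\lambda(x)$ for all $x$. The product $(X\times[0,1],\lambda\times\mathbf{1})$ has weight $(x,t)\mapsto\lambda(x)$ and the same type as $(X,\lambda)$. Two W-continuous maps $f,g:(X,\lambda)\to(X',\lambda')$ are W-homotopic if there is a W-continuous map $H:(X\times[0,1],\lambda\times\mathbf{1})\to(X',\lambda')$ with $H(x,0)=f(x)$, $H(x,1)=g(x)$; they are strongly W-homotopic if $H$ can be chosen weight-preserving. $(X,\lambda)$ and $(X',\lambda')$ are W-homotopy equivalent if there are W-continuous maps $f:(X,\lambda)\to(X',\lambda')$ and $g:(X',\lambda')\to(X,\lambda)$ with $g\circ f$ and $f\circ g$ W-homotopic to $\mathrm{id}_X$ and $\mathrm{id}_{X'}$; they are strongly W-homotopy equivalent if $f,g$ can be chosen weight-preserving with $g\circ f$ and $f\circ g$ strongly W-homotopic to the identities. *)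

(* Defs.v *)
From HB Require Import structures.
From mathcomp Require Import all_boot all_order all_fingroup all_algebra.
From mathcomp Require Import all_classical all_reals topology normedtype.
From mathcomp Require Import finset.
Import Order.TTheory GRing.Theory Num.Theory numFieldNormedType.Exports.

Set Implicit Arguments.
Unset Strict Implicit.
Unset Printing Implicit Defensive.

Local Open Scope ring_scope.

(* Homology at B of a pair of composable homomorphisms A -> B -> C. *)

Section Homology.
Variables A B C : zmodType.

Definition cycle_pred (d : {additive B -> C}) : {pred B} := fun b => d b == 0.

Fact cycle_pred_zmod_closed (d : {additive B -> C}) :
  zmod_closed (cycle_pred d).
Proof.
split=> [|x y]; rewrite !unfold_in ?raddf0 ?raddfB //.
by move=> /eqP-> /eqP->; rewrite subrr.
Qed.

HB.instance Definition _ (d : {additive B -> C}) :=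
  GRing.isZmodClosed.Build B (cycle_pred d) (cycle_pred_zmod_closed d).

Definition cycles (d : {additive B -> C}) := {b : B | b \in cycle_pred d}.

HB.instance Definition _ (d : {additive B -> C}) := SubChoice.on (cycles d).
HB.instance Definition _ (d : {additive B -> C}) :=
  [SubChoice_isSubZmodule of cycles d by <:].

(* The boundaries are taken inside the cycles, so d0 \o d1 = 0 is not needed to
   form the quotient; it holds for the differentials used below whenever mu is
   a weight. *)
Definition boundary_pred (d1 : {additive A -> B}) (d0 : {additive B -> C}) :
  {pred cycles d0} := fun z => `[< exists a : A, d1 a = \val z >].

Fact boundary_pred_zmod_closed d1 d0 : zmod_closed (@boundary_pred d1 d0).
Proof.
split=> [|x y]; rewrite !unfold_in.
  by apply/asboolP; exists 0; rewrite !raddf0.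
move=> /asboolP[a ax] /asboolP[b by_]; apply/asboolP.
by exists (a - b); rewrite !raddfB /= ax by_.
Qed.

HB.instance Definition _ d1 d0 :=
  GRing.isZmodClosed.Build _ (@boundary_pred d1 d0)
    (boundary_pred_zmod_closed d1 d0).

Definition homology (d1 : {additive A -> B}) (d0 : {additive B -> C}) :
  zmodType := Quotient.quot (@boundary_pred d1 d0).

End Homology.

Definition zmod_isomorphic (A B : zmodType) : Prop :=
  exists f : {additive A -> B}, bijective f.

(* Simplices are nonempty; elements of V need not be vertices of K. *)
Record simplicial_complex (V : finType) := SimplicialComplex {
  simplices :> {set {set V}};
  simplex_neq0 : set0 \notin simplices;
  simplex_face : forall s s' : {set V},
    s \in simplices -> s' \subset s -> s' != set0 -> s' \in simplices
}.

Variant wtype := Ascending | Descending.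

Definition opposite (t : wtype) : wtype :=
  match t with Ascending => Descending | Descending => Ascending end.

Section Weights.
Variables (V : finType) (K : simplicial_complex V).
Implicit Types (t : wtype) (mu xi : {set V} -> nat).

Definition is_weight t mu : Prop :=
  (forall s, s \in (K : {set _}) -> (0 < mu s)%N) /\
  (forall s s', s \in (K : {set _}) -> s' \in (K : {set _}) -> s' \subset s ->
     match t with
     | Ascending => (mu s' %| mu s)%N
     | Descending => (mu s %| mu s')%N
     end).

Definition is_divisible_weight t xi : Prop :=
  is_weight t xi /\
  forall s, s \in (K : {set _}) ->
    exists v0 : V, exists vs : seq V,
      [/\ uniq (v0 :: vs), s = [set v in v0 :: vs]%SET,
          path (fun u v => (xi [set u]%SET %| xi [set v]%SET)%N) v0 vs &
          xi s = match t with
                 | Ascending => xi [set last v0 vs]%SET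
                 | Descending => xi [set v0]%SET
                 end].

End Weights.

(* The inversion of a divisible weight xi of type t.  On a simplex whose
   vertices satisfy xi v_0 %| ... %| xi v_k, the gcd of the vertex weights is
   xi v_0 and their lcm is xi v_k; inversionP and inversion_set1 say that this is
   the divisible weight of the opposite type with the same vertex values. *)
Definition inversion (V : finType) (t : wtype) (xi : {set V} -> nat) :
    {set V} -> nat := fun s =>
  match t with
  | Ascending => \big[gcdn/0%N]_(v in s) xi [set v]%SET
  | Descending => \big[lcmn/1%N]_(v in s) xi [set v]%SET
  end.

Section Chains.
Variables (V : finType) (K : simplicial_complex V).

Definition vset n (v : {ffun 'I_n -> V}) : {set V} := [set v i | i : 'I_n]%SET.

Definition is_osimplex n (v : {ffun 'I_n.+1 -> V}) : bool :=
  injectiveb v && (vset v \in (K : {set _})).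

(* [v_0, ..., v_n], as the injective map i |-> v_i *)
Definition osimplex n := {v : {ffun 'I_n.+1 -> V} | is_osimplex v}.
HB.instance Definition _ n := SubFinite.on (osimplex n).

Fact osimplex_perm_subproof n (v : osimplex n) (p : 'S_n.+1) :
  is_osimplex [ffun i => \val v (p i)].
Proof.
case: v => v /= /andP[/injectiveP vI vK]; apply/andP; split.
  by apply/injectiveP => i j; rewrite !ffunE => /vI/perm_inj.
suff -> : vset [ffun i => v (p i)] = vset v by [].
apply/setP => x; apply/imsetP/imsetP => -[i _ ->].
  by exists (p i); rewrite ?ffunE.
by exists ((p^-1)%g i); rewrite ?ffunE ?permKV.
Qed.

Definition osimplex_perm n (v : osimplex n) (p : 'S_n.+1) : osimplex n :=
  Sub _ (osimplex_perm_subproof v p).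

Fact osimplex_face_subproof n (v : osimplex n.+1) (j : 'I_n.+2) :
  is_osimplex [ffun i => \val v (lift j i)].
Proof.
case: v => v /= /andP[/injectiveP vI vK]; apply/andP; split.
  by apply/injectiveP => i k; rewrite !ffunE => /vI/lift_inj.
apply: (simplex_face vK).
  by apply/fintype.subsetP => x /imsetP[i _ ->]; rewrite ffunE; apply: imset_f.
by apply/set0Pn; exists (v (lift j ord0)); apply/imsetP; exists ord0; rewrite ?ffunE.
Qed.

Definition osimplex_face n (v : osimplex n.+1) (j : 'I_n.+2) : osimplex n :=
  Sub _ (osimplex_face_subproof v j).

(* C_n(K) is the free abelian group on the [v_0, ..., v_n] modulo the relations
   [v_(p 0), ..., v_(p n)] = sgn(p) [v_0, ..., v_n]. *)

Definition ochain n := {ffun osimplex n -> int}.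
HB.instance Definition _ n := GRing.Zmodule.on (ochain n).

Definition obasis n (v : osimplex n) : ochain n := [ffun w => (w == v)%:R].

Definition orient_rel n (v : osimplex n) (p : 'S_n.+1) : ochain n :=
  obasis (osimplex_perm v p) - obasis v *~ (-1) ^+ p.

Definition orient_pred n : {pred ochain n} := fun x =>
  `[< exists a : {ffun osimplex n * 'S_n.+1 -> int},
        x = \sum_q orient_rel q.1 q.2 *~ a q >].

Fact orient_pred_zmod_closed n : zmod_closed (@orient_pred n).
Proof.
split=> [|x y]; rewrite !unfold_in.
  by apply/asboolP; exists 0; rewrite big1 // => q _; rewrite ffunE mulr0z.
move=> /asboolP[a ->] /asboolP[b ->]; apply/asboolP; exists (a - b).
by rewrite -sumrB; apply: eq_bigr => q _; rewrite !ffunE mulrzBr.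
Qed.

HB.instance Definition _ n :=
  GRing.isZmodClosed.Build _ (@orient_pred n) (@orient_pred_zmod_closed n).

Definition chain n : zmodType := Quotient.quot (@orient_pred n).

Definition chain_class n (x : ochain n) : chain n :=
  (\pi_(Quotient.quot (@orient_pred n)) x)%qT.

Variables (t : wtype) (mu : {set V} -> nat).

Definition wcoef (s s' : {set V}) : nat :=
  match t with
  | Ascending => (mu s %/ mu s')%N
  | Descending => (mu s' %/ mu s)%N
  end.

Definition obdry_simplex n (v : osimplex n.+1) : ochain n :=
  \sum_(j < n.+2)
     obasis (osimplex_face v j) *~
       ((-1) ^+ j * (wcoef (vset (\val v)) (vset (\val (osimplex_face v j))))%:Z).

Definition obdry n (x : ochain n.+1) : ochain n :=
  \sum_v obdry_simplex v *~ x v.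

Definition bdry n (c : chain n.+1) : chain n := chain_class (obdry (generic_quotient.repr c)).

Fact obdryB n : {morph @obdry n : x y / x - y}.
Proof.
move=> x y; rewrite /obdry -sumrB.
by apply: eq_bigr => v _; rewrite !ffunE mulrzBr.
Qed.

HB.instance Definition _ n :=
  GRing.isZmodMorphism.Build (ochain n.+1) (ochain n) (@obdry n) (@obdryB n).

Fact obdry_obasis n (v : osimplex n.+1) : obdry (obasis v) = obdry_simplex v.
Proof.
rewrite /obdry (bigD1 v isT) big1 => [|w wv]; rewrite ffunE.
  by rewrite eqxx mulr1z /= addr0.
by rewrite (negbTE wv) mulr0z.
Qed.

Fact orient_relP n (v : osimplex n) (p : 'S_n.+1) :
  orient_rel v p \in @orient_pred n.
Proof.
apply/asboolP; exists [ffun q => (q == (v, p))%:R].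
rewrite (bigD1 (v, p) isT) big1 => [|q qv]; rewrite ffunE.
  by rewrite eqxx mulr1z /= addr0.
by rewrite (negbTE qv) mulr0z.
Qed.

Fact perm_liftE n (p : 'S_n.+1) (j : 'I_n.+1) :
  exists q : 'S_n, p = lift_perm j (p j) q.
Proof.
have ex (k : 'I_n) : exists i : 'I_n, p (lift j k) == lift (p j) i.
  case: (unliftP (p j) (p (lift j k))) => [i ->|/perm_inj/eqP]; first by exists i.
  by rewrite eq_sym (negbTE (neq_lift _ _)).
pose f k := xchoose (ex k).
have fE k : p (lift j k) = lift (p j) (f k) by apply/eqP; exact: xchooseP (ex k).
have fI : injective f.
  move=> k l fkl; apply: (@lift_inj _ j); apply: (@perm_inj _ p).
  by rewrite !fE fkl.
exists (perm fI); apply/permP => i.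
case: (unliftP j i) => [k|] ->; last by rewrite lift_perm_id.
by rewrite lift_perm_lift permE fE.
Qed.

Fact vset_perm n (v : osimplex n) p : vset (\val (osimplex_perm v p)) = vset (\val v).
Proof.
apply/setP => x; apply/imsetP/imsetP => -[i _ ->] /=.
  by exists (p i); rewrite ?ffunE.
by exists ((p^-1)%g i); rewrite ?ffunE ?permKV.
Qed.

Fact obdry_orient_pred n (x : ochain n.+1) :
  x \in @orient_pred n.+1 -> obdry x \in @orient_pred n.
Proof.
move=> /asboolP[a ->]; rewrite raddf_sum; apply: rpred_sum => -[v p] _ /=.
rewrite raddfMz rpredMz // raddfB /= raddfMz /= !obdry_obasis.
rewrite /obdry_simplex mulrz_suml [X in _ - X](reindex_inj (@perm_inj _ p)).
rewrite -sumrB.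
apply: rpred_sum => j _; have [q pE] := perm_liftE p j.
have -> : osimplex_face (osimplex_perm v p) j =
    osimplex_perm (osimplex_face v (p j)) q.
  apply/val_inj/ffunP => i; rewrite /= !ffunE {1}pE lift_perm_lift //.
have sE : (-1) ^+ p j * (-1) ^+ p = (-1) ^+ q * (-1) ^+ j :> int.
  have := odd_lift_perm j (p j) q; rewrite -pE => ->.
  rewrite -(signr_odd _ j) -(signr_odd _ (p j)).
  by case: (odd j); case: (odd (p j)); case: (q : bool).
rewrite !vset_perm -mulrzA mulrAC sE -mulrA [X in _ - X]mulrzA -mulrzBl.
exact: rpredMz (orient_relP _ _).
Qed.

Fact chain_classE n (x y : ochain n) :
  (chain_class x == chain_class y) = (x - y \in @orient_pred n).
Proof. by rewrite /chain_class Quotient.idealrBE. Qed.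

Fact chain_classB n : {morph @chain_class n : x y / x - y}.
Proof. by move=> x y; rewrite /chain_class raddfB. Qed.

Fact bdry_class n (x : ochain n.+1) :
  bdry (chain_class x) = chain_class (obdry x).
Proof.
apply/eqP; rewrite chain_classE -obdryB; apply: obdry_orient_pred.
by rewrite -chain_classE /chain_class reprK.
Qed.

Fact bdryB n : {morph @bdry n : x y / x - y}.
Proof.
move=> x y; rewrite -[x]reprK -[y]reprK -!/(chain_class _).
by rewrite -chain_classB !bdry_class obdryB chain_classB.
Qed.

HB.instance Definition _ n :=
  GRing.isZmodMorphism.Build (chain n.+1) (chain n) (@bdry n) (@bdryB n).

(* the differential out of degree n, with C_(-1)(K) = 0 *)
Definition bdry_from n : {additive chain n -> chain n.-1} :=
  match n return {additive chain n -> chain n.-1} with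
  | 0 => \0
  | m.+1 => @bdry m
  end.

Definition weighted_homology n : zmodType := homology (@bdry n) (bdry_from n).

End Chains.

Lemma inversion_set1 (V : finType) t (xi : {set V} -> nat) (v : V) :
  inversion t xi [set v]%SET = xi [set v]%SET.
Proof. by case: t; rewrite /inversion big_set1. Qed.

Lemma inversionP (V : finType) (K : simplicial_complex V) t
    (xi : {set V} -> nat) :
  is_divisible_weight K t xi ->
  is_divisible_weight K (opposite t) (inversion t xi).
Proof.
move=> [[xi_gt0 _] xi_div].
have tr : transitive (fun u v => (xi [set u]%SET %| xi [set v]%SET)%N).
  by move=> u v w; apply: dvdn_trans.
have vK s v : s \in (K : {set _}) -> v \in s -> [set v]%SET \in (K : {set _}).
  move=> sK vs; apply: (simplex_face sK); first by rewrite sub1set.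
  by apply/set0Pn; exists v; rewrite in_set1.
have invE (v0 : V) vs : path (fun u v => (xi [set u]%SET %| xi [set v]%SET)%N) v0 vs ->
    inversion t xi [set v in v0 :: vs]%SET =
    match opposite t with
    | Ascending => xi [set last v0 vs]%SET
    | Descending => xi [set v0]%SET
    end.
  move=> pvs; apply/eqP; rewrite eqn_dvd /inversion; case: (t) => /=.
    apply/andP; split.
      by apply: (biggcdn_inf v0); rewrite // !inE eqxx.
    apply/dvdn_biggcdP => v; rewrite inE in_cons => /orP[/eqP->//|vvs].
    exact: (allP (order_path_min tr pvs)).
  apply/andP; split; last first.
    by apply: (biglcmn_sup (last v0 vs)); rewrite // inE mem_last.
  apply/dvdn_biglcmP => v; rewrite inE.
  elim: vs v0 pvs v => [|v1 vs IH] v0 /=; first by move=> _ v; rewrite mem_seq1 => /eqP->.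
  move=> /andP[v01 pvs] v; rewrite in_cons => /orP[/eqP->|]; last exact: IH.
  exact: dvdn_trans v01 (IH _ pvs _ (mem_head _ _)).
split; last first.
  move=> s /xi_div[v0 [vs [uvs sE pvs _]]]; exists v0, vs; split=> //.
    by apply: (sub_path _ pvs) => u v; rewrite !inversion_set1.
  by rewrite sE invE //; rewrite !inversion_set1.
split=> [s sK|s s' _ _ ss'].
  have [v0 [vs [_ sE pvs _]]] := xi_div _ sK.
  rewrite sE invE //; case: (t) => /=; apply/xi_gt0/(vK _ _ sK); rewrite sE inE ?mem_head //.
  exact: mem_last.
case: (t); rewrite /= /inversion.
  by apply/dvdn_biggcdP => v /(fintype.subsetP ss') vs; apply: (biggcdn_inf v).
by apply/dvdn_biglcmP => v /(fintype.subsetP ss') vs; apply: (biglcmn_sup v).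
Qed.

Section Polyhedra.
Variable R : realType.

Section Realization.
Variables (V : finType) (K : simplicial_complex V).

(* x is given by its barycentric coordinates; the open simplex containing it is
   spanned by the vertices with nonzero coordinate. *)
Definition carrier (x : V -> R) : {set V} := [set v | 0 < x v]%SET.

Definition realization : set {ptws V -> R} :=
  [set x | [/\ forall v, 0 <= x v, \sum_v x v = 1 &
               carrier x \in (K : {set _})]]%classic.

End Realization.

Definition weighted_triangulation (X : topologicalType) (lam : X -> nat)
    (V : finType) (K : simplicial_complex V) (mu : {set V} -> nat) : Prop :=
  exists h : X -> classical_sets.set_type (realization K),
  exists g : classical_sets.set_type (realization K) -> X,
    [/\ continuous h, continuous g, cancel h g, cancel g h &
        forall x, mu (carrier (\val (h x))) = lam x].

Definition weighted_polyhedron (t : wtype) (X : topologicalType)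
    (lam : X -> nat) : Prop :=
  exists (V : finType) (K : simplicial_complex V) (mu : {set V} -> nat),
    is_weight K t mu /\ weighted_triangulation lam K mu.

Record divisible_triangulation (t : wtype) (X : topologicalType)
    (lam : X -> nat) := DivisibleTriangulation {
  dt_vertex : finType;
  dt_complex : simplicial_complex dt_vertex;
  dt_weight : {set dt_vertex} -> nat;
  dt_divisible : is_divisible_weight dt_complex t dt_weight;
  dt_triangulation : weighted_triangulation lam dt_complex dt_weight
}.

Arguments dt_vertex {t X lam} _.
Arguments dt_complex {t X lam} _.
Arguments dt_weight {t X lam} _ _.

Definition AW_homology t (X : topologicalType) (lam : X -> nat)
    (T : divisible_triangulation t lam) (n : nat) : zmodType :=
  match t with
  | Ascending => weighted_homology (dt_complex T) Ascending (dt_weight T) n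
  | Descending =>
      weighted_homology (dt_complex T) Ascending
        (inversion Descending (dt_weight T)) n
  end.

Definition DW_homology t (X : topologicalType) (lam : X -> nat)
    (T : divisible_triangulation t lam) (n : nat) : zmodType :=
  match t with
  | Ascending =>
      weighted_homology (dt_complex T) Descending
        (inversion Ascending (dt_weight T)) n
  | Descending => weighted_homology (dt_complex T) Descending (dt_weight T) n
  end.

Definition unit_interval : Type := classical_sets.set_type `[0%R : R, 1%R]%classic.
HB.instance Definition _ := Topological.on unit_interval.

Section Maps.
Variables (t : wtype) (X X' : topologicalType).
Variables (lam : X -> nat) (lam' : X' -> nat).

Definition W_continuous (f : X -> X') : Prop :=
  continuous f /\
  forall x, match t with
            | Ascending => (lam' (f x) %| lam x)%N
            | Descending => (lam x %| lam' (f x))%N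
            end.

Definition weight_preserving (f : X -> X') : Prop :=
  forall x, lam' (f x) = lam x.

End Maps.

Section Homotopy.
Variables (t : wtype) (X X' : topologicalType).
Variables (lam : X -> nat) (lam' : X' -> nat).

Definition cylinder_weight (p : X * unit_interval) : nat := lam p.1.

Definition homotopy_ends (H : X * unit_interval -> X') (f g : X -> X') : Prop :=
  forall (x : X) (s : unit_interval),
    (\val s = 0 -> H (x, s) = f x) /\ (\val s = 1 -> H (x, s) = g x).

Definition W_homotopic (f g : X -> X') : Prop :=
  exists H : X * unit_interval -> X',
    W_continuous t cylinder_weight lam' H /\ homotopy_ends H f g.

Definition strongly_W_homotopic (f g : X -> X') : Prop :=
  exists H : X * unit_interval -> X',
    [/\ W_continuous t cylinder_weight lam' H,
        weight_preserving cylinder_weight lam' H & homotopy_ends H f g].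

End Homotopy.

Definition W_homotopy_equivalent (t : wtype) (X X' : topologicalType)
    (lam : X -> nat) (lam' : X' -> nat) : Prop :=
  exists (f : X -> X') (g : X' -> X),
    [/\ W_continuous t lam lam' f, W_continuous t lam' lam g,
        W_homotopic t lam lam (g \o f) id &
        W_homotopic t lam' lam' (f \o g) id].

Definition strongly_W_homotopy_equivalent (t : wtype) (X X' : topologicalType)
    (lam : X -> nat) (lam' : X' -> nat) : Prop :=
  exists (f : X -> X') (g : X' -> X),
    [/\ W_continuous t lam lam' f /\ weight_preserving lam lam' f,
        W_continuous t lam' lam g /\ weight_preserving lam' lam g,
        strongly_W_homotopic t lam lam (g \o f) id &
        strongly_W_homotopic t lam' lam' (f \o g) id].

End Polyhedra.

(* Main.v *)
(* Replacing a descending weight xi by M / xi, for a common multiple M, all the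
   weights become ascending: their value on a simplex is the least common multiple
   of vertex weights m.  Multiplying each simplex by its weight then identifies the
   weighted complex with the ordinary simplicial chains, seen as alternating integral
   functions on tuples of vertices, whose value at a simplex is divisible by the
   weights of all its vertices.

   Such a chain is subdivided into small tuples of points of |K|, and these are sent
   by the map f to tuples of points of |K'|.  The divisibility of the chain says that a
   tuple of multiplicity d consists of points with total coordinate 1 on the vertices
   whose weight divides d.  If f respects the least common multiples of vertex
   weights, the same holds for the image; if f only respects the greatest common
   divisors, compactness still gives a lower bound t > 0 for that total coordinate.
   Either way, sending a point to the vertex of least weight among those with a large
   coordinate turns small tuples back into simplices and produces a weighted chain.
   Subdivision, labelling and homotopies are compared with the identity by filling
   tuples inside the convex simplices that carry them, and by prisms; coning off at
   the vertex of least weight preserves the mass bounds. *)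

From HB Require Import structures.
Require Import Defs.
From mathcomp Require Import all_boot all_order all_fingroup all_algebra.
From mathcomp Require Import all_classical all_reals topology normedtype.
From mathcomp Require Import finset.
From mathcomp Require Import zify ring lra.
From mathcomp Require Import -(notations) finmap.
From mathcomp.multinomials Require Import -(notations) monalg.
Import Order.TTheory GRing.Theory Num.Theory numFieldNormedType.Exports.

Set Implicit Arguments.
Unset Strict Implicit.
Unset Printing Implicit Defensive.

Local Open Scope ring_scope.

(** * Free abelian groups on tuples *)

(** When only greatest common divisors are respected, each map may lower the guaranteed mass from a
    level [t] to a smaller one, so no fixed pair of mutually inverse chain maps is at hand. A single
    map [F] is built from [f]; its composites with two maps built from [g] at different levels show
    that [F] is injective and surjective on homology. When least common multiples are respected, the
    same argument runs with all levels equal to 1.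

    The subdivision is not barycentric: the straight contraction of a simplex to its vertex of least
    weight is cut into [N.+1] steps, so that a tuple of length [k] has diameter at most [k / N.+1]
    and no intermediate point falls below its mass bound. Labelling undoes this subdivision exactly,
    by a Sperner argument, so a filling homotopy is needed only for the opposite composite. That
    homotopy fills image tuples inside one simplex, whereas nearby points may lie in simplices
    without a common coface; hence the correction [snap] applied after [f] and [g]. *)

Record free_abelian_group (K : choiceType) := FreeAbelianGroup {
  fag_sort : zmodType;
  fag_gen : K -> fag_sort;
  fag_coef : K -> {additive fag_sort -> int};
  fag_supp : fag_sort -> seq K;
  fag_suppP : forall c, uniq (fag_supp c) /\
    forall k, (k \in fag_supp c) = (fag_coef k c != 0);
  fag_coef_gen : forall k l, fag_coef l (fag_gen k) = (k == l)%:R;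
  fag_sum : forall c, c = \sum_(k <- fag_supp c) fag_gen k *~ fag_coef k c
}.

(* Opaque on purpose: unification must never unfold the finitely supported
   functions underneath. *)
Lemma free_abelian_group_exists (K : choiceType) : free_abelian_group K.
Proof.
apply: (@FreeAbelianGroup K (malg K int) (fun k => mkmalgU k 1) (@mcoeff K int)
  (fun c => finmap.enum_fset (msupp c))) => [c|k l|c].
- by split; [exact: finmap.fset_uniq | move=> k; rewrite mcoeff_neq0].
- by rewrite /= mcoeffU.
rewrite {1}[c]monalgE; apply: eq_bigr => k _.
by rewrite -raddfMz /= intz.
Qed.

Definition freeZ (K : choiceType) : zmodType :=
  fag_sort (free_abelian_group_exists K).

Section LinearExtension.
Variables (K : choiceType) (B : zmodType).
Implicit Types (phi : K -> B) (c : freeZ K).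

Definition gen (k : K) : freeZ K := fag_gen _ k.
Definition coef (k : K) : {additive freeZ K -> int} := fag_coef _ k.
Definition supp c : seq K := fag_supp c.

Lemma mem_supp c k : (k \in supp c) = (coef k c != 0).
Proof. by case: (fag_suppP c) => _ ->. Qed.

Lemma coef_gen (k l : K) : coef l (gen k) = (k == l)%:R.
Proof. exact: fag_coef_gen. Qed.

Lemma freeZ_sum c : c = \sum_(k <- supp c) gen k *~ coef k c.
Proof. exact: fag_sum. Qed.

Definition ext phi c : B := \sum_(k <- supp c) phi k *~ coef k c.

Lemma extw phi c (E : seq K) : uniq E -> {subset supp c <= E} ->
  ext phi c = \sum_(k <- E) phi k *~ coef k c.
Proof.
move=> uE sE; rewrite /ext [RHS](bigID (fun k => k \in supp c)) /=.
rewrite [X in _ + X]big1 ?addr0; last first.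
  by move=> k; rewrite mem_supp negbK => /eqP->; rewrite mulr0z.
rewrite -[RHS]big_filter; apply: perm_big; apply: uniq_perm.
- by case: (fag_suppP c).
- exact: filter_uniq.
move=> k; rewrite mem_filter.
by apply/idP/andP => [kc|[]//]; split=> //; apply: sE.
Qed.

Fact ext_zmod_morphism phi : zmod_morphism (ext phi).
Proof.
move=> c d; set E := undup (supp c ++ supp d).
have uE : uniq E by exact: undup_uniq.
rewrite (@extw _ c E) // ?(@extw _ d E) // ?(@extw _ (c - d) E) //.
- by rewrite -sumrB; apply: eq_bigr => k _; rewrite raddfB mulrzBr.
- move=> k; rewrite mem_undup mem_cat !mem_supp raddfB /=; apply: contraNT.
  by rewrite negb_or !negbK => /andP[/eqP-> /eqP->].
- by move=> k kd; rewrite mem_undup mem_cat kd orbT.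
by move=> k kc; rewrite mem_undup mem_cat kc.
Qed.

HB.instance Definition _ phi :=
  GRing.isZmodMorphism.Build (freeZ K) B (ext phi) (ext_zmod_morphism phi).

Lemma ext_gen phi k : ext phi (gen k) = phi k.
Proof.
rewrite (@extw _ _ [:: k]) // ?big_seq1 ?coef_gen ?eqxx ?mulr1z //.
move=> l; rewrite mem_supp coef_gen mem_seq1 eq_sym.
by have [|] := eqVneq k l.
Qed.

Lemma additive_eq (phi psi : {additive freeZ K -> B}) :
  (forall k, phi (gen k) = psi (gen k)) -> phi =1 psi.
Proof.
move=> e c; rewrite (freeZ_sum c) !raddf_sum; apply: eq_bigr => k _.
by rewrite !raddfMz e.
Qed.

End LinearExtension.

(** Testing equality on integer coefficients is how [ring] is brought to bear on identities between
    chains. *)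
Lemma freeZP (K : choiceType) (c d : freeZ K) :
  c = d <-> forall k, coef k c = coef k d.
Proof.
split=> [->//|e]; apply/eqP; rewrite -subr_eq0 (freeZ_sum (c - d)).
by rewrite big1 // => k _; rewrite raddfB /= e subrr mulr0z.
Qed.

Lemma coefD (K : choiceType) k (c d : freeZ K) : coef k (c + d) = coef k c + coef k d.
Proof. exact: raddfD. Qed.
Lemma coefN (K : choiceType) k (c : freeZ K) : coef k (- c) = - coef k c.
Proof. exact: raddfN. Qed.
Lemma coef0 (K : choiceType) (k : K) : coef k 0 = 0.
Proof. exact: raddf0. Qed.
Lemma coefMz (K : choiceType) k (c : freeZ K) n : coef k (c *~ n) = coef k c *~ n.
Proof. exact: raddfMz. Qed.
Definition coefE := (coef0, coefN, coefD, coefMz).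

(** Lets a known equation [z = t] be used linearly: what remains is a pure ring identity. *)
Lemma eq_from_sub (B : zmodType) (x y z t : B) : z = t -> x - y = z - t -> x = y.
Proof. by move=> -> /eqP; rewrite subrr subr_eq0 => /eqP. Qed.

Section Support.
Variable K : choiceType.
Implicit Types (P Q : K -> Prop) (c : freeZ K).

Definition supported P c := forall k, coef k c != 0 -> P k.

Lemma supportedW P Q c :
  (forall k, P k -> Q k) -> supported P c -> supported Q c.
Proof. by move=> PQ Pc k /Pc/PQ. Qed.

Lemma supported0 P : supported P 0.
Proof. by move=> k; rewrite coef0. Qed.

Lemma supported_gen P k : P k -> supported P (gen k).
Proof.
by move=> Pk l; rewrite coef_gen; have [<-|] := eqVneq k l.
Qed.

Lemma supportedD P c d : supported P c -> supported P d -> supported P (c + d).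
Proof.
move=> Pc Pd k; rewrite raddfD; have [e|/Pc//] := eqVneq (coef k c) 0.
by rewrite e add0r => /Pd.
Qed.

Lemma supportedN P c : supported P c -> supported P (- c).
Proof. by move=> Pc k; rewrite coefN oppr_eq0 => /Pc. Qed.

Lemma supportedB P c d : supported P c -> supported P d -> supported P (c - d).
Proof. by move=> Pc Pd; apply: supportedD => //; apply: supportedN. Qed.

Lemma supportedMz P c n : (n != 0 -> supported P c) -> supported P (c *~ n).
Proof.
move=> Pc k; rewrite coefMz -mulrzr mulf_eq0 negb_or intr_eq0.
by move=> /andP[kc n0]; apply: Pc.
Qed.

Lemma supported_sum P (I : Type) (r : seq I) (p : pred I) F :
  (forall i, p i -> supported P (F i)) -> supported P (\sum_(i <- r | p i) F i).
Proof.
by move=> PF; apply: (big_ind (supported P)); [apply: supported0|apply: supportedD|].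
Qed.

End Support.

Section SupportExt.
Variable K : choiceType.
Implicit Types (P : K -> Prop) (c : freeZ K).

Lemma supported_ext (L : choiceType) (Q : L -> Prop) P (phi : K -> freeZ L) c :
  (forall k, P k -> supported Q (phi k)) -> supported P c ->
  supported Q (ext phi c).
Proof.
by move=> PQ Pc; apply: supported_sum => k _; apply: supportedMz => /Pc/PQ.
Qed.

Lemma supported_additive (L : choiceType) (Q : L -> Prop) P
    (phi : {additive freeZ K -> freeZ L}) c :
  (forall k, P k -> supported Q (phi (gen k))) -> supported P c ->
  supported Q (phi c).
Proof.
move=> PQ Pc; rewrite (freeZ_sum c) raddf_sum; apply: supported_sum => k _.
by rewrite raddfMz; apply: supportedMz => /Pc/PQ.
Qed.

Lemma additive_eq_supported (B : zmodType) P (phi psi : {additive freeZ K -> B}) c :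
  (forall k, P k -> phi (gen k) = psi (gen k)) -> supported P c -> phi c = psi c.
Proof.
move=> e Pc; rewrite (freeZ_sum c) !raddf_sum; apply: eq_big_seq => k.
by rewrite mem_supp => /Pc/e ek; rewrite !raddfMz ek.
Qed.

Lemma eq_ext (B : zmodType) P (phi psi : K -> B) c :
  (forall k, P k -> phi k = psi k) -> supported P c -> ext phi c = ext psi c.
Proof.
move=> e Pc; rewrite /ext; apply: eq_bigr => k _.
by have [->|/Pc/e->//] := eqVneq (coef k c) 0; rewrite !mulr0z.
Qed.

End SupportExt.

(** * Interior products, prisms and contractions on tuples *)

Section Tuples.
Variable Y : choiceType.
Local Notation L := (freeZ (seq Y)).
Implicit Types (s : seq Y) (c : L) (phi psi : Y -> int).

Definition tcons (y : Y) : L -> L := ext (fun s => gen (y :: s)).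
HB.instance Definition _ y := GRing.Additive.on (tcons y).

Fixpoint icut_gen phi s : L :=
  if s is y :: s' then gen s' *~ phi y - tcons y (icut_gen phi s') else 0.

(* Interior product with phi on the tensor algebra. *)
Definition icut phi : L -> L := ext (icut_gen phi).
HB.instance Definition _ phi := GRing.Additive.on (icut phi).

(* The augmented simplicial boundary: a point is sent to the empty tuple. *)
Definition tbdry : L -> L := icut (fun=> 1).
HB.instance Definition _ := GRing.Additive.on tbdry.

Let scalez n : L -> L := fun c => c *~ n.
Fact scalez_zmod_morphism n : zmod_morphism (scalez n).
Proof. by move=> c d; rewrite /scalez mulrzBl. Qed.
HB.instance Definition _ n :=
  GRing.isZmodMorphism.Build L L (scalez n) (scalez_zmod_morphism n).

Lemma icut_genE phi s : icut phi (gen s) = icut_gen phi s.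
Proof. exact: ext_gen. Qed.

Lemma eq_icut phi psi c :
  supported (fun s : seq Y => {in s, phi =1 psi}) c -> icut phi c = icut psi c.
Proof.
apply: eq_ext; elim=> [//|y s IH] /= e; rewrite e ?mem_head // IH // => x xs.
by rewrite e // in_cons xs orbT.
Qed.

Lemma icut_gen_sum (I : finType) (phi : I -> Y -> int) s :
  icut_gen (fun y => \sum_i phi i y) s = \sum_i icut_gen (phi i) s.
Proof.
elim: s => [|y s IH] /=; first by rewrite big1.
by rewrite IH mulrz_sumr sumrB (raddf_sum (tcons y)).
Qed.

(** An interior product is linear in its covector, so a partition of unity splits the boundary
    [icut (fun=> 1)] into one cut per vertex; [eval_tbdry] rests on this. *)
Lemma icut_sum (I : finType) (phi : I -> Y -> int) c :
  icut (fun y => \sum_i phi i y) c = \sum_i icut (phi i) c.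
Proof.
rewrite /icut /ext exchange_big /=; apply: eq_bigr => s _.
by rewrite icut_gen_sum mulrz_suml.
Qed.

Lemma tcons_supp P (Q : seq Y -> Prop) y c :
  (forall s, P s -> Q (y :: s)) -> supported P c -> supported Q (tcons y c).
Proof. by move=> PQ; apply: supported_ext => s /PQ; apply: supported_gen. Qed.

Lemma tcons_gen y s : tcons y (gen s) = gen (y :: s).
Proof. exact: ext_gen. Qed.

Lemma icut_gen0 phi : icut phi (gen [::]) = 0.
Proof. exact: ext_gen. Qed.

Lemma icut_cons phi y c : icut phi (tcons y c) = c *~ phi y - tcons y (icut phi c).
Proof.
suff : icut phi \o tcons y =1 scalez (phi y) \- (tcons y \o icut phi) by apply.
apply: additive_eq => s /=; by rewrite tcons_gen !icut_genE.
Qed.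

Lemma tbdry_cons y c : tbdry (tcons y c) = c - tcons y (tbdry c).
Proof. by rewrite [LHS]icut_cons mulr1z. Qed.

Lemma icutB phi c d : icut phi (c - d) = icut phi c - icut phi d.
Proof. exact: raddfB. Qed.

Lemma icutMz phi c n : icut phi (c *~ n) = icut phi c *~ n.
Proof. exact: raddfMz. Qed.

Lemma tconsB y c d : tcons y (c - d) = tcons y c - tcons y d.
Proof. exact: raddfB. Qed.

Lemma tconsMz y c n : tcons y (c *~ n) = tcons y c *~ n.
Proof. exact: raddfMz. Qed.

Lemma tconsN y c : tcons y (- c) = - tcons y c.
Proof. exact: raddfN. Qed.

(** Contractions by covectors anticommute, as in the exterior algebra. Equal covectors give
    [tbdry_tbdry]; two labels make [eval_vertices] alternating. *)
Lemma icut_anti phi psi c : icut phi (icut psi c) = - icut psi (icut phi c).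
Proof.
suff : icut phi \o icut psi =1 -%R \o (icut psi \o icut phi) by apply.
apply: additive_eq; elim=> [|y s IH] /=; first by rewrite !icut_gen0 !raddf0.
rewrite -tcons_gen !icut_cons !icutB !icutMz !icut_cons.
move: IH => /= ->; rewrite tconsN.
by apply/freeZP => k; rewrite !coefE; ring.
Qed.

Lemma icut_supp phi s :
  supported (fun t : seq Y => [/\ {subset t <= s}, (size t).+1 = size s &
                          exists2 y, y \in s & phi y != 0]) (icut phi (gen s)).
Proof.
rewrite icut_genE; elim: s => [|y s IH] /=; first exact: supported0.
apply: supportedB.
  apply: supportedMz => py; apply: supported_gen; split=> //.
    by move=> x; rewrite in_cons orbC => ->.
  by exists y; rewrite ?mem_head.
apply: tcons_supp IH => t [ts st [x xs px]]; split.
- move=> z; rewrite !in_cons => /orP[->//|/ts->]; exact: orbT.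
- by rewrite /= st.
by exists x; rewrite // in_cons xs orbT.
Qed.

End Tuples.

Arguments tbdry {Y} c.

Section TupleMaps.
Variables Y Z : choiceType.
Local Notation L Y := (freeZ (seq Y)).
Implicit Types (f : Y -> Z) (s : seq Y) (c : L Y).

Definition tmap f : L Y -> L Z := ext (fun s => gen (map f s)).
HB.instance Definition _ f := GRing.Additive.on (tmap f).

Lemma tmap_gen f s : tmap f (gen s) = gen (map f s).
Proof. exact: ext_gen. Qed.

Lemma eq_tmap f g c :
  supported (fun s : seq Y => {in s, f =1 g}) c -> tmap f c = tmap g c.
Proof. by apply: eq_ext => s /eq_in_map ->. Qed.

Lemma tmap_cons f y c : tmap f (tcons y c) = tcons (f y) (tmap f c).
Proof.
suff : tmap f \o tcons y =1 tcons (f y) \o tmap f by apply.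
by apply: additive_eq => s /=; rewrite tcons_gen !tmap_gen tcons_gen.
Qed.

Lemma icut_tmap f phi c : icut phi (tmap f c) = tmap f (icut (phi \o f) c).
Proof.
suff : icut phi \o tmap f =1 tmap f \o icut (phi \o f) by apply.
apply: additive_eq; elim=> [|y s IH] /=; first by rewrite tmap_gen !icut_gen0 raddf0.
rewrite -tcons_gen tmap_cons !icut_cons !raddfB /= raddfMz /= tmap_cons.
by move: IH => /= ->.
Qed.

Lemma tbdry_tmap f c : tbdry (tmap f c) = tmap f (tbdry c).
Proof. exact: icut_tmap. Qed.

(** The usual prism operator: the alternating sum over i of the tuples f y_0, ..., f y_i, g y_i,
    ..., g y_k. *)
Fixpoint prism_gen f g s : L Z :=
  if s is y :: s' then
    gen [:: f y, g y & map g s'] - tcons (f y) (prism_gen f g s')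
  else 0.

Definition prism f g : L Y -> L Z := ext (prism_gen f g).
HB.instance Definition _ f g := GRing.Additive.on (prism f g).

Lemma prism0 f g : prism f g (gen [::]) = 0.
Proof. exact: ext_gen. Qed.

Lemma prism_cons f g y c :
  prism f g (tcons y c) =
  tcons (f y) (tcons (g y) (tmap g c)) - tcons (f y) (prism f g c).
Proof.
suff : prism f g \o tcons y =1
  (tcons (f y) \o (tcons (g y) \o tmap g)) \- (tcons (f y) \o prism f g) by apply.
apply: additive_eq => s /=.
by rewrite tcons_gen tmap_gen !tcons_gen /prism !ext_gen.
Qed.

Lemma tbdry_prism f g c :
  tbdry (prism f g c) + prism f g (tbdry c) = tmap g c - tmap f c.
Proof.
suff : (tbdry \o prism f g) \+ (prism f g \o tbdry) =1 tmap g \- tmap f by apply.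
apply: additive_eq; elim=> [|y s IH] /=.
  by rewrite prism0 !tmap_gen /tbdry icut_gen0 !raddf0 addr0 subrr.
rewrite -tcons_gen prism_cons tbdry_cons !tmap_cons !raddfB /= !tbdry_cons.
rewrite prism_cons tbdry_tmap !tconsB.
move: IH => /= /(congr1 (tcons (f y))).
rewrite tconsB (raddfD (tcons (f y))) /= => /freeZP E.
by apply/freeZP => k; apply: eq_from_sub (E k) _; rewrite !coefE; ring.
Qed.

End TupleMaps.

Lemma tmap_id (Y : choiceType) (c : freeZ (seq Y)) : tmap id c = c.
Proof.
have /= := @additive_eq _ _ (tmap id) (idfun : {additive freeZ (seq Y) -> freeZ (seq Y)}).
by apply=> s; rewrite tmap_gen map_id.
Qed.

Lemma tmap_comp (X Y Z : choiceType) (f : X -> Y) (g : Y -> Z) (c : freeZ (seq X)) :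
  tmap g (tmap f c) = tmap (g \o f) c.
Proof.
have /= := @additive_eq _ _ (tmap g \o tmap f) (tmap (g \o f)).
by apply=> s /=; rewrite !tmap_gen map_comp.
Qed.

Lemma prism_supp (Y Z : choiceType) (f g : Y -> Z) (s : seq Y) :
  supported (fun t : seq Z => size t = (size s).+1 /\
    forall z, z \in t -> exists2 y, y \in s & z = f y \/ z = g y)
  (prism f g (gen s)).
Proof.
rewrite /prism ext_gen; elim: s => [|y s IH] /=; first exact: supported0.
apply: supportedB.
  apply: supported_gen; split; first by rewrite /= size_map.
  move=> z; rewrite !in_cons => /orP[/eqP->|/orP[/eqP->|/mapP[x xs ->]]].
  - by exists y; rewrite ?mem_head //; left.
  - by exists y; rewrite ?mem_head //; right.
  by exists x; rewrite ?in_cons ?xs ?orbT //; right.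
apply: supported_ext IH => t [ts th]; apply: supported_gen; split.
  by rewrite /= ts.
move=> z; rewrite in_cons => /orP[/eqP->|/th[x xs zx]].
  by exists y; rewrite ?mem_head //; left.
by exists x; rewrite // in_cons xs orbT.
Qed.

(** A contraction anticommutes with itself, so each coefficient equals its opposite, and the
    integers have no 2-torsion. *)
Lemma tbdry_tbdry (Y : choiceType) (c : freeZ (seq Y)) : tbdry (tbdry c) = 0.
Proof.
have /freeZP e := icut_anti (fun=> 1) (fun=> 1) c.
apply/freeZP => s; rewrite coef0; apply/eqP.
by move: (e s); rewrite coefN => /eqP; rewrite -addr_eq0 -mulr2n mulrn_eq0.
Qed.

Section Contraction.
Variables (Y : choiceType) (theta : nat -> Y -> Y) (N : nat) (e : Y).
Local Notation L := (freeZ (seq Y)).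

(** The prisms deform every tuple to a constant tuple at [e], which is not zero; prefixing [e]
    contracts the constant tuples, down to the empty one. Passing through all the [theta i] rather
    than in one step keeps the entries of a tuple close to each other. *)
Definition contraction (c : L) : L :=
  tcons e (tmap (fun=> e) c) - \sum_(i < N) prism (theta i) (theta i.+1) c.

Fact contraction_zmod_morphism : zmod_morphism contraction.
Proof.
move=> c d; rewrite /contraction !raddfB /=.
under eq_bigr do rewrite raddfB.
by rewrite sumrB; apply/freeZP => k; rewrite !coefE; ring.
Qed.
HB.instance Definition _ :=
  GRing.isZmodMorphism.Build L L contraction contraction_zmod_morphism.

Lemma tbdry_contraction c : theta 0%N =1 id -> theta N =1 (fun=> e) ->
  tbdry (contraction c) + contraction (tbdry c) = c.
Proof.
move=> /funext th0 /funext thN.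
rewrite /contraction raddfB /= tbdry_cons tbdry_tmap (raddf_sum (@tbdry Y)) /=.
set S := \sum_i _; set S' := \sum_i _.
have /freeZP E : S + S' = tmap (fun=> e) c - c.
  rewrite -big_split /= (eq_bigr (fun i : 'I_N => tmap (theta i.+1) c - tmap (theta i) c)).
    rewrite -(big_mkord xpredT (fun i => tmap (theta i.+1) c - tmap (theta i) c)).
    rewrite telescope_sumr //.
    by rewrite th0 thN tmap_id.
  by move=> i _; rewrite tbdry_prism.
by apply/freeZP => k; apply: eq_from_sub (esym (E k)) _; rewrite !coefE; ring.
Qed.

End Contraction.

(** * Alternating functions and subdivision *)

Section Alternating.
Variable V : finType.
Implicit Types (a b : seq V -> int) (s t u : seq V) (sigma : {set V}).

Definition alternating a := forall s x y t,
  a (s ++ [:: x, y & t]) = - a (s ++ [:: y, x & t]).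

Lemma alternating0 : alternating 0.
Proof. by move=> s x y t; rewrite oppr0. Qed.

Lemma alternatingB a b : alternating a -> alternating b -> alternating (a - b).
Proof. by move=> aa ab s x y t; rewrite !fctE aa ab opprB addrC opprK. Qed.

Lemma alternating_move_front a s x t u : alternating a ->
  a (s ++ t ++ x :: u) = 0 -> a (s ++ x :: t ++ u) = 0.
Proof.
move=> aa; elim: t s => [//|y t IH] s /= e.
rewrite aa; apply/eqP; rewrite oppr_eq0; apply/eqP.
by have := IH (rcons s y); rewrite -!cats1 -!catA /=; apply.
Qed.

Lemma alternating_perm a s t : alternating a -> perm_eq s t -> a t = 0 -> a s = 0.
Proof.
move=> aa; suff H u : perm_eq s t -> a (u ++ t) = 0 -> a (u ++ s) = 0 by apply: (H [::]).
elim: s t u => [|x s IH] t u; first by rewrite perm_sym => /perm_nilP ->.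
move=> st; have /splitPr xt : x \in t by rewrite -(perm_mem st) mem_head.
case: t / xt st => t1 t2 st at0.
have st' : perm_eq s (t1 ++ t2).
  by move: st; rewrite perm_sym -cat1s perm_catCA /= perm_cons perm_sym.
have := IH _ (rcons u x) st'; rewrite -!cats1 -!catA /=; apply.
exact: alternating_move_front.
Qed.

Lemma alternating_dup a x s : alternating a -> a [:: x, x & s] = 0.
Proof.
move=> aa; apply/eqP; have /eqP := aa [::] x x s.
by rewrite -addr_eq0 -mulr2n mulrn_eq0.
Qed.

Lemma alternating_uniq a s : alternating a -> a s != 0 -> uniq s.
Proof.
move=> aa; apply: contraNT => us.
suff [x [s' p]] : exists x s', perm_eq s [:: x, x & s'].
  by rewrite (alternating_perm aa p) // alternating_dup.
elim: s us => [//|y s IH] /=; rewrite negb_and negbK => /orP[/splitPr[s1 s2]|/IH[x [s' p]]].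
  by exists y, (s1 ++ s2); rewrite perm_cons (perm_catCA s1 [:: y] s2).
exists x, (y :: s'); apply: (@perm_trans _ (y :: [:: x, x & s'])); first by rewrite perm_cons.
by rewrite (perm_catCA [:: y] [:: x; x] s').
Qed.

End Alternating.

Section Cochains.
Variable V : finType.
Local Notation cochain := (seq V -> int).
Implicit Types (a b : cochain) (s t u : seq V) (sigma : {set V}).

(** For a chain given by its alternating coefficients, every simplex with face [u] can be ordered as
    [v :: u], where the face has sign +1. At the empty tuple this is the augmentation. *)
Definition fbdry a : cochain := fun u => \sum_v a (v :: u).

Fact fbdry_zmod_morphism : zmod_morphism fbdry.
Proof. by move=> a b; apply/funext => u; rewrite !fctE /fbdry -sumrB. Qed.
HB.instance Definition _ :=
  GRing.isZmodMorphism.Build cochain cochain fbdry fbdry_zmod_morphism.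

Definition restr sigma a : cochain :=
  fun u => if [set v in u]%SET == sigma then a u else 0.

Fact restr_zmod_morphism sigma : zmod_morphism (restr sigma).
Proof.
by move=> a b; apply/funext => u; rewrite !fctE /restr; case: ifP; rewrite ?subr0.
Qed.
HB.instance Definition _ sigma :=
  GRing.isZmodMorphism.Build cochain cochain (restr sigma) (restr_zmod_morphism sigma).

Definition at_tuple u : cochain -> int := fun a => a u.
Fact at_tuple_zmod_morphism u : zmod_morphism (at_tuple u).
Proof. by move=> a b; rewrite /at_tuple !fctE. Qed.
HB.instance Definition _ u :=
  GRing.isZmodMorphism.Build cochain int (at_tuple u) (at_tuple_zmod_morphism u).

Lemma fct_sumE (I : Type) (r : seq I) (p : pred I) (F : I -> cochain) u :
  (\sum_(i <- r | p i) F i) u = \sum_(i <- r | p i) F i u.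
Proof. exact: (raddf_sum (at_tuple u)). Qed.

Lemma fctMz a n u : (a *~ n) u = a u *~ n.
Proof. exact: (raddfMz (at_tuple u)). Qed.

Lemma sum_restr a : \sum_sigma restr sigma a = a.
Proof.
apply/funext => u; rewrite fct_sumE (bigD1 [set v in u]%SET) //= /restr eqxx.
by rewrite big1 ?addr0 // => sigma; rewrite eq_sym => /negbTE ->.
Qed.

Lemma alternating_fbdry a : alternating a -> alternating (fbdry a).
Proof.
move=> aa s x y t; rewrite /fbdry -sumrN; apply: eq_bigr => v _.
exact: (aa (v :: s)).
Qed.

Lemma alternating_restr sigma a : alternating a -> alternating (restr sigma a).
Proof.
move=> aa s x y t; rewrite /restr aa.
have -> : [set v in s ++ [:: x, y & t]]%SET = [set v in s ++ [:: y, x & t]]%SET.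
  by apply/setP => v; rewrite !inE !mem_cat !in_cons; do !bool_congr.
by case: ifP; rewrite ?oppr0.
Qed.

Lemma fbdry_fbdry a : alternating a -> fbdry (fbdry a) = 0.
Proof.
move=> aa; apply/funext => u; apply/eqP; rewrite /fbdry.
set S := \sum_v _; suff : S = - S by move/eqP; rewrite -addr_eq0 -mulr2n mulrn_eq0.
rewrite {1}/S exchange_big /= -sumrN; apply: eq_bigr => v _; rewrite -sumrN.
by apply: eq_bigr => w _; apply: (aa [::]).
Qed.

End Cochains.

Section Subdivision.
Variables (V : finType) (Y : choiceType).
Local Notation cochain := (seq V -> int).
Local Notation L := (freeZ (seq Y)).
Variable h : {set V} -> {additive L -> L}.
Hypothesis tbdry_h : forall sigma c, tbdry (h sigma c) + h sigma (tbdry c) = c.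
Implicit Types (a b : cochain) (sigma : {set V}).

(** Each simplex is replaced by the cone over its subdivided boundary. The recursion starts from the
    empty tuple, so vertices arise as cones over it. *)
Fixpoint sd k a : L :=
  if k is k'.+1 then \sum_sigma h sigma (sd k' (fbdry (restr sigma a)))
  else gen [::] *~ a [::].

Fact sd_zmod_morphism k : zmod_morphism (sd k).
Proof.
elim: k => [|k IH] a b /=; first by rewrite mulrzBr.
by rewrite -sumrB; apply: eq_bigr => sigma _; rewrite !raddfB /= IH raddfB.
Qed.
HB.instance Definition _ k :=
  GRing.isZmodMorphism.Build cochain L (sd k) (sd_zmod_morphism k).

Lemma tbdry_h' sigma c : tbdry (h sigma c) = c - h sigma (tbdry c).
Proof. by apply/eqP; rewrite eq_sym subr_eq tbdry_h. Qed.

Lemma tbdry_sd0 a : tbdry (sd 0 a) = 0.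
Proof. by rewrite raddfMz /= [tbdry _]icut_gen0 mul0rz. Qed.

Lemma sdS k a : sd k.+1 a = \sum_sigma h sigma (sd k (fbdry (restr sigma a))).
Proof. by []. Qed.

Arguments sd : simpl never.

(** The boundary of a cone is its base minus the cone over the boundary of the base; by induction
    the latter subdivides [fbdry (fbdry _)], which is 0. *)
Lemma tbdry_sd k a : alternating a -> tbdry (sd k.+1 a) = sd k (fbdry a).
Proof.
have split m b : sd m (fbdry b) = \sum_sigma sd m (fbdry (restr sigma b)).
  by rewrite -{1}(sum_restr b) (raddf_sum (@fbdry V)) (raddf_sum (sd m)).
elim: k a => [|k IH] a aa; rewrite sdS (raddf_sum (@tbdry Y)) split;
  apply: eq_bigr => sigma _; rewrite /= tbdry_h'.
  by rewrite (tbdry_sd0 (fbdry _)) raddf0 subr0.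
have ab := alternating_restr sigma aa.
by rewrite (IH _ (alternating_fbdry ab)) fbdry_fbdry // (raddf0 (sd k)) (raddf0 (h sigma)) subr0.
Qed.

Variable chi : V -> Y -> int.

Definition tcut (u : seq V) (c : L) : L := foldl (fun c v => icut (chi v) c) c u.

Fact tcut_zmod_morphism u : zmod_morphism (tcut u).
Proof. by elim: u => [|v u IH] c d //=; rewrite raddfB /= IH. Qed.
HB.instance Definition _ u :=
  GRing.isZmodMorphism.Build L L (tcut u) (tcut_zmod_morphism u).

(** On a tuple of points s this is the determinant of the values of chi u_i at s_j, as [eval_det]
    shows for [delta]. When every point has a single label, it is the alternating function of the
    tuple of labels, and 0 if a label repeats. *)
Definition eval_vertices (c : L) : cochain := fun u => coef [::] (tcut u c).

Fact eval_zmod_morphism : zmod_morphism eval_vertices.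
Proof.
by move=> c d; apply/funext => u; rewrite !fctE /eval_vertices !raddfB.
Qed.
HB.instance Definition _ :=
  GRing.isZmodMorphism.Build L cochain eval_vertices eval_zmod_morphism.

Lemma alternating_eval c : alternating (eval_vertices c).
Proof.
move=> s x y t; rewrite /eval_vertices /tcut !foldl_cat /=.
by rewrite icut_anti -!/(tcut _ _) !raddfN.
Qed.

(** Since the [chi v] add up to 1 at the points involved, cutting by 1 amounts to summing the first
    cut over all vertices. *)
Lemma eval_tbdry c :
  supported (fun s : seq Y => forall y, y \in s -> \sum_v chi v y = 1) c ->
  eval_vertices (tbdry c) = fbdry (eval_vertices c).
Proof.
move=> cs; apply/funext => u; rewrite /fbdry /eval_vertices /=.
rewrite -[RHS](raddf_sum (coef [::])) -(raddf_sum (tcut u)) /= -icut_sum.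
congr (coef _ (tcut _ _)); apply: eq_icut.
by apply: supportedW cs => s e y /e ->.
Qed.

Lemma eval_gen_supp s u : eval_vertices (gen s) u != 0 ->
  size u = size s /\ forall v, v \in u -> exists2 y, y \in s & chi v y != 0.
Proof.
elim: u s => [|v u IH] s; rewrite /eval_vertices /=.
  by rewrite coef_gen; have [->|] := eqVneq s [::].
rewrite [icut _ _]freeZ_sum.
have := @icut_supp _ (chi v) s; set c := icut _ _ => cs.
rewrite !raddf_sum /= => /eqP ne.
have [t tc tn] : exists2 t, coef t c != 0 & eval_vertices (gen t) u != 0.
  apply: contra_notP ne => n; rewrite big1_seq // => t /andP[_ tc].
  rewrite raddfMz /= raddfMz /= -[coef [::] (tcut _ _)]/(eval_vertices (gen t) u).
  have [->|tn] := eqVneq (eval_vertices (gen t) u) 0; first by rewrite mul0rz.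
  by case: n; exists t; rewrite // -mem_supp.
have [ts st [y ys py]] := cs _ tc.
have [su su'] := IH _ tn.
split; first by rewrite su.
move=> w; rewrite in_cons => /orP[/eqP->|/su'[z zt zw]]; first by exists y.
by exists z; rewrite ?ts.
Qed.

End Subdivision.
Arguments sd : simpl never.

(** * Carriers, the Sperner argument and filling of tuples *)

Section Carriers.
Variables (V : finType) (Y : choiceType) (K : simplicial_complex V).
Local Notation cochain := (seq V -> int).
Local Notation L := (freeZ (seq Y)).
Variable h : {set V} -> {additive L -> L}.
Hypothesis tbdry_h : forall sigma c, tbdry (h sigma c) + h sigma (tbdry c) = c.
Implicit Types (a b : cochain) (sigma tau : {set V}).

Variables (G : {set V} -> Prop) (C : {set V} -> nat -> seq Y -> Prop).
Hypothesis G_sub : forall sigma tau, G sigma -> tau \subset sigma ->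
  tau != finset.set0 -> G tau.
Hypothesis C_nil : forall sigma, C sigma 0 [::].
Hypothesis C_sub : forall sigma tau k s, tau \subset sigma -> C tau k s -> C sigma k s.
Hypothesis hC : forall sigma k c, G sigma -> supported (C sigma k) c ->
  supported (C sigma k.+1) (h sigma c).

Lemma restr_eq0 sigma a : (forall u, [set v in u]%SET = sigma -> a u = 0) ->
  restr sigma a = 0.
Proof. by move=> e; apply/funext => u; rewrite /restr; case: eqP => [/e|]. Qed.

Lemma fbdry_neq0 a u : fbdry a u != 0 -> exists v, a (v :: u) != 0.
Proof.
rewrite /fbdry => au; apply/existsP; apply: contraNT au; rewrite negb_exists.
by move=> /forallP n; rewrite big1 // => v _; apply/eqP/negPn.
Qed.

(** [G] marks the simplices in which coning is allowed, [C sigma k] the tuples permitted in [sigma];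
    the former passes to faces, the latter to cofaces. The empty [sigma] is exempted from [G]
    because nothing is coned there. *)
Lemma sd_carried sigma k a : (sigma != finset.set0 -> G sigma) ->
  (forall u, a u != 0 -> [set v in u]%SET \subset sigma) ->
  supported (C sigma k) (sd h k a).
Proof.
elim: k a sigma => [|k IH] a sigma Gs as_.
  by apply: supportedMz => _; apply: supported_gen.
rewrite sdS; apply: supported_sum => tau _.
have [tn|tn] := eqVneq tau finset.set0.
  suff -> : fbdry (restr tau a) = 0 by rewrite (raddf0 (sd h k)) (raddf0 (h tau)); apply: supported0.
  apply/funext => u; rewrite /fbdry big1 // => v _; rewrite /restr tn.
  by case: eqP => // /setP/(_ v); rewrite !inE eqxx.
have [ts|ts] := boolP (tau \subset sigma); last first.
  rewrite restr_eq0 ?(raddf0 (@fbdry V)) ?(raddf0 (sd h k)) ?(raddf0 (h tau)).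
    exact: supported0.
  by move=> u ut; apply/eqP; apply: contraNT ts => /as_; rewrite ut.
have sn : sigma != finset.set0.
  by apply: contraNneq tn => s0; rewrite -subset0 -s0.
have Gt : G tau by apply: G_sub ts tn; apply: Gs.
apply: (supportedW (fun t => C_sub ts)); apply: (hC Gt); apply: IH => // u.
move=> bu; have [v] := fbdry_neq0 bu.
rewrite /restr; case: ifP => [/eqP <- _|]; last by rewrite eqxx.
by apply/fintype.subsetP => w; rewrite !inE => ->; rewrite orbT.
Qed.

Section Evaluation.
Variable chi : V -> Y -> int.
Hypothesis G_simplex : forall sigma, sigma \in (K : {set _}) -> G sigma.
Hypothesis C_size : forall sigma k s, C sigma k s -> size s = k.
Hypothesis C_chi : forall sigma k s, sigma \in (K : {set _}) -> C sigma k s ->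
  forall y, y \in s -> \sum_v chi v y = 1 /\ forall v, chi v y != 0 -> v \in sigma.

Lemma eval_carried sigma k c u : sigma \in (K : {set _}) ->
  supported (C sigma k) c -> eval_vertices chi c u != 0 ->
  size u = k /\ [set v in u]%SET \subset sigma.
Proof.
move=> sK Cc; rewrite {1}(freeZ_sum c) (raddf_sum (eval_vertices chi)) fct_sumE /= => ne.
have [t tc tn] : exists2 t, coef t c != 0 & eval_vertices chi (gen t) u != 0.
  apply: contraPP ne => n; apply/negP; rewrite negbK big1_seq // => t /andP[_ tc].
  rewrite raddfMz fctMz /=.
  have [->|tn] := eqVneq (eval_vertices chi (gen t) u) 0; first by rewrite mul0rz.
  by case: n; exists t; rewrite // -mem_supp.
have [us uP] := eval_gen_supp tn; have Ct := Cc _ tc.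
split; first by rewrite us (C_size Ct).
apply/fintype.subsetP => v; rewrite inE => /uP[y yt cy].
by have [_] := C_chi sK Ct yt; apply.
Qed.

(** Sperner's lemma for chains. On one simplex the defect between the labelled subdivision and the
    original is an alternating function supported on the orderings of that simplex; by induction its
    boundary vanishes, and then so does the defect. *)
Lemma eval_sd k a : alternating a ->
  (forall u, a u != 0 -> size u = k /\
     (u != [::] -> [set v in u]%SET \in (K : {set _}))) ->
  eval_vertices chi (sd h k a) = a.
Proof.
elim: k a => [|k IH] a aa aK.
  apply/funext => u; rewrite /sd /= (raddfMz (eval_vertices chi)) fctMz /=.
  rewrite /eval_vertices; case: u => [|v u] /=.
    by rewrite coef_gen intz.
  rewrite icut_gen0 raddf0 /= raddf0 mul0rz; apply/esym/eqP.
  by apply: contraT => /aK[].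
rewrite -{1}(sum_restr a) (raddf_sum (sd h k.+1)) (raddf_sum (eval_vertices chi)) /=.
rewrite -[RHS]sum_restr; apply: eq_bigr => sigma _.
set b := restr sigma a.
have [b0|bn] := eqVneq b 0.
  by rewrite b0 (raddf0 (sd h k.+1)) (raddf0 (eval_vertices chi)).
have ab : alternating b by apply: alternating_restr.
have bE u : b u != 0 -> size u = k.+1 /\ [set v in u]%SET = sigma.
  rewrite /b /restr; case: ifP => [/eqP us|]; last by rewrite eqxx.
  by move=> /aK[].
have [u0 bu0] : exists u, b u != 0.
  apply: contrapT => n; case/eqP: bn; apply/funext => u.
  by apply/eqP; apply: contrapT => /negP bu; apply: n; exists u.
have [us0 us] := bE _ bu0.
have sK : sigma \in (K : {set _}).
  move: bu0; rewrite /b /restr us eqxx => /aK[_]; rewrite us; apply.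
  by rewrite -size_eq0 us0.
have scard : #|sigma| = k.+1.
  by rewrite -us0 -us cardsE; apply/card_uniqP; exact: alternating_uniq ab bu0.
set d := eval_vertices chi (sd h k.+1 b) - b.
have ad : alternating d by apply: alternatingB => //; exact: alternating_eval.
have dE u : d u != 0 -> uniq u /\ u =i sigma.
  move=> du; have uu := alternating_uniq ad du.
  have [su ss] : size u = k.+1 /\ [set v in u]%SET \subset sigma.
    have [bu|bu] := eqVneq (b u) 0; last by have [? ->] := bE _ bu.
    move: du; rewrite /d !fctE bu subr0; apply: eval_carried => //.
    by apply: sd_carried => // [_|v /bE[_ ->]//]; exact: G_simplex.
  split=> // v; have <- : [set w in u]%SET = sigma by apply/eqP;
    rewrite eqEcard ss scard cardsE (card_uniqP uu) su /=.
  by rewrite inE.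
have d0 : fbdry d = 0.
  rewrite (raddfB (@fbdry V)) /= -eval_tbdry; last first.
    have : supported (C sigma k.+1) (sd h k.+1 b).
      by apply: sd_carried => // [_|v /bE[_ ->]//]; exact: G_simplex.
    by apply: supportedW => t Ct y yt; have [] := C_chi sK Ct yt.
  rewrite tbdry_sd // IH ?subrr //; first exact: alternating_fbdry.
  move=> u /fbdry_neq0[v /bE[[su] us1]]; split=> // un.
  apply: (simplex_face sK); first by rewrite -us1; apply/fintype.subsetP => w; rewrite !inE => ->; rewrite orbT.
  by case: u un {su us1} => // w u _; apply/set0Pn; exists w; rewrite !inE eqxx.
apply/eqP; rewrite -subr_eq0 -/d; apply/eqP/funext => u.
case: u => [|v u].
  apply/eqP; apply: contraT => /dE[_ e].
  by move: scard; rewrite -(eq_card e) card0.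
apply/eqP; apply: contraT => dvu; have [/= /andP[vu uu] eu] := dE _ dvu.
have /(congr1 (fun f : cochain => f u)) := d0.
(* The tuple [u] lists all vertices of [sigma] except [v], so [d (v :: u)] is the only nonzero term
   of the boundary at [u]. *)
rewrite /fbdry (bigD1 v) //= big1 ?addr0; first by move=> e; rewrite e eqxx in dvu.
move=> w wv; apply/eqP; apply: contraT => /dE[_ ew].
have : v \in w :: u by rewrite ew -eu mem_head.
by rewrite in_cons (negbTE vu) orbF eq_sym (negbTE wv).
Qed.

Variable Car : seq Y -> {set V}.

(* Chain homotopy from the identity to sd \o eval, filling each tuple s inside
   the simplex Car s. *)
Fixpoint fill_gen k (s : seq Y) : L :=
  if k is k'.+1 then
    h (Car s) (gen s - sd h k (eval_vertices chi (gen s))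
               - ext (fill_gen k') (tbdry (gen s)))
  else 0.
Definition fill k : L -> L := ext (fill_gen k).
HB.instance Definition _ k := GRing.Additive.on (fill k).

Lemma fill_genE k s : fill k (gen s) = fill_gen k s.
Proof. exact: ext_gen. Qed.

Lemma fill0 c : fill 0 c = 0.
Proof. by rewrite /fill /ext big1 // => s _; rewrite mul0rz. Qed.

Lemma fillS k s : fill k.+1 (gen s) =
  h (Car s) (gen s - sd h k.+1 (eval_vertices chi (gen s)) - fill k (tbdry (gen s))).
Proof. by rewrite fill_genE. Qed.

Definition normalized (s : seq Y) := forall y, y \in s -> \sum_v chi v y = 1.

(** The acyclic carrier argument: by induction the chain coned in [fillS] is a cycle. In length 0
    both sides vanish, because labelling followed by subdivision fixes the empty tuple. *)
Lemma tbdry_fill k c :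
  supported (fun s => size s = k /\ normalized s) c ->
  tbdry (fill k c) + fill k.-1 (tbdry c) = c - sd h k (eval_vertices chi c).
Proof.
elim: k c => [|k IH] c cs;
  [pose phi : {additive L -> L} := (tbdry \o fill 0) \+ (fill 0 \o tbdry);
   pose psi : {additive L -> L} := idfun \- (sd h 0 \o eval_vertices chi)
  |pose phi : {additive L -> L} := (tbdry \o fill k.+1) \+ (fill k \o tbdry);
   pose psi : {additive L -> L} := idfun \- (sd h k.+1 \o eval_vertices chi)];
  (suff : phi c = psi c by []); apply: additive_eq_supported cs => s [sk s1];
  rewrite /phi /psi /=.
  rewrite !fill0 raddf0 add0r; case: s sk {s1} => // _.
  by rewrite /sd /eval_vertices /= coef_gen eqxx mulr1z subrr.
have ts : supported (fun s => size s = k /\ normalized s) (tbdry (gen s)).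
  apply: supportedW (@icut_supp _ _ s) => t [ts [st] _]; split=> [|y /ts/s1//].
  by move: st; rewrite sk => -[].
rewrite fillS (tbdry_h' tbdry_h) !(raddfB (@tbdry Y)) /= (tbdry_sd tbdry_h); last exact: alternating_eval.
rewrite -eval_tbdry; last exact: supported_gen.
have := IH _ ts; rewrite tbdry_tbdry raddf0 addr0 => ->.
by rewrite subrr raddf0 subr0 subrK.
Qed.

Variable P : seq Y -> Prop.
Hypothesis P_sub : forall s t, {subset t <= s} -> P s -> P t.
Hypothesis Car_sub : forall s t : seq Y, {subset t <= s} -> Car t \subset Car s.
Hypothesis P_G : forall s, P s -> s != [::] -> G (Car s).
Hypothesis P_C : forall s, P s -> s != [::] -> C (Car s) (size s) s.
Hypothesis P_sd : forall s, P s -> s != [::] ->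
  supported (C (Car s) (size s)) (sd h (size s) (eval_vertices chi (gen s))).

Lemma fill_carried k s : size s = k -> P s ->
  supported (C (Car s) k.+1) (fill k (gen s)).
Proof.
elim: k s => [|k IH] s sk Ps; first by rewrite fill0; apply: supported0.
have sn : s != [::] by case: s sk {Ps}.
rewrite fillS -sk; apply: hC; first exact: P_G.
apply: supportedB; first apply: supportedB.
- by apply: supported_gen; apply: P_C.
- exact: P_sd.
rewrite sk /fill; apply: supported_ext (@icut_supp _ _ s) => t [ts st _].
have tk : size t = k by move: st; rewrite sk => -[].
rewrite -fill_genE; apply: supportedW (IH t tk (P_sub ts Ps)) => u.
exact/C_sub/Car_sub.
Qed.

End Evaluation.
End Carriers.

(** * Points of a weighted polyhedron *)

Section Geometry.
Variables (R : realType) (V : finType) (K : simplicial_complex V) (m : V -> nat).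
Hypothesis m_gt0 : forall v, (0 < m v)%N.
Hypothesis m_total : forall sigma v w, sigma \in (K : {set _}) ->
  v \in sigma -> w \in sigma -> (m v %| m w)%N || (m w %| m v)%N.
Local Notation point := (V -> R).
Implicit Types (y z : point) (sigma tau S : {set V}) (d : nat) (eps t : R).

Definition near eps y z := forall v, `|y v - z v| <= eps.

Definition inside sigma y := realization K y /\ carrier y \subset sigma.

Definition mass d y : R := \sum_(v | (m v %| d)%N) y v.

Definition minv S : option V :=
  [pick v in S | [forall w in S, (m v %| m w)%N]].

Lemma minvP S v : minv S = Some v -> v \in S /\ forall w, w \in S -> (m v %| m w)%N.
Proof.
by rewrite /minv; case: pickP => // x /andP[xS /forall_inP xm] [<-].
Qed.

(** Divisibility is total on the weights of one simplex, so a numerically least weight divides all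
    the others. *)
Lemma minv_ex sigma S w : sigma \in (K : {set _}) -> S \subset sigma -> w \in S ->
  exists v, minv S = Some v.
Proof.
move=> sK /fintype.subsetP Ss wS; rewrite /minv; case: pickP => [v _|no]; first by exists v.
case: (arg_minnP m wS) => v vS vmin; case/negP: (negbT (no v)).
rewrite [v \in S]vS /=; apply/forall_inP => u uS.
case/orP: (m_total sK (Ss _ vS) (Ss _ uS)) => // uv.
suff -> : m u = m v by [].
by apply/eqP; rewrite eqn_leq vmin // dvdn_leq.
Qed.

(** Accepting an option makes coning at [minv sigma] total; [None] gives the zero vector, which is
    no point of |K|, and [good] excludes that case. *)
Definition dirac_pt (o : option V) : point := fun w => (o == Some w)%:R.

Lemma dirac_sum v (P : pred V) :
  \sum_(w | P w) dirac_pt (Some v) w = (P v)%:R.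
Proof.
rewrite (bigID (pred1 v)) /= [X in _ + X]big1 ?addr0; last first.
  by move=> w /andP[_ wv]; rewrite /dirac_pt (inj_eq Some_inj) eq_sym (negbTE wv).
have [Pv|Pv] := boolP (P v).
  rewrite (bigD1 v) ?Pv ?eqxx //= big1 ?addr0 ?/dirac_pt ?eqxx // => w.
  by case/andP=> /andP[_ /eqP->]; rewrite eqxx.
by rewrite big1 // => w /andP[Pw /eqP wv]; rewrite -wv Pw in Pv.
Qed.

Lemma carrier_gt0 y v : (v \in carrier y) = (0 < y v).
Proof. by rewrite inE. Qed.

Lemma carrier_convex y z t : 0 <= t -> t <= 1 -> (forall v, 0 <= y v) -> (forall v, 0 <= z v) ->
  carrier (fun v => (1 - t) * y v + t * z v) \subset carrier y :|: carrier z.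
Proof.
move=> t0 t1 y0 z0; apply/fintype.subsetP => v; rewrite !inE => yz.
have [//|yv] := ltP 0 (y v); have [|zv] := ltP 0 (z v); first by rewrite orbT.
have yv0 : y v = 0 by apply/eqP; rewrite eq_le yv y0.
have zv0 : z v = 0 by apply/eqP; rewrite eq_le zv z0.
by rewrite yv0 zv0 !mulr0 addr0 ltxx in yz.
Qed.

Lemma carrier_neq0 y : \sum_v y v = 1 -> carrier y != finset.set0.
Proof.
move=> y1; apply/negP => /eqP e.
suff : \sum_v y v <= 0 by rewrite y1 ler10.
apply: sumr_le0 => v _; rewrite leNgt.
by rewrite -carrier_gt0 e finset.in_set0.
Qed.

Lemma inside_convex sigma y z t : sigma \in (K : {set _}) -> 0 <= t -> t <= 1 ->
  inside sigma y -> inside sigma z -> inside sigma (fun v => (1 - t) * y v + t * z v).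
Proof.
move=> sK t0 t1 [[y0 y1 yK] ys] [[z0 z1 zK] zs].
have cs : carrier (fun v => (1 - t) * y v + t * z v) \subset sigma.
  by apply: fintype.subset_trans (carrier_convex t0 t1 y0 z0) _; rewrite finset.subUset ys zs.
have s1 : \sum_v ((1 - t) * y v + t * z v) = 1.
  by rewrite big_split /= -!mulr_sumr y1 z1 !mulr1 subrK.
split=> //; split=> //; first by move=> v; rewrite addr_ge0 ?mulr_ge0 ?subr_ge0.
by apply: (simplex_face sK) => //; apply: carrier_neq0.
Qed.

Lemma carrier_dirac v : carrier (dirac_pt (Some v)) = [set v]%SET.
Proof.
apply/setP => w; rewrite !inE /dirac_pt (inj_eq Some_inj) eq_sym.
by case: eqP; rewrite ?ltr01 ?ltxx.
Qed.

Lemma inside_dirac sigma v : sigma \in (K : {set _}) -> v \in sigma ->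
  inside sigma (dirac_pt (Some v)).
Proof.
move=> sK vs; split; last by rewrite carrier_dirac finset.sub1set.
split=> [w||]; first by rewrite /dirac_pt ler0n.
  by rewrite dirac_sum.
rewrite carrier_dirac; apply: (simplex_face sK); first by rewrite finset.sub1set.
by apply/set0Pn; exists v; rewrite inE.
Qed.

Lemma realization_le1 y v : realization K y -> y v <= 1.
Proof.
case=> y0 <- _; rewrite (bigD1 v) //= lerDl; exact: sumr_ge0.
Qed.

Definition theta N sigma (i : nat) y : point :=
  fun v => (1 - i%:R / N.+1%:R) * y v + i%:R / N.+1%:R * dirac_pt (minv sigma) v.

Lemma frac_ge0 N (i : nat) : 0 <= i%:R / N.+1%:R :> R.
Proof. by rewrite divr_ge0. Qed.

Lemma frac_le1 N i : (i <= N.+1)%N -> i%:R / N.+1%:R <= 1 :> R.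
Proof. by move=> iN; rewrite ler_pdivrMr ?ltr0n // mul1r ler_nat. Qed.

(** Ensures that the apex [minv sigma] exists and has mass 1 with respect to [d]: the least weight
    divides the one assumed to divide [d]. *)
Definition good d sigma := sigma \in (K : {set _}) /\ exists2 v, v \in sigma & (m v %| d)%N.

Lemma good_minv d sigma : good d sigma -> exists v, [/\ minv sigma = Some v, v \in sigma & (m v %| d)%N].
Proof.
case=> sK [w ws wd]; have [v mv] := minv_ex sK (fintype.subxx _) ws.
have [vs vmin] := minvP mv; exists v; split=> //.
exact: dvdn_trans (vmin _ ws) wd.
Qed.

Lemma theta_inside N sigma d i y : good d sigma -> (i <= N.+1)%N ->
  inside sigma y -> inside sigma (theta N sigma i y).
Proof.
move=> gs iN yi; have [v [mv vs _]] := good_minv gs.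
apply: inside_convex => //; first by case: gs.
- exact: frac_ge0.
- exact: frac_le1.
by rewrite mv; apply: inside_dirac => //; case: gs.
Qed.

(** Mass is affine along the segment and equals 1 at the apex, so a lower bound [t <= 1]
    survives. *)
Lemma mass_theta N sigma d i y t : good d sigma -> (i <= N.+1)%N -> t <= 1 ->
  t <= mass d y -> t <= mass d (theta N sigma i y).
Proof.
move=> gs iN t1 ty; have [v [mv vs vd]] := good_minv gs.
rewrite /mass /theta big_split /= -!mulr_sumr mv dirac_sum vd mulr1 -/(mass d y).
have := frac_ge0 N i; have := frac_le1 iN; set u := _ / _ => u1 u0; nra.
Qed.

Lemma theta_near N sigma i y z eps : (i <= N.+1)%N -> near eps y z ->
  near eps (theta N sigma i y) (theta N sigma i z).
Proof.
move=> iN yz v; rewrite /theta; have := frac_ge0 N i; have := frac_le1 iN.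
set u := _ / _ => u1 u0.
have -> : (1 - u) * y v + u * dirac_pt (minv sigma) v -
  ((1 - u) * z v + u * dirac_pt (minv sigma) v) = (1 - u) * (y v - z v) by ring.
rewrite normrM ger0_norm ?subr_ge0 //.
have := yz v; have := normr_ge0 (y v - z v); nra.
Qed.

(** The extra term is one of [N.+1] equal steps along a segment whose ends differ by at most 1 in
    each coordinate. *)
Lemma theta_nearS N sigma i y z eps : (i <= N.+1)%N -> realization K z -> near eps y z ->
  near (eps + N.+1%:R^-1) (theta N sigma i y) (theta N sigma i.+1 z).
Proof.
move=> iN zK yz v; apply: le_trans (ler_distD (theta N sigma i z v) _ _) _.
apply: lerD; first exact: theta_near yz v.
have -> : theta N sigma i z v - theta N sigma i.+1 z v =
    (z v - dirac_pt (minv sigma) v) / N.+1%:R.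
  by rewrite /theta -[i.+1]addn1 natrD mulrDl mul1r; ring.
rewrite normrM normfV (ger0_norm (ler0n _ _)) -[leRHS]mul1r ler_pM2r ?invr_gt0 ?ltr0n //.
have z1 := realization_le1 v zK; have z0 : 0 <= z v by case: zK.
have [d0 d1] : 0 <= dirac_pt (minv sigma) v /\ dirac_pt (minv sigma) v <= 1.
  by rewrite /dirac_pt ler0n lern1 leq_b1.
by rewrite ler_norml; apply/andP; split; lra.
Qed.

Local Notation L := (freeZ (seq point)).

Lemma near_le eps eps' y z : eps <= eps' -> near eps y z -> near eps' y z.
Proof. by move=> e yz v; apply: le_trans e. Qed.

Lemma near_sym eps y z : near eps y z -> near eps z y.
Proof. by move=> yz v; rewrite distrC. Qed.

Lemma near_refl eps y : 0 <= eps -> near eps y y.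
Proof. by move=> e v; rewrite subrr normr0. Qed.

Lemma near_trans e1 e2 x y z : near e1 x y -> near e2 y z -> near (e1 + e2) x z.
Proof. by move=> xy yz v; apply: le_trans (ler_distD (y v) _ _) (lerD (xy v) (yz v)). Qed.

Definition cone N sigma : L -> L :=
  contraction (theta N sigma) N.+1 (dirac_pt (minv sigma)).
HB.instance Definition _ N sigma := GRing.Additive.on (cone N sigma).

Lemma tbdry_cone N sigma c : tbdry (cone N sigma c) + cone N sigma (tbdry c) = c.
Proof.
apply: tbdry_contraction => y; apply/funext => v; rewrite /theta.
  by rewrite mul0r subr0 mul1r mul0r addr0.
by rewrite divff ?pnatr_eq0 // subrr mul0r mul1r add0r.
Qed.

(** Each coning adds one step [1 / N.+1] to the diameter, hence a bound growing with the length
    [k]. *)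
Definition cell_tuple N eps t d sigma k (s : seq point) :=
  [/\ size s = k, forall y, y \in s -> inside sigma y /\ t <= mass d y &
      forall y z, y \in s -> z \in s -> near (eps + k%:R / N.+1%:R) y z].

Lemma inside_sub sigma tau y : tau \subset sigma -> inside tau y -> inside sigma y.
Proof. by move=> ts [yK yt]; split=> //; apply: fintype.subset_trans ts. Qed.

Lemma cell_tuple_sub N eps t d sigma tau k s : tau \subset sigma ->
  cell_tuple N eps t d tau k s -> cell_tuple N eps t d sigma k s.
Proof.
by move=> ts [sk si sn]; split=> // y /si[yi yt]; split=> //; apply: inside_sub yi.
Qed.

Lemma cone_carried N eps t d sigma k c : 0 <= eps -> t <= 1 -> good d sigma ->
  supported (cell_tuple N eps t d sigma k) c ->
  supported (cell_tuple N eps t d sigma k.+1) (cone N sigma c).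
Proof.
move=> e0 t1 gs; have [v [mv vs vd]] := good_minv gs.
apply: (@supported_additive _ _ _ _ (cone N sigma)) => s [sk si sn] /=.
have epsS : eps + k.+1%:R / N.+1%:R = eps + k%:R / N.+1%:R + N.+1%:R^-1.
  by rewrite -addn1 natrD mulrDl mul1r addrA.
have N0 : 0 <= N.+1%:R^-1 :> R by rewrite invr_ge0.
apply: supportedB.
  rewrite tmap_gen tcons_gen; apply: supported_gen.
  have H y : y \in dirac_pt (minv sigma) :: map (fun=> dirac_pt (minv sigma)) s ->
      y = dirac_pt (minv sigma).
    by rewrite in_cons => /orP[/eqP//|/mapP[]].
  split; first by rewrite /= size_map sk.
    move=> y /H ->; rewrite mv; split; first by apply: inside_dirac => //; case: gs.
    by rewrite /mass dirac_sum vd.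
  by move=> y z /H -> /H ->; apply: near_refl; rewrite addr_ge0 // frac_ge0.
apply: supported_sum => i _; apply: supportedW (@prism_supp _ _ _ _ _) => u [us uE].
split; first by rewrite us sk.
  by move=> y /uE[z zs [->|->]]; have [zi zt] := si _ zs; split;
    (apply: (@theta_inside _ _ d) || apply: mass_theta) => //; rewrite ?ltnS // ltnW.
rewrite epsS => y z /uE[y' ys yE] /uE[z' zs zE].
have zK : realization K z' by have [[]] := si _ zs.
have yK : realization K y' by have [[]] := si _ ys.
have iN : (i <= N.+1)%N by rewrite ltnW.
have yz := sn _ _ ys zs; have zy := near_sym yz.
case: yE => ->; case: zE => ->.
- by apply: near_le (theta_near _ _ yz) => //; rewrite lerDl.
- exact: theta_nearS.
- exact/near_sym/theta_nearS.
by apply: near_le (theta_near _ _ yz) => //; rewrite lerDl.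
Qed.

(** The threshold comes from the pigeonhole [big_coord]: mass [t] on a set of vertices forces one
    coordinate of this size. The successor keeps the denominator positive. *)
Definition label t y : option V := minv [set v | t / #|V|.+1%:R <= y v]%SET.

Definition chi t v y : int := (label t y == Some v)%:R.

Lemma big_coord y d t : realization K y -> 0 < t -> t <= mass d y ->
  exists v, (m v %| d)%N /\ t / #|V|.+1%:R <= y v.
Proof.
move=> yK t0 ty; have V0 := ltr0Sn R #|V|; apply: contrapT => no.
suff : mass d y < t by rewrite ltNge ty.
have b v : (m v %| d)%N -> y v < t / #|V|.+1%:R.
  by move=> vd; rewrite ltNge; apply/negP => ge; apply: no; exists v.
have [v vd|no1] := pickP (fun v => (m v %| d)%N); last first.
  by rewrite /mass big_pred0.
apply: (@lt_le_trans _ _ (\sum_(v | (m v %| d)%N) t / #|V|.+1%:R)).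
  by apply: ltr_sum => //; apply/hasP; exists v; rewrite ?mem_index_enum.
rewrite (eq_bigl [in [set v | (m v %| d)%N]%SET]); last by move=> u; rewrite inE.
rewrite sumr_const -[_ *+ _]mulr_natr mulrAC ler_pdivrMr //.
by rewrite ler_pM2l // ler_nat leqW // max_card.
Qed.

Lemma labelP t y : realization K y -> 0 < t -> t <= 1 ->
  exists v, [/\ label t y = Some v, t / #|V|.+1%:R <= y v &
    forall d, t <= mass d y -> (m v %| d)%N].
Proof.
move=> yK t0 t1; have V0 := ltr0Sn R #|V|; have [y0 y1 yC] := yK.
(* For the product of all weights the mass is the full sum 1, so some coordinate reaches the
   threshold and a label exists. *)
have [w [_ wy]] : exists v, (m v %| \prod_v m v)%N /\ t / #|V|.+1%:R <= y v.
  apply: (big_coord yK t0); rewrite /mass.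
  have dv v : (m v %| \prod_w m w)%N by rewrite (bigD1 v) //= dvdn_mulr.
  by rewrite [leRHS](eq_bigl xpredT) ?y1.
have [||v lv] := minv_ex (w := w) yC (S := [set v | t / #|V|.+1%:R <= y v]%SET).
- apply/fintype.subsetP => v; rewrite !inE; apply: lt_le_trans.
  by rewrite divr_gt0.
- by rewrite inE.
have [vS vmin] := minvP lv.
exists v; split=> //; first by rewrite inE in vS.
move=> d /(big_coord yK t0)[u [ud uy]]; apply: dvdn_trans ud.
by apply: vmin; rewrite inE.
Qed.

Lemma chi_sum t y : realization K y -> 0 < t -> t <= 1 -> \sum_v chi t v y = 1.
Proof.
move=> yK t0 t1; have [v [lv _ _]] := labelP yK t0 t1.
rewrite (bigD1 v) //= /chi lv eqxx big1 ?addr0 // => w wv.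
by rewrite (inj_eq Some_inj) eq_sym (negbTE wv).
Qed.

Lemma chi_neq0 t v y : realization K y -> 0 < t -> t <= 1 -> chi t v y != 0 ->
  t / #|V|.+1%:R <= y v /\ forall d, t <= mass d y -> (m v %| d)%N.
Proof.
move=> yK t0 t1; have [w [lw wy wd]] := labelP yK t0 t1.
by rewrite /chi lw (inj_eq Some_inj); have [<-|] := eqVneq w v.
Qed.

(* Moves the coordinates of size at most eta to the labelling vertex, so that
   nearby points are sent to a common simplex. *)
Definition snap t eta y : point :=
  fun v => (if eta < y v then y v else 0)
           + dirac_pt (label t y) v * \sum_(w | y w <= eta) y w.

Section Snap.
Variables (t eta : R) (y : point).
Hypotheses (yK : realization K y) (t_gt0 : 0 < t) (t_le1 : t <= 1).
Hypotheses (eta_ge0 : 0 <= eta) (eta_lt : eta < t / #|V|.+1%:R).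

Lemma snap_rest_ge0 : 0 <= \sum_(w | y w <= eta) y w.
Proof. by case: yK => y0 _ _; apply: sumr_ge0. Qed.

Lemma snap_ge0 v : 0 <= snap t eta y v.
Proof.
case: yK => y0 _ _; rewrite /snap addr_ge0 ?mulr_ge0 ?snap_rest_ge0 ?ler0n //.
by case: ifP.
Qed.

(** Only the labelling vertex gains anything, and its coordinate already exceeds [eta], which lies
    below the label threshold. *)
Lemma snap_carrier v : v \in carrier (snap t eta y) -> eta < y v.
Proof.
rewrite inE /snap; case: (ltP eta (y v)) => // yv; rewrite add0r.
have [w [lw wy _]] := labelP yK t_gt0 t_le1.
rewrite lw /dirac_pt (inj_eq Some_inj); have [wv _|_] := eqVneq w v; first rewrite -wv in yv.
  by have := lt_le_trans eta_lt wy; rewrite ltNge; case: leP yv.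
by rewrite mul0r ltxx.
Qed.

Lemma mass_snap_gen (P : pred V) v : label t y = Some v ->
  \sum_(w | P w) snap t eta y w =
  \sum_(w | P w && (eta < y w)) y w + (P v)%:R * \sum_(w | y w <= eta) y w.
Proof.
move=> lv; rewrite /snap big_split /= -mulr_suml lv dirac_sum; congr (_ + _).
by rewrite -big_mkcondr.
Qed.

Lemma snap_sum : \sum_v snap t eta y v = 1.
Proof.
case: yK => _ <- _; have [v [lv _ _]] := labelP yK t_gt0 t_le1.
rewrite (mass_snap_gen xpredT lv) mul1r [RHS](bigID (fun w => eta < y w)) /=.
by congr (_ + _); apply: eq_bigl => w; rewrite leNgt.
Qed.

Lemma snap_realization : realization K (snap t eta y).
Proof.
have [y0 y1 yC] := yK; split; [exact: snap_ge0 | exact: snap_sum|].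
apply: (simplex_face yC); last exact/carrier_neq0/snap_sum.
by apply/fintype.subsetP => v /snap_carrier yv; rewrite inE (le_lt_trans eta_ge0).
Qed.

(** Whatever is moved lands on the label, whose weight divides every [d] for which [y] has mass at
    least [t]. *)
Lemma snap_mass d : t <= mass d y -> mass d y <= mass d (snap t eta y).
Proof.
have [y0 y1 yC] := yK; have [v [lv _ vd]] := labelP yK t_gt0 t_le1.
move=> /vd vd'; rewrite [leRHS](mass_snap_gen (fun w => m w %| d)%N lv) vd' mul1r.
rewrite /mass (bigID (fun w => eta < y w)) /= lerD2l.
rewrite [leRHS](bigID (fun w => m w %| d)%N) /=.
rewrite (eq_bigl (fun w => (y w <= eta) && (m w %| d)%N)); last first.
  by move=> w; rewrite leNgt andbC.
by rewrite lerDl sumr_ge0.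
Qed.

Lemma snap_near : near (#|V|.+1%:R * eta) y (snap t eta y).
Proof.
have [y0 y1 yC] := yK; have [u [lu uy _]] := labelP yK t_gt0 t_le1.
have V1 : 1 <= #|V|.+1%:R :> R by rewrite ler1n.
have r0 := snap_rest_ge0.
have re : \sum_(w | y w <= eta) y w <= #|V|.+1%:R * eta.
  apply: (@le_trans _ _ (\sum_(w | y w <= eta) eta)); first exact: ler_sum.
  rewrite (eq_bigl [in [set w | y w <= eta]%SET]) => [|w]; last by rewrite inE.
  by rewrite sumr_const -[_ *+ _]mulr_natl ler_wpM2r // ler_nat leqW // max_card.
move=> v; rewrite /snap lu /dirac_pt (inj_eq Some_inj); case: (ltP eta (y v)) => yv.
  rewrite opprD addrA subrr add0r normrN; have [_|_] := eqVneq u v.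
    by rewrite mul1r ger0_norm.
  by rewrite mul0r normr0 mulr_ge0.
have [e|_] := eqVneq u v; first by rewrite e in uy; have := lt_le_trans eta_lt uy; rewrite ltNge yv.
by rewrite mul0r addr0 subr0 ger0_norm //; nra.
Qed.

End Snap.

End Geometry.

(** * Weighted chains and the small tuples that carry them *)

Section WeightedCochains.
Variables (V : finType) (K : simplicial_complex V) (m : V -> nat).
Local Notation cochain := (seq V -> int).
Implicit Types (a b : cochain) (u : seq V).

(** The degree [k] is a length, one more than the dimension. The empty tuple is allowed, but
    exempted from membership since the empty set is not a simplex. *)
Definition weighted_cochain k a := alternating a /\
  forall u, a u != 0 ->
    [/\ size u = k, u != [::] -> [set v in u]%SET \in (K : {set _}) &
        forall v, v \in u -> ((m v)%:Z %| a u)%Z].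

Lemma weighted_cochain0 k : weighted_cochain k 0.
Proof. by split=> [|u]; [exact: alternating0 | rewrite eqxx]. Qed.

Lemma weighted_cochainB k a b : weighted_cochain k a -> weighted_cochain k b ->
  weighted_cochain k (a - b).
Proof.
move=> [aa ak] [ab bk]; split; first exact: alternatingB.
move=> u; rewrite !fctE => abu.
have [su uK] : size u = k /\ (u != [::] -> [set v in u]%SET \in (K : {set _})).
  have [e|/ak[]//] := eqVneq (a u) 0.
  by move: abu; rewrite e sub0r oppr_eq0 => /bk[].
split=> // v vu; apply: rpredB.
  by have [->|/ak[_ _]] := eqVneq (a u) 0; [rewrite dvdz0 | apply].
by have [->|/bk[_ _]] := eqVneq (b u) 0; [rewrite dvdz0 | apply].
Qed.

Lemma weighted_cochainN k a : weighted_cochain k a -> weighted_cochain k (- a).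
Proof.
by move=> wa; rewrite -[- a]sub0r; apply: weighted_cochainB => //; apply: weighted_cochain0.
Qed.

Lemma weighted_cochainD k a b : weighted_cochain k a -> weighted_cochain k b ->
  weighted_cochain k (a + b).
Proof.
move=> wa wb; rewrite -[b]opprK; apply: weighted_cochainB => //.
exact: weighted_cochainN.
Qed.

Lemma weighted_cochainMz k a n : weighted_cochain k a -> weighted_cochain k (a *~ n).
Proof.
move=> wa; have wn j : weighted_cochain k (a *+ j).
  by elim: j => [|j IH]; [exact: weighted_cochain0 | rewrite mulrS; apply: weighted_cochainD].
by case: n => n; rewrite ?NegzE ?mulrNz; [|apply: weighted_cochainN]; rewrite -pmulrn.
Qed.

Lemma weighted_cochain_sum k (I : Type) (r : seq I) (p : pred I) (F : I -> cochain) :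
  (forall i, p i -> weighted_cochain k (F i)) ->
  weighted_cochain k (\sum_(i <- r | p i) F i).
Proof.
move=> h; apply: (big_ind (weighted_cochain k)) => //.
by move=> x y; apply: weighted_cochainD.
Qed.

Lemma weighted_cochain_ext k (X : choiceType) (P : X -> Prop) z
    (phi : {additive freeZ X -> cochain}) c :
  (forall s, P s -> weighted_cochain k (phi (gen s) *~ z)) -> supported P c ->
  weighted_cochain k (phi c *~ z).
Proof.
move=> Pw Pc; rewrite (freeZ_sum c) raddf_sum mulrz_suml big_seq.
apply: weighted_cochain_sum => s; rewrite mem_supp => /Pc/Pw ws.
by rewrite raddfMz -mulrzA mulrC mulrzA; apply: weighted_cochainMz.
Qed.

(** Each coefficient stays attached to its tuple, so divisibility can be checked tuple by tuple. *)
Lemma weighted_cochain_terms k (X : choiceType)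
    (phi : {additive freeZ X -> cochain}) c :
  (forall s, coef s c != 0 -> weighted_cochain k (phi (gen s) *~ coef s c)) ->
  weighted_cochain k (phi c).
Proof.
move=> h; rewrite (freeZ_sum c) raddf_sum big_seq.
by apply: weighted_cochain_sum => s; rewrite mem_supp raddfMz => /h.
Qed.

End WeightedCochains.

Section WeightedPoints.
Variables (R : realType) (V : finType) (K : simplicial_complex V) (m : V -> nat).
Hypothesis m_gt0 : forall v, (0 < m v)%N.
Hypothesis m_total : forall sigma v w, sigma \in (K : {set _}) ->
  v \in sigma -> w \in sigma -> (m v %| m w)%N || (m w %| m v)%N.
Local Notation point := (V -> R).
Local Notation cochain := (seq V -> int).
Local Notation L := (freeZ (seq point)).

Definition small_tuple t eps k d (s : seq point) :=
  [/\ size s = k, forall y, y \in s -> realization K y /\ t <= mass m d y &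
      forall y z, y \in s -> z \in s -> near eps y z].

(* A tuple occurring in c with coefficient d must consist of points having mass at
   least t on the vertices whose weight divides d. *)
Definition small_chain t eps k (c : L) :=
  forall s, coef s c != 0 -> small_tuple t eps k `|coef s c|%N s.

(** Mass 1 means that the weights of all vertices of the carrier divide the coefficient. In this
    form stability under sums is plain, which [sd_small] uses. *)
Lemma small_chain1_alt eps k c :
  small_chain 1 eps k c <-> supported (fun s : seq point =>
    [/\ size s = k, forall y, y \in s -> realization K y /\
       forall v, v \in carrier y -> ((m v)%:Z %| coef s c)%Z &
      forall y z, y \in s -> z \in s -> near eps y z]) c.
Proof.
suff H (y : point) d : realization K y -> (1 <= mass m d y) <-> (forall v, v \in carrier y -> (m v %| d)%N).
  split=> h s /h[sk sr sn]; split=> // y /sr[yK ym]; split=> //.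
    by move=> v; rewrite dvdzE; move/(H _ _ yK): ym; apply.
  by apply/(H _ _ yK) => v /ym; rewrite dvdzE.
case=> y0 <- _; rewrite /mass [leLHS](bigID (fun v => (m v %| d)%N)) /= -lerBrDl subrr.
split=> [le v|dv].
  rewrite inE => yv; apply: contraTT le => nv; rewrite -ltNge.
  by rewrite (bigD1 v) //= ltr_pwDl // sumr_ge0.
apply: sumr_le0 => v nv; rewrite leNgt; apply: contra nv => yv.
by apply: dv; rewrite inE.
Qed.

Variable N : nat.
Local Notation h := (cone (R := R) m N).
Implicit Types (sigma tau : {set V}) (y z : point).

Lemma good_sub d sigma tau : good K m d sigma -> tau \subset sigma ->
  tau != finset.set0 -> (forall v, v \in tau -> (m v %| d)%N) -> good K m d tau.
Proof.
move=> [sK _] ts tn td; split; first exact: (simplex_face sK).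
by have /set0Pn[v vt] := tn; exists v; rewrite ?td.
Qed.

Definition full d (sigma : {set V}) :=
  good K m d sigma /\ forall v, v \in sigma -> (m v %| d)%N.

Lemma full_sub d sigma tau : full d sigma -> tau \subset sigma ->
  tau != finset.set0 -> full d tau.
Proof.
move=> [gs sd] ts tn; have td v : v \in tau -> (m v %| d)%N.
  by move=> /(fintype.subsetP ts); apply: sd.
by split=> //; apply: good_sub gs ts tn td.
Qed.

Lemma sd_cell d t sigma k a : t <= 1 -> (sigma != finset.set0 -> full d sigma) ->
  (forall u, a u != 0 -> [set v in u]%SET \subset sigma) ->
  supported (cell_tuple K m N 0 t d sigma k) (sd h k a).
Proof.
move=> t1 fs as_.
apply: (sd_carried (G := full d) (C := cell_tuple K m N 0 t d)) => //.
- by move=> sg ta; apply: full_sub.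
- by move=> sg ta j s; apply: cell_tuple_sub.
by move=> sg j c [gs _]; apply: cone_carried.
Qed.

Lemma simplex_max sigma : sigma \in (K : {set _}) ->
  exists2 w, w \in sigma & full (m w) sigma.
Proof.
move=> sK; have /set0Pn[v0 v0s] : sigma != finset.set0.
  by apply: contraNneq (simplex_neq0 K) => <-.
case: (arg_maxnP m v0s) => w ws wmax; exists w => //.
have wd v : v \in sigma -> (m v %| m w)%N.
  move=> vs; case/orP: (m_total sK vs ws) => // wv.
  suff -> : m v = m w by [].
  by apply: anti_leq; rewrite (dvdn_leq _ wv) // andbT; apply: wmax.
by split=> //; split=> //; exists w.
Qed.

(** On one simplex the values of [a] are divisible by its largest vertex weight, which is factored
    out before subdividing. The resulting points stay in that simplex, and all its vertex weights
    divide the factor. *)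
Lemma sd_small k a : weighted_cochain K m k a ->
  small_chain 1 (k%:R / N.+1%:R) k (sd h k a).
Proof.
move=> [aa ak]; apply/small_chain1_alt.
rewrite -(sum_restr a) (raddf_sum (sd h k)).
pose Q (c : L) := supported (fun s : seq point =>
  [/\ size s = k, forall y, y \in s -> realization K y /\
       forall v, v \in carrier y -> ((m v)%:Z %| coef s c)%Z &
      forall y z, y \in s -> z \in s -> near (k%:R / N.+1%:R) y z]) c.
rewrite -/(Q _).
apply: (big_ind Q) => [|c d Qc Qd|sigma _].
- exact: supported0.
- move=> s; rewrite coefD => cd; have [c0|c0] := eqVneq (coef s c) 0.
    by move: cd; rewrite c0 add0r => /Qd.
  have [sk sr sn] := Qc s c0; split=> // y ys; have [yK ym] := sr y ys.
  split=> // v vy; apply: rpredD; first exact: ym.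
  have [->|/Qd[_ /(_ y ys)[_ dm] _]] := eqVneq (coef s d) 0; first exact: dvdz0.
  exact: dm.
set b := restr sigma a.
have bE u : b u != 0 -> [/\ size u = k, [set v in u]%SET = sigma,
    u != [::] -> sigma \in (K : {set _}) & forall v, v \in u -> ((m v)%:Z %| b u)%Z].
  rewrite /b /restr; case: ifP => [/eqP us|]; last by rewrite eqxx.
  by move=> /ak[? uK um]; split=> //; rewrite -us.
have [b0|bn] := eqVneq b 0.
  by rewrite b0 (raddf0 (sd h k)); apply: supported0.
have [u0 bu0] : exists u, b u != 0.
  apply: contrapT => n; case/eqP: bn; apply/funext => u.
  by apply/eqP; apply: contrapT => /negP bu; apply: n; exists u.
have [us0 us sK _] := bE _ bu0.
have [u00|un0] := eqVneq u0 [::].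
  rewrite u00 /= in us0; rewrite -us0.
  by apply: supportedMz => _; apply: supported_gen; split.
have [w ws fw] := simplex_max (sK un0).
have [b' bb'] : exists b', b = b' *~ (m w)%:Z.
  exists (fun u => (b u %/ (m w)%:Z)%Z); apply/funext => u.
  rewrite fctMz -mulrzr intz divzK //; have [->|bu] := eqVneq (b u) 0; first exact: dvdz0.
  have [_ us1 _ um] := bE _ bu; apply: um.
  by move/setP/(_ w): us1; rewrite ws inE.
have m0 : (m w)%:Z != 0 by rewrite -lt0n.
rewrite bb' (raddfMz (sd h k)) => s; rewrite coefMz => cs.
have bs u : b' u != 0 -> [set v in u]%SET \subset sigma.
  move=> b'u; have [|_ -> _ _ //] := bE u; rewrite bb' fctMz -mulrzr mulf_eq0 negb_or b'u.
  by rewrite intz.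
have cs' : coef s (sd h k b') != 0 by apply: contraNneq cs => ->; rewrite mul0rz.
have [sk si sn] := @sd_cell (m w) 0 sigma k b' ler01 (fun _ => fw) bs s cs'.
split=> // [y ys|y z ys zs]; last by have := sn y z ys zs; rewrite add0r.
have [[yK yc] _] := si y ys; split=> // v vy.
rewrite -mulrzr intz dvdz_mull // dvdzE.
by case: fw => _; apply; apply: (fintype.subsetP yc).
Qed.

Lemma coord_chi t y v : realization K y -> 0 < t -> t <= 1 -> chi m t v y != 0 ->
  v \in carrier y.
Proof.
move=> yK t0 t1 c0; have [ty _] := chi_neq0 m_gt0 m_total yK t0 t1 c0.
by rewrite inE (lt_le_trans _ ty) // divr_gt0 // (ltr0Sn _ _).
Qed.

Lemma eval_sd_weighted t k a : 0 < t -> t <= 1 -> weighted_cochain K m k a ->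
  eval_vertices (chi m t) (sd h k a) = a.
Proof.
(* With [d] the product of all weights every simplex is [full], which puts the claim within reach of
   the unweighted [eval_sd]. *)
move=> t0 t1 [aa ak]; pose d := (\prod_v m v)%N.
have dv v : (m v %| d)%N by rewrite /d (bigD1 v) //= dvdn_mulr.
have Kd sigma : sigma \in (K : {set _}) -> full d sigma.
  move=> sK; have [w ws _] := simplex_max sK.
  by split=> [|v _]; [split=> //; exists w|].
apply: (eval_sd (K := K) (tbdry_cone m N) (G := full d)
  (C := cell_tuple K m N 0 0 d)) => //.
- by move=> sg ta; apply: full_sub.
- by move=> sg ta j s; apply: cell_tuple_sub.
- by move=> sg j c [gs _]; apply: cone_carried.
- by move=> sg j s [].
- move=> sg j s sK [_ si _] y ys; have [[yK yc] _] := si y ys.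
  split; first exact: (chi_sum m_gt0 m_total yK).
  by move=> v /(coord_chi yK t0 t1) vy; apply: (fintype.subsetP yc).
by move=> u /ak[].
Qed.

(** At the label of a point the coordinate exceeds [eps], so it is still positive at every other
    point of the tuple: all labels lie in the carrier of one point. Their weights divide [z] by the
    mass bound. *)
Lemma eval_weighted t eps k (z : int) s : 0 < t -> t <= 1 -> eps < t / #|V|.+1%:R ->
  small_tuple t eps k `|z|%N s ->
  weighted_cochain K m k (eval_vertices (chi m t) (gen s) *~ z).
Proof.
move=> t0 t1 et [sk sr sn]; split.
  by move=> s1 x y s2; rewrite !fctMz alternating_eval mulNrz.
move=> u; rewrite fctMz -mulrzr intz mulf_eq0 negb_or => /andP[eu z0].
have [us uc] := eval_gen_supp eu.
split; first by rewrite us.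
  case: u us uc {eu} => // v0 u us uc _; have [y0 y0s cy0] := uc v0 (mem_head _ _).
  have [y0K _] := sr _ y0s; have [_ _ yC] := y0K.
  apply: (simplex_face yC); last by apply/set0Pn; exists v0; rewrite !inE eqxx.
  apply/fintype.subsetP => v; rewrite inE => /uc[y ys cy].
  have [yK _] := sr _ ys; have [ty _] := chi_neq0 m_gt0 m_total yK t0 t1 cy.
  have := sn y y0 ys y0s v; rewrite inE ler_norml => /andP[_].
  by move: ty et; set q := t / _ => ty et; lra.
move=> v /uc[y ys cy]; have [yK ym] := sr _ ys.
have [_ vd] := chi_neq0 m_gt0 m_total yK t0 t1 cy.
by apply: dvdz_mull; rewrite dvdzE; apply: vd.
Qed.

Definition hull (s : seq point) : {set V} := [set v | has (fun y => 0 < y v) s]%SET.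

Lemma hullP (s : seq point) v :
  reflect (exists2 y, y \in s & v \in carrier y) (v \in hull s).
Proof.
by rewrite inE; apply: (iffP hasP) => -[y ys yv]; exists y; rewrite ?inE // in yv *.
Qed.

Definition fillable t eps d (s : seq point) :=
  [/\ s != [::] -> hull s \in (K : {set _}),
      forall y, y \in s -> realization K y /\ t <= mass m d y &
      forall y z, y \in s -> z \in s -> near eps y z].

Lemma fill_small t eps d k s : 0 < t -> t <= 1 -> 0 <= eps -> size s = k ->
  fillable t eps d s ->
  supported (small_tuple t (eps + k.+1%:R / N.+1%:R) k.+1 d)
    (fill h (chi m t) hull k (gen s)).
Proof.
move=> t0 t1 e0 sk Ps.
have hull_sub (s1 s2 : seq point) : {subset s2 <= s1} -> hull s2 \subset hull s1.
  move=> s21; apply/fintype.subsetP => v /hullP[y ys yv]; apply/hullP.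
  by exists y => //; apply: s21.
have d_in s1 : fillable t eps d s1 -> s1 != [::] -> exists2 v, v \in hull s1 & (m v %| d)%N.
  case: s1 => // y s1 [_ sr _] _; have [yK ym] := sr y (mem_head _ _).
  have [v [vd yv]] := big_coord yK t0 ym; exists v => //.
  apply/hullP; exists y; rewrite ?mem_head // inE (lt_le_trans _ yv) //.
  by rewrite divr_gt0 // (ltr0Sn _ _).
have in_hull (s1 : seq point) y : y \in s1 -> carrier y \subset hull s1.
  by move=> ys; apply/fintype.subsetP => v vy; apply/hullP; exists y.
have : supported (cell_tuple K m N eps t d (hull s) k.+1) (fill h (chi m t) hull k (gen s)).
  apply: (@fill_carried _ _ _ (good K m d) (cell_tuple K m N eps t d) _ _ _ _
    (fillable t eps d)) => //.
  - by move=> sg ta j s'; apply: cell_tuple_sub.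
  - by move=> sg j c gs; apply: cone_carried.
  - move=> s1 s2 s21 [sK sr sn]; split=> [s2n|y /s21/sr//|y z /s21 ys /s21]; last exact: sn.
    have s1n : s1 != [::] by case: s2 s2n s21 => // y s2 _ /(_ y (mem_head _ _)); case: s1 {sK sr sn}.
    apply: (simplex_face (sK s1n)); first exact: hull_sub.
    case: s2 s2n s21 => // y s2 _ /(_ y (mem_head _ _)) /sr[[_ y1 _] _].
    have /set0Pn[v vy] := carrier_neq0 y1; apply/set0Pn; exists v.
    by apply/hullP; exists y; rewrite ?mem_head.
  - by move=> s1 P1 s1n; split; [case: P1 => /(_ s1n) | exact: d_in].
  - move=> s1 [sK sr sn] s1n; split=> // [y ys|y z ys zs].
      by have [yK ym] := sr y ys; split=> //; split=> //; apply: in_hull.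
    by apply: near_le (sn y z ys zs); rewrite lerDl frac_ge0.
  move=> s1 P1 s1n; have [sK sr sn] := P1.
  (* The labels have weights dividing [d], so the labelled tuple lives on the face [S], all of whose
     points have mass 1; its subdivision meets any mass bound [t <= 1]. *)
  pose S := [set v in hull s1 | (m v %| d)%N]%SET.
  have Sh : S \subset hull s1 by apply/fintype.subsetP => v; rewrite inE => /andP[].
  have : supported (cell_tuple K m N 0 1 d S (size s1))
      (sd h (size s1) (eval_vertices (chi m t) (gen s1))).
    apply: sd_cell => // [Sn|u].
      have Sd v : v \in S -> (m v %| d)%N by rewrite inE => /andP[].
      split=> //; apply: good_sub Sh Sn Sd; split; first exact: sK.
      exact: d_in.
    move=> /eval_gen_supp[_ uc]; apply/fintype.subsetP => v; rewrite !inE => /uc[y ys cy].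
    have [yK ym] := sr y ys; apply/andP; split.
      by apply/hasP; exists y => //; have := coord_chi yK t0 t1 cy; rewrite inE.
    by have [_] := chi_neq0 m_gt0 m_total yK t0 t1 cy; apply.
  apply: supportedW => s2 [s2k si sn2]; split=> // [y /si[yi y1]|y z ys zs].
    by split; [apply: inside_sub yi | apply: le_trans y1].
  by apply: near_le (sn2 y z ys zs); rewrite add0r lerDr.
apply: supportedW => s2 [s2k si sn2]; split=> // y /si[[yK _] ym] //.
Qed.

End WeightedPoints.

(** * The map induced on weighted chains *)

Section Transfer.
Variable R : realType.
Variables (V : finType) (K : simplicial_complex V) (m : V -> nat).
Hypothesis m_gt0 : forall v, (0 < m v)%N.
Hypothesis m_total : forall sigma v w, sigma \in (K : {set _}) ->
  v \in sigma -> w \in sigma -> (m v %| m w)%N || (m w %| m v)%N.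
Variables (V' : finType) (K' : simplicial_complex V') (m' : V' -> nat).
Hypothesis m'_gt0 : forall v, (0 < m' v)%N.
Hypothesis m'_total : forall sigma v w, sigma \in (K' : {set _}) ->
  v \in sigma -> w \in sigma -> (m' v %| m' w)%N || (m' w %| m' v)%N.
Local Notation point := (V -> R).
Local Notation point' := (V' -> R).
Local Notation cochain := (seq V -> int).
Local Notation cochain' := (seq V' -> int).

Definition transfer N t' (f : point -> point') k (a : cochain) : cochain' :=
  eval_vertices (chi m' t') (tmap f (sd (cone m N) k a)).

Fact transfer_zmod_morphism N t' f k : zmod_morphism (transfer N t' f k).
Proof. by move=> a b; rewrite /transfer (raddfB (sd _ k)) !raddfB. Qed.
HB.instance Definition _ N t' f k :=
  GRing.isZmodMorphism.Build cochain cochain' (transfer N t' f k)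
    (transfer_zmod_morphism N t' f k).

Definition maps_into (f : point -> point') :=
  forall y : point, realization K y -> realization K' (f y).

Definition maps_mass t t' (f : point -> point') :=
  forall (y : point) d, realization K y -> t <= mass m d y -> t' <= mass m' d (f y).

Definition maps_near delta eps (f g : point -> point') :=
  forall y z : point, realization K y -> realization K z -> near delta y z ->
  near eps (f y) (g z).

Variables (N : nat) (t' delta0 eps1 : R) (f : point -> point').
Hypotheses (t'_gt0 : 0 < t') (t'_le1 : t' <= 1).
Hypotheses (f_into : maps_into f) (f_mass : maps_mass 1 t' f)
  (f_near : maps_near delta0 eps1 f f).

Lemma map_small eps k d s : eps <= delta0 -> small_tuple K m 1 eps k d s ->
  small_tuple K' m' t' eps1 k d (map f s).
Proof.
move=> ed [sk sr sn]; split; first by rewrite size_map.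
  by move=> _ /mapP[y ys ->]; have [yK ym] := sr y ys; split; [apply: f_into|apply: f_mass].
move=> _ _ /mapP[y ys ->] /mapP[z zs ->].
have [yK _] := sr y ys; have [zK _] := sr z zs.
by apply: f_near => //; apply: near_le (sn y z ys zs).
Qed.

Lemma realization_chi (s : seq point') : (forall y, y \in s -> realization K' y) ->
  forall y, y \in s -> \sum_v chi m' t' v y = 1.
Proof. by move=> sr y /sr yK; apply: (chi_sum m'_gt0 m'_total yK). Qed.

Hypothesis eps1_lt : eps1 < t' / #|V'|.+1%:R.

Lemma transfer_weighted k a : k%:R / N.+1%:R <= delta0 ->
  weighted_cochain K m k a -> weighted_cochain K' m' k (transfer N t' f k a).
Proof.
move=> kd wa; have sa := @sd_small R _ _ _ m_gt0 m_total N _ _ wa.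
pose phi : {additive freeZ (seq point) -> cochain'} :=
  eval_vertices (chi m' t') \o tmap f.
apply: (weighted_cochain_terms (phi := phi)) => s cs; rewrite /phi /= tmap_gen.
apply: (eval_weighted m'_gt0 m'_total t'_gt0 t'_le1 eps1_lt).
exact: map_small kd (sa s cs).
Qed.

Lemma transfer_fbdry k a : weighted_cochain K m k.+1 a ->
  transfer N t' f k (fbdry a) = fbdry (transfer N t' f k.+1 a).
Proof.
move=> wa; have [aa _] := wa; have sa := @sd_small R _ _ _ m_gt0 m_total N _ _ wa.
rewrite /transfer -(tbdry_sd (tbdry_cone m N) _ aa) -tbdry_tmap eval_tbdry //.
apply: (supported_additive (phi := tmap f)
  (P := fun s : seq point => forall y, y \in s -> realization K y)).
  move=> s sr; rewrite /= tmap_gen; apply: supported_gen; apply: realization_chi.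
  by move=> _ /mapP[y /sr yK ->]; apply: f_into.
by move=> s /sa[_ sr _] y /sr[].
Qed.

End Transfer.

Section TransferHomotopy.
Variable R : realType.
Variables (V : finType) (K : simplicial_complex V) (m : V -> nat).
Hypothesis m_gt0 : forall v, (0 < m v)%N.
Hypothesis m_total : forall sigma v w, sigma \in (K : {set _}) ->
  v \in sigma -> w \in sigma -> (m v %| m w)%N || (m w %| m v)%N.
Variables (V' : finType) (K' : simplicial_complex V') (m' : V' -> nat).
Hypothesis m'_gt0 : forall v, (0 < m' v)%N.
Hypothesis m'_total : forall sigma v w, sigma \in (K' : {set _}) ->
  v \in sigma -> w \in sigma -> (m' v %| m' w)%N || (m' w %| m' v)%N.
Local Notation point := (V -> R).
Local Notation point' := (V' -> R).

Variables (n N N' M : nat) (t' t2 delta0 delta1 eps1 eps2 : R).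
Variables (f f0 : point -> point') (g : point' -> point) (phi : nat -> point -> point).
Hypotheses (t'_gt0 : 0 < t') (t'_le1 : t' <= 1) (t2_gt0 : 0 < t2) (t2_le1 : t2 <= 1).
Hypotheses (eps1_ge0 : 0 <= eps1) (eps2_lt : eps2 < t2 / #|V|.+1%:R).
Hypotheses (N_large : n.+2%:R / N.+1%:R <= delta0)
  (N'_large : eps1 + n.+2%:R / N'.+1%:R <= delta1).
Hypotheses (f_into : maps_into K K' f) (f_mass : maps_mass K m m' 1 t' f)
  (f_near : maps_near K delta0 eps1 f f).
Hypotheses (f0_into : maps_into K K' f0)
  (f_carrier : forall y z : point, realization K y -> realization K z ->
     near delta0 y z -> carrier (f y) \subset carrier (f0 z)).
Hypotheses (g_into : maps_into K' K g) (g_mass : maps_mass K' m' m t' t2 g)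
  (g_near : maps_near K' delta1 eps2 g g).
Hypotheses (phi_into : forall i, (i <= M)%N -> maps_into K K (phi i))
  (phi_mass : forall i, (i <= M)%N -> maps_mass K m m 1 t2 (phi i))
  (phi_near : forall i, (i <= M)%N -> maps_near K delta0 eps2 (phi i) (phi i))
  (phi_nearS : forall i, (i < M)%N -> maps_near K delta0 eps2 (phi i) (phi i.+1)).
Hypotheses (phi_start : forall y : point, realization K y -> phi 0%N y = g (f y))
  (phi_end : forall y : point, realization K y -> phi M y = y).

Local Notation E' := (eval_vertices (chi (R := R) m' t')).
Local Notation E2 := (eval_vertices (chi (R := R) m t2)).
Local Notation S' := (sd (cone (R := R) m' N') n.+1).
Local Notation D := (fill (cone (R := R) m' N') (chi m' t') (@hull R V')).

(** Two homotopies are added: [c2] is the image under [g] of the filling between [c1] and its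
    relabelled subdivision, and [P] runs through the [phi i] from [g \o f] to the identity. The map
    [f0] stands for [f] before snapping. *)
Lemma transfer_homotopy a : weighted_cochain K m n.+1 a ->
  (n = 0%N \/ fbdry a = 0) ->
  exists2 b, weighted_cochain K m n.+2 b &
    transfer m' m N' t2 g n.+1 (transfer m m' N t' f n.+1 a) - a = fbdry b.
Proof.
move=> wa cyc; have [aa _] := wa; have sa := @sd_small R _ _ _ m_gt0 m_total N _ _ wa.
set z := sd (cone m N) n.+1 a in sa.
have kd : n.+1%:R / N.+1%:R <= delta0.
  by apply: le_trans N_large; rewrite ler_pM2r ?invr_gt0 ?ltr0n // ler_nat.
set c1 := tmap f z.
have tz : tbdry z = sd (cone m N) n (fbdry a) by exact: (tbdry_sd (tbdry_cone m N)).
have small_c1 s : coef s z != 0 -> small_tuple K' m' t' eps1 n.+1 `|coef s z|%N (map f s).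
  by move=> /sa; apply: map_small kd.
have D_eq : tbdry (D n.+1 c1) = c1 - S' (E' c1).
  rewrite -(tbdry_fill (tbdry_cone m' N') (@hull R V')); last first.
    apply: (supported_additive (phi := tmap f) (P := fun s => coef s z != 0)) => //.
    move=> s /small_c1[sk sr _]; rewrite /= tmap_gen; apply: supported_gen; split=> //.
    by apply: (realization_chi (K' := K')) => // y /sr[].
  (* The side term vanishes on cycles; for [n = 0] it sits on the empty tuple, where [fill] is 0. *)
  suff -> : fill (cone m' N') (chi m' t') (@hull R V') n (tbdry c1) = 0 by rewrite addr0.
  by rewrite /c1 tbdry_tmap tz; case: cyc => [->|->]; rewrite ?fill0 // (raddf0 (sd _ n)) !raddf0.
pose P := \sum_(i < M) prism (phi i) (phi i.+1) z.
have P_eq : tbdry P = z - tmap g c1.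
  rewrite /P (raddf_sum (@tbdry point)) /=.
  rewrite (eq_bigr (fun i : 'I_M => tmap (phi i.+1) z - tmap (phi i) z)); last first.
    move=> i _; rewrite -tbdry_prism.
    suff -> : prism (phi i) (phi i.+1) (tbdry z) = 0 by rewrite addr0.
    rewrite tz; case: cyc => [->|->]; last by rewrite (raddf0 (sd _ n)) raddf0.
    by rewrite /sd raddfMz /= prism0 mul0rz.
  rewrite -(big_mkord xpredT (fun i => tmap (phi i.+1) z - tmap (phi i) z)).
  rewrite telescope_sumr // -[X in _ = X - _]tmap_id tmap_comp.
  by congr (_ - _); apply: eq_tmap => s /sa[_ sr _] y /sr[yK _] /=;
    [apply: phi_end | apply: phi_start].
have E2z : E2 z = a by exact: (eval_sd_weighted m_gt0 m_total).
pose c2 := tmap g (D n.+1 c1).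
have smallP s i : coef s z != 0 -> (i < M)%N ->
    supported (small_tuple K m t2 eps2 n.+2 `|coef s z|%N)
      (prism (phi i) (phi i.+1) (gen s)).
  move=> /sa[sk sr sn] iM1; have iM := ltnW iM1.
  apply: supportedW (@prism_supp _ _ _ _ _) => u [us uE].
  split; first by rewrite us sk.
    by move=> x /uE[y /sr[yK ym] [->|->]]; split; (apply: phi_into || apply: phi_mass).
  move=> x1 x2 /uE[y1 ys1 x1E] /uE[y2 ys2 x2E].
  have [y1K _] := sr _ ys1; have [y2K _] := sr _ ys2.
  have n12 := near_le kd (sn _ _ ys1 ys2); have n21 := near_sym n12.
  case: x1E => ->; case: x2E => ->; [exact: phi_near | exact: phi_nearS | | exact: phi_near].
  exact/near_sym/phi_nearS.
have smallD s : coef s z != 0 ->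
    supported (small_tuple K' m' t' (eps1 + n.+2%:R / N'.+1%:R) n.+2 `|coef s z|%N)
      (D n.+1 (gen (map f s))).
  move=> cs; have [sk sr sn] := sa s cs; have [fk fr fn] := small_c1 s cs.
  apply: fill_small => //; split=> //.
  case: s sk sr sn fk fr fn {cs} => // y0 s _ sr sn _ _ _ _.
  have [y0K _] := sr y0 (mem_head _ _); have [_ _ fC] := f0_into y0K.
  have [_ fy1 _] := f_into y0K.
  (* All images have their carrier inside that of the single point [f0 y0], so their hull is a
     simplex; snapping secures this. *)
  apply: (simplex_face fC).
    apply/fintype.subsetP => v /hullP[_ /mapP[y ys ->]]; have [yK _] := sr y ys.
    apply: (fintype.subsetP (f_carrier yK y0K _)).
    by apply: near_le (sn _ _ ys (mem_head _ _)).
  have /set0Pn[v vf] := carrier_neq0 fy1; apply/set0Pn; exists v; apply/hullP.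
  by exists (f y0) => //; rewrite /= mem_head.
have E2P : weighted_cochain K m n.+2 (E2 P).
  rewrite /P (raddf_sum E2); apply: weighted_cochain_sum => i _ /=.
  pose psi : {additive freeZ (seq point) -> (seq V -> int)} := E2 \o prism (phi i) (phi i.+1).
  apply: (weighted_cochain_terms (phi := psi)) => s cs.
  apply: (weighted_cochain_ext (phi := E2) _ (smallP s i cs (ltn_ord i))) => u.
  exact: (eval_weighted m_gt0 m_total).
have E2c : weighted_cochain K m n.+2 (E2 c2).
  pose psi : {additive freeZ (seq point) -> (seq V -> int)} :=
    (E2 \o tmap g) \o (D n.+1 \o tmap f).
  apply: (weighted_cochain_terms (phi := psi)) => s cs; rewrite /psi /= tmap_gen.
  apply: (weighted_cochain_ext (phi := E2 \o tmap g) _ (smallD s cs)) => u [uk ur un].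
  rewrite /= tmap_gen; apply: (eval_weighted m_gt0 m_total t2_gt0 t2_le1 eps2_lt).
  split; first by rewrite size_map.
    by move=> _ /mapP[x /ur[xK xm] ->]; split; [apply: g_into | apply: g_mass].
  move=> _ _ /mapP[x xu ->] /mapP[x' x'u ->].
  have [xK _] := ur _ xu; have [x'K _] := ur _ x'u.
  by apply: g_near => //; apply: near_le N'_large (un _ _ xu x'u).
have norm (c : freeZ (seq point)) :
    supported (fun s : seq point => forall y, y \in s -> realization K y) c ->
    E2 (tbdry c) = fbdry (E2 c).
  move=> cs; apply: eval_tbdry; apply: supportedW cs => s sr.
  exact: (realization_chi (K' := K)).
exists (- (E2 P + E2 c2)).
  exact/weighted_cochainN/weighted_cochainD.
rewrite /transfer -/z -/c1.
have -> : S' (E' c1) = c1 - tbdry (D n.+1 c1) by rewrite D_eq opprB addrC subrK.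
rewrite (raddfB (tmap g)) /= -tbdry_tmap (raddfB E2) /= -/c2.
have -> : tmap g c1 = z - tbdry P by rewrite P_eq opprB addrC subrK.
rewrite (raddfB E2) /= E2z (raddfN (@fbdry V)) (raddfD (@fbdry V)) /= -!norm.
- by apply/funext => u; rewrite !fctE; ring.
- apply: (supported_additive (phi := tmap g)
    (P := fun s : seq point' => forall y, y \in s -> realization K' y)).
    move=> s sr; rewrite /= tmap_gen; apply: supported_gen => _ /mapP[y /sr yK ->].
    exact: g_into.
  apply: (supported_additive (phi := D n.+1 \o tmap f) (P := fun s => coef s z != 0)) => //.
  move=> s /smallD; rewrite /= tmap_gen; apply: supportedW => u [_ ur _] y /ur[].
  by [].
- apply: supported_sum => i _.
  apply: (supported_additive (phi := prism (phi i) (phi i.+1))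
    (P := fun s => coef s z != 0)) => //.
  by move=> s cs; apply: supportedW (smallP s i cs (ltn_ord i)) => u [_ ur _] y /ur[].
Qed.

End TransferHomotopy.

Definition uniform_on (R : realType) (V V' : finType) (K : simplicial_complex V)
    (f : (V -> R) -> V' -> R) :=
  forall eps, 0 < eps -> exists2 delta, 0 < delta & maps_near K delta eps f f.

Definition uniform_homotopy (R : realType) (V V' : finType) (K : simplicial_complex V)
    (H : R -> (V -> R) -> V' -> R) :=
  forall eps, 0 < eps -> exists2 delta, 0 < delta &
    forall s t, 0 <= s <= 1 -> 0 <= t <= 1 -> `|s - t| <= delta ->
      maps_near K delta eps (H s) (H t).

(** * Choice of the moduli, thresholds and meshes *)

Section ParameterChoice.
Variable R : realType.
Variables (V : finType) (K : simplicial_complex V) (m : V -> nat).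
Hypothesis m_gt0 : forall v, (0 < m v)%N.
Hypothesis m_total : forall sigma v w, sigma \in (K : {set _}) ->
  v \in sigma -> w \in sigma -> (m v %| m w)%N || (m w %| m v)%N.
Variables (V' : finType) (K' : simplicial_complex V') (m' : V' -> nat).
Hypothesis m'_gt0 : forall v, (0 < m' v)%N.
Hypothesis m'_total : forall sigma v w, sigma \in (K' : {set _}) ->
  v \in sigma -> w \in sigma -> (m' v %| m' w)%N || (m' w %| m' v)%N.
Local Notation point := (V -> R).
Local Notation point' := (V' -> R).

Lemma large_mesh k (d : R) : 0 < d -> exists N0, forall N, (N0 <= N)%N -> k%:R / N.+1%:R <= d.
Proof.
move=> d0; have q0 : 0 <= k%:R / d by rewrite divr_ge0 // ltW.
exists (Num.bound (k%:R / d)) => N NN; rewrite ler_pdivrMr ?ltr0Sn //.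
rewrite mulrC -ler_pdivrMr //; apply: ltW; apply: lt_le_trans (archi_boundP q0) _.
by rewrite ler_nat leqW.
Qed.

Variables (f : point -> point') (g : point' -> point) (H : R -> point -> point).
Hypotheses (f_into : maps_into K K' f) (g_into : maps_into K' K g)
  (H_into : forall t, 0 <= t <= 1 -> maps_into K K (H t)).
Hypotheses (f_unif : uniform_on K f) (g_unif : uniform_on K' g)
  (H_unif : uniform_homotopy K H).
Hypotheses (H0 : forall y : point, realization K y -> H 0 y = g (f y))
  (H1 : forall y : point, realization K y -> H 1 y = y).
Variables (t' t2 : R) (n : nat).
Hypotheses (t'_gt0 : 0 < t') (t'_le1 : t' <= 1) (t2_gt0 : 0 < t2) (t2_le1 : t2 <= 1).
Hypotheses (f_mass : maps_mass K m m' 1 t' f) (g_mass : maps_mass K' m' m t' t2 g)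
  (H_mass : forall t, 0 <= t <= 1 -> maps_mass K m m 1 t2 (H t)).

Definition snapped eta' := snap m' t' eta' \o f.
Definition snapped_back eta := snap m t2 eta \o g.

(** The constants are fixed backwards: the label threshold of [K] and the modulus of [g], then the
    label threshold of [K'] and the modulus of [f], last the meshes. The snapping parameters stay
    free below [eps0], so that both directions can share one map [F]. *)
Lemma direction : exists2 eps0, 0 < eps0 &
  forall eta eta', 0 < eta -> eta < eps0 -> 0 < eta' -> eta' < eps0 ->
  exists N0, forall N N', (N0 <= N)%N -> (N0 <= N')%N ->
  let F := transfer m m' N t' (snapped eta') in
  let G := transfer m' m N' t2 (snapped_back eta) in
  [/\ forall k a, (k <= n.+2)%N -> weighted_cochain K m k a -> weighted_cochain K' m' k (F k a),
      forall k a, (k <= n.+2)%N -> weighted_cochain K' m' k a -> weighted_cochain K m k (G k a),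
      maps_into K K' (snapped eta'), maps_into K' K (snapped_back eta) &
      forall a, weighted_cochain K m n.+1 a -> (n = 0%N \/ fbdry a = 0) ->
      exists2 b, weighted_cochain K m n.+2 b & G n.+1 (F n.+1 a) - a = fbdry b].
Proof.
pose A : R := #|V|.+1%:R; pose A' : R := #|V'|.+1%:R.
have A1 : 1 <= A by rewrite ler1n.
have A'1 : 1 <= A' by rewrite ler1n.
have A0 : 0 < A by apply: lt_le_trans A1.
have A'0 : 0 < A' by apply: lt_le_trans A'1.
pose thr2 := t2 / A; pose thr' := t' / A'.
have thr20 : 0 < thr2 by rewrite divr_gt0.
have thr'0 : 0 < thr' by rewrite divr_gt0.
pose eps2 := thr2 / 2.
have eps20 : 0 < eps2 by rewrite divr_gt0.
have eps2lt : eps2 < thr2 by rewrite /eps2; lra.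
(* Snapping will displace each of two points by at most [eps2 / 4], so a quarter is allotted to [g]
   itself. *)
have [delta1 d10 g_near] := g_unif (divr_gt0 eps20 (ltr0Sn R 3)).
(* The first bound stays below the label threshold of [K']; the second leaves [delta1 / 2] for the
   mesh of the filling. *)
pose eps1 := Num.min (thr' / 2) (delta1 / 2).
have eps10 : 0 < eps1 by rewrite lt_min !divr_gt0.
have eps1thr : eps1 <= thr' / 2 by rewrite ge_min lexx.
have eps1d : eps1 <= delta1 / 2 by rewrite ge_min lexx orbT.
clearbody eps1.
have [deltaf df0 f_near] := f_unif (divr_gt0 eps10 (ltr0Sn R 3)).
have [deltaH dH0 H_near] := H_unif eps20.
have [M0 hM] := large_mesh 1 dH0.
pose M := M0.+1.
have e0 : 0 < Num.min (eps2 / (4 * A)) (eps1 / (4 * A')).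
  by rewrite lt_min !divr_gt0 // mulr_gt0.
exists (Num.min (eps2 / (4 * A)) (eps1 / (4 * A'))) => // eta eta' eta0.
rewrite lt_min => /andP[eta2 _] eta'0; rewrite lt_min => /andP[_ eta'1].
have Aeta : A * eta <= eps2 / 4.
  by move: eta2; rewrite ltr_pdivlMr ?mulr_gt0 // => /ltW; rewrite mulrCA mulrC => h; lra.
have A'eta' : A' * eta' <= eps1 / 4.
  by move: eta'1; rewrite ltr_pdivlMr ?mulr_gt0 // => /ltW; rewrite mulrCA mulrC => h; lra.
have eta_thr : eta < thr2 by nra.
have eta'_thr : eta' < thr' by nra.
(* A coordinate surviving the snap exceeds [eta']; if [f] moves by at most [eta'], it stays positive
   at nearby images. Hence the mesh depends on [eta']. *)
have [deltac dc0 f_carr] := f_unif eta'0.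
pose delta0 := Num.min deltaf (Num.min deltac deltaH).
have d00 : 0 < delta0 by rewrite !lt_min df0 dc0 dH0.
have d0f : delta0 <= deltaf by rewrite ge_min lexx.
have d0c : delta0 <= deltac by rewrite !ge_min lexx orbT.
have d0H : delta0 <= deltaH by rewrite !ge_min lexx !orbT.
clearbody delta0.
have [N1 hN1] := large_mesh n.+2 d00.
have [N2 hN2] := large_mesh n.+2 (divr_gt0 d10 (ltr0Sn R 1)).
exists (maxn N1 N2) => N N'; rewrite !geq_max => /andP[NN1 _] /andP[_ NN2] F G.
have hN := hN1 _ NN1; have hN' := hN2 _ NN2.
have sf y : realization K y -> near (A' * eta') (f y) (snapped eta' y).
  by move=> yK; apply: (snap_near m'_gt0 m'_total (f_into yK)) => //; apply: ltW.
have sg y : realization K' y -> near (A * eta) (g y) (snapped_back eta y).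
  by move=> yK; apply: (snap_near m_gt0 m_total (g_into yK)) => //; apply: ltW.
have F_into : maps_into K K' (snapped eta').
  by move=> y yK; apply: (snap_realization m'_gt0 m'_total (f_into yK)) => //; apply: ltW.
have G_into : maps_into K' K (snapped_back eta).
  by move=> y yK; apply: (snap_realization m_gt0 m_total (g_into yK)) => //; apply: ltW.
have F_mass : maps_mass K m m' 1 t' (snapped eta').
  move=> y d yK /(f_mass yK) fm; apply: (le_trans fm).
  exact: (snap_mass m'_gt0 m'_total eta' (f_into yK) t'_gt0 t'_le1 fm).
have G_mass : maps_mass K' m' m t' t2 (snapped_back eta).
  move=> y d yK /(g_mass yK) gm; apply: (le_trans gm).
  exact: (snap_mass m_gt0 m_total eta (g_into yK) t2_gt0 t2_le1 gm).
have F_near : maps_near K delta0 eps1 (snapped eta') (snapped eta').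
  move=> y z yK zK yz; have fyz := f_near _ _ yK zK (near_le d0f yz).
  apply: near_le (near_trans (near_sym (sf y yK)) (near_trans fyz (sf z zK))).
  by lra.
have G_near : maps_near K' delta1 eps2 (snapped_back eta) (snapped_back eta).
  move=> y z yK zK yz; have gyz := g_near _ _ yK zK yz.
  apply: near_le (near_trans (near_sym (sg y yK)) (near_trans gyz (sg z zK))).
  by lra.
have eps1d1 : eps1 <= delta1 by lra.
have N'_large : eps1 + n.+2%:R / N'.+1%:R <= delta1.
  by rewrite [leRHS]splitr lerD.
have k_large k (d : R) : (k <= n.+2)%N -> n.+2%:R / N.+1%:R <= d -> k%:R / N.+1%:R <= d.
  by move=> kn; apply: le_trans; rewrite ler_pM2r ?invr_gt0 ?ltr0Sn // ler_nat.
(* One step is put before the samples of [H]: from the composite of the snapped maps to [H 0], which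
   is [g \o f]. *)
pose phi i : point -> point :=
  if i is j.+1 then H (j%:R / M%:R) else snapped_back eta \o snapped eta'.
have frac j : (j <= M)%N -> 0 <= (j%:R / M%:R : R) <= 1.
  by move=> jM; rewrite divr_ge0 // ler_pdivrMr ?ltr0Sn // mul1r ler_nat.
have phi_into i : (i <= M.+1)%N -> maps_into K K (phi i).
  case: i => [_ y yK|j jM]; first exact/G_into/F_into.
  exact/H_into/frac.
have phi_mass i : (i <= M.+1)%N -> maps_mass K m m 1 t2 (phi i).
  case: i => [_ y d yK ym|j jM]; last exact/H_mass/frac.
  by apply: G_mass; [apply: F_into | apply: F_mass].
have phi_near i : (i <= M.+1)%N -> maps_near K delta0 eps2 (phi i) (phi i).
  case: i => [_ y z yK zK yz|j jM y z yK zK yz].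
    apply: G_near; [exact: F_into | exact: F_into|].
    by apply: near_le (F_near _ _ yK zK yz).
  apply: H_near => //; [exact: frac | exact: frac | | exact: near_le yz].
  by rewrite subrr normr0 ltW.
have phi_nearS i : (i < M.+1)%N -> maps_near K delta0 eps2 (phi i) (phi i.+1).
  case: i => [_ y z yK zK yz|j jM y z yK zK yz].
    rewrite /phi mul0r H0 //=.
    have Fyz : near delta1 (snapped eta' y) (f z).
      have fyz := f_near _ _ yK zK (near_le d0f yz).
      by apply: near_le (near_trans (near_sym (sf y yK)) fyz); lra.
    have gyz := g_near _ _ (F_into _ yK) (f_into zK) Fyz.
    by apply: near_le (near_trans (near_sym (sg _ (F_into _ yK))) gyz); lra.
  apply: H_near => //; [exact/frac/ltnW | exact: frac | | exact: near_le yz].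
  rewrite -mulrBl -opprB -natrB // subSnn mulNr normrN ger0_norm ?divr_ge0 //.
  exact: hM.
split=> //.
- move=> k a kn; apply: (transfer_weighted m_gt0 m_total m'_gt0 m'_total t'_gt0 t'_le1
    F_into F_mass F_near); last exact: k_large.
  by rewrite -/A' -/thr'; lra.
- move=> k a kn; apply: (transfer_weighted (delta0 := delta1) (eps1 := eps2)
    m'_gt0 m'_total m_gt0 m_total t2_gt0 t2_le1 G_into _ G_near) => //.
    by move=> y d yK y1; apply: G_mass => //; apply: le_trans y1.
  apply: le_trans (_ : delta1 / 2 <= _); last by lra.
  by apply: le_trans hN'; rewrite ler_pM2r ?invr_gt0 ?ltr0Sn // ler_nat.
move=> a wa cyc; rewrite /F /G.
apply: (transfer_homotopy m_gt0 m_total m'_gt0 m'_total (delta0 := delta0)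
  (delta1 := delta1) (eps1 := eps1) (eps2 := eps2) (f0 := f) (phi := phi)
  (M := M.+1) t'_gt0 t'_le1 t2_gt0 t2_le1 _ _ hN N'_large F_into F_mass F_near
  f_into _ G_into G_mass G_near phi_into phi_mass phi_near phi_nearS _ _ wa cyc) => //.
- exact: ltW.
- move=> y z yK zK yz; apply/fintype.subsetP => v.
  move=> /(snap_carrier m'_gt0 m'_total (f_into yK) t'_gt0 t'_le1 eta'_thr) yv.
  have := f_carr _ _ yK zK (near_le d0c yz) v; rewrite inE ler_norml => /andP[_]; lra.
by move=> y yK; rewrite /phi divff ?H1 // pnatr_eq0.
Qed.

End ParameterChoice.

(** * A map bijective on homology, from its left and right inverses *)

Section HomologyEquivalence.
Variable R : realType.
Variables (V : finType) (K : simplicial_complex V) (m : V -> nat).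
Hypothesis m_gt0 : forall v, (0 < m v)%N.
Hypothesis m_total : forall sigma v w, sigma \in (K : {set _}) ->
  v \in sigma -> w \in sigma -> (m v %| m w)%N || (m w %| m v)%N.
Variables (V' : finType) (K' : simplicial_complex V') (m' : V' -> nat).
Hypothesis m'_gt0 : forall v, (0 < m' v)%N.
Hypothesis m'_total : forall sigma v w, sigma \in (K' : {set _}) ->
  v \in sigma -> w \in sigma -> (m' v %| m' w)%N || (m' w %| m' v)%N.
Local Notation point := (V -> R).
Local Notation point' := (V' -> R).

Variables (f : point -> point') (g : point' -> point).
Variables (H : R -> point -> point) (H' : R -> point' -> point').
Hypotheses (f_into : maps_into K K' f) (g_into : maps_into K' K g)
  (H_into : forall t, 0 <= t <= 1 -> maps_into K K (H t))
  (H'_into : forall t, 0 <= t <= 1 -> maps_into K' K' (H' t)).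
Hypotheses (f_unif : uniform_on K f) (g_unif : uniform_on K' g)
  (H_unif : uniform_homotopy K H) (H'_unif : uniform_homotopy K' H').
Hypotheses (H0 : forall y : point, realization K y -> H 0 y = g (f y))
  (H1 : forall y : point, realization K y -> H 1 y = y)
  (H'0 : forall y : point', realization K' y -> H' 0 y = f (g y))
  (H'1 : forall y : point', realization K' y -> H' 1 y = y).

(* tset = {1} when f, g and the homotopies respect the least common multiples
   of the vertex weights, tset = ]0, 1] when they respect their greatest common
   divisors. *)
Variable tset : R -> Prop.
Hypotheses (tset1 : tset 1) (tset_range : forall t, tset t -> 0 < t /\ t <= 1)
  (tset_min : forall s t, tset s -> tset t -> tset (Num.min s t)).
Hypotheses
  (f_mass : forall t, tset t -> exists2 t', tset t' & maps_mass K m m' t t' f)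
  (g_mass : forall t, tset t -> exists2 t', tset t' & maps_mass K' m' m t t' g)
  (H_mass : forall t, tset t -> exists2 t', tset t' &
     forall s, 0 <= s <= 1 -> maps_mass K m m t t' (H s))
  (H'_mass : forall t, tset t -> exists2 t', tset t' &
     forall s, 0 <= s <= 1 -> maps_mass K' m' m' t t' (H' s)).

Definition weighted_cycle n (W : finType) (L : simplicial_complex W) (p : W -> nat)
    (a : seq W -> int) := weighted_cochain L p n.+1 a /\ (n = 0%N \/ fbdry a = 0).

(** [D1] gives a left inverse of [F] up to boundaries, built from [g] at level [t2], and [D2] a
    right inverse at level [t3]. The four clauses say that [F] is well defined, injective and
    surjective on homology. *)
Lemma homology_equivalence n :
  exists F : {additive (seq V -> int) -> (seq V' -> int)},
  [/\ forall a, weighted_cycle n K m a -> weighted_cycle n K' m' (F a),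
      forall b, weighted_cochain K m n.+2 b ->
        exists2 b', weighted_cochain K' m' n.+2 b' & F (fbdry b) = fbdry b',
      forall a b', weighted_cycle n K m a -> weighted_cochain K' m' n.+2 b' ->
        F a = fbdry b' -> exists2 b, weighted_cochain K m n.+2 b & a = fbdry b &
      forall a', weighted_cycle n K' m' a' -> exists a b',
        [/\ weighted_cycle n K m a, weighted_cochain K' m' n.+2 b' & F a - a' = fbdry b']].
Proof.
have mass_le (W W' : finType) (L : simplicial_complex W) p (p' : W' -> nat) s t t'
    (k : (W -> R) -> W' -> R) : t' <= t -> maps_mass L p p' s t k -> maps_mass L p p' s t' k.
  by move=> tt km y d yL /(km y d yL); apply: le_trans.
have [t3 t3T g1] := g_mass tset1.
have [ta taT f1] := f_mass tset1; have [tb tbT f3] := f_mass t3T.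
have [tc tcT H'1m] := H'_mass tset1.
(* The level of [F] serves twice: from level 1 in the left composite ([ta]) and from level [t3] in
   the right one ([tb]); [tc] accounts for the homotopy [H']. *)
pose t' := Num.min ta (Num.min tb tc).
have t'T : tset t' by do ?apply: tset_min.
have t'a : t' <= ta by rewrite ge_min lexx.
have t'b : t' <= tb by rewrite !ge_min lexx orbT.
have t'c : t' <= tc by rewrite !ge_min lexx !orbT.
have [td tdT gt'] := g_mass t'T; have [te teT H1m] := H_mass tset1.
pose t2 := Num.min td te.
have t2T : tset t2 by apply: tset_min.
have t2d : t2 <= td by rewrite ge_min lexx.
have t2e : t2 <= te by rewrite ge_min lexx orbT.
have [t'0 t'1] := tset_range t'T; have [t20 t21] := tset_range t2T.
have [t30 t31] := tset_range t3T.
have [e1 e10 D1] := direction m_gt0 m_total m'_gt0 m'_total f_into g_into H_into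
  f_unif g_unif H_unif H0 H1 n t'0 t'1 t20 t21 (mass_le _ _ _ _ _ _ _ _ _ t'a f1)
  (mass_le _ _ _ _ _ _ _ _ _ t2d gt')
  (fun s s01 => mass_le _ _ _ _ _ _ _ _ _ t2e (H1m s s01)).
have [e2 e20 D2] := direction m'_gt0 m'_total m_gt0 m_total g_into f_into H'_into
  g_unif f_unif H'_unif H'0 H'1 n t30 t31 t'0 t'1 g1
  (mass_le _ _ _ _ _ _ _ _ _ t'b f3)
  (fun s s01 => mass_le _ _ _ _ _ _ _ _ _ t'c (H'1m s s01)).
pose eta := Num.min e1 e2 / 2.
have e0 : 0 < Num.min e1 e2 by rewrite lt_min e10.
have eta0 : 0 < eta by rewrite divr_gt0.
have eta_lt : eta < Num.min e1 e2 by rewrite /eta; set e := Num.min _ _ in e0 *; lra.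
move: (eta_lt); rewrite lt_min => /andP[eta1 eta2].
have [N1 D1'] := D1 eta eta eta0 eta1 eta0 eta1.
have [N2 D2'] := D2 eta eta eta0 eta2 eta0 eta2.
pose N := maxn N1 N2.
have [Fw Gw Fi Gi GF] := D1' N N (leq_maxl _ _) (leq_maxl _ _).
have [Gw3 Fw3 Gi3 Fi3 FG] := D2' N N (leq_maxr _ _) (leq_maxr _ _).
have cyc_transfer (W W' : finType) (L : simplicial_complex W) (L' : simplicial_complex W')
    p p' t (k : (W -> R) -> W' -> R) a :
    (forall w, 0 < p w)%N -> (forall w, 0 < p' w)%N ->
    (forall sigma v w, sigma \in (L : {set _}) ->
      v \in sigma -> w \in sigma -> (p v %| p w)%N || (p w %| p v)%N) ->
    (forall sigma v w, sigma \in (L' : {set _}) ->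
      v \in sigma -> w \in sigma -> (p' v %| p' w)%N || (p' w %| p' v)%N) ->
    0 < t -> t <= 1 -> maps_into L L' k ->
    weighted_cycle n L p a -> weighted_cochain L' p' n.+1 (transfer p p' N t k n.+1 a) ->
    weighted_cycle n L' p' (transfer p p' N t k n.+1 a).
  move=> p0 p'0 pt p't t0 t1 ki [wa cyc] wk; split=> //.
  case: cyc => [|a0]; [by left | right].
  have [aa _] := wa.
  by rewrite -(transfer_fbdry p0 pt p'0 p't N t0 t1 ki wa) a0 raddf0.
exists (transfer m m' N t' (snapped m' f t' eta) n.+1); split.
- move=> a ca; apply: (cyc_transfer _ _ K K') => //.
  by apply: Fw => //; case: ca.
- move=> b wb; exists (transfer m m' N t' (snapped m' f t' eta) n.+2 b); first exact: Fw.
  exact: (transfer_fbdry m_gt0 m_total m'_gt0 m'_total).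
- move=> a b' [wa cyc] wb' Fab.
  have [b wb eb] := GF a wa cyc.
  move: eb; rewrite Fab (transfer_fbdry m'_gt0 m'_total m_gt0 m_total N t20 t21 Gi wb').
  set c := transfer _ _ _ _ _ _ _ => eb.
  exists (c - b); first by apply: weighted_cochainB => //; apply: Gw.
  by rewrite raddfB /= -eb opprB addrC subrK.
move=> a' ca'; have [wa' cyc'] := ca'.
have [b' wb' eb'] := FG a' wa' cyc'.
exists (transfer m' m N t3 (snapped m g t3 eta) n.+1 a'), b'; split=> //.
apply: (cyc_transfer _ _ K' K) => //.
exact: Gw3.
Qed.

End HomologyEquivalence.

(** * Weighted homology through alternating functions *)

Section CodomTuples.
Variable V : finType.
Local Notation L := (freeZ (seq V)).

Lemma codom_recl n (w : 'I_n.+1 -> V) :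
  codom w = w ord0 :: codom (fun i => w (lift ord0 i)).
Proof. by rewrite /codom /image_mem !enumT /= -!enumT enum_ordSl /= -map_comp. Qed.

Lemma icut_codom (phi : V -> int) n (w : 'I_n.+1 -> V) :
  icut phi (gen (codom w)) =
  \sum_j gen (codom (fun i => w (lift j i))) *~ ((-1) ^+ j * phi (w j)).
Proof.
elim: n w => [|n IH] w.
  rewrite big_ord1 codom_recl -tcons_gen icut_cons expr0 mul1r.
  suff -> : codom (fun i => w (lift ord0 i)) = [::].
    by rewrite icut_gen0 (raddf0 (tcons (w ord0))) subr0.
  by apply/nilP; rewrite /nilp size_codom card_ord.
rewrite codom_recl -tcons_gen icut_cons IH [RHS]big_ord_recl expr0 mul1r.
congr (_ + _); rewrite (raddf_sum (tcons (w ord0))) -sumrN.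
apply: eq_bigr => j _; rewrite /= tconsMz tcons_gen -mulrNz; congr (gen _ *~ _).
  rewrite [RHS]codom_recl; congr (w _ :: _); first by apply: val_inj.
  by apply: eq_codom => i; congr (w _); apply: val_inj; rewrite /= /bump !leq0n !add1n ltnS addnS.
by rewrite /bump leq0n add1n exprS mulN1r mulNr.
Qed.

Definition delta (v y : V) : int := (v == y)%:R.

Lemma sum_delta y : \sum_v delta v y = 1.
Proof.
rewrite (bigD1 y) //= /delta eqxx big1 ?addr0 // => v vy.
by rewrite (negbTE vy).
Qed.

Local Notation psi s := (eval_vertices delta (gen s)).

(** The first interior product is the cofactor expansion along the first row. Permuting the entries
    of [w] then permutes columns, which gives [psi_perm]. *)
Lemma eval_det n (w u : 'I_n -> V) :
  psi (codom w) (codom u) = \det (\matrix_(i, j) (u i == w j)%:R).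
Proof.
elim: n w u => [|n IH] w u.
  have e (x : 'I_0 -> V) : codom x = [::].
    by apply/nilP; rewrite /nilp size_codom card_ord.
  by rewrite det_mx00 !e /eval_vertices /= coef_gen.
rewrite [codom u]codom_recl (expand_det_row _ ord0) /eval_vertices /= icut_codom.
rewrite (raddf_sum (tcut delta _)) (raddf_sum (coef [::])).
apply: eq_bigr => j _; rewrite /= !raddfMz /= -[coef _ _]/(psi _ _) IH mxE /cofactor add0n.
rewrite -mulrzr intz mulrC [(-1) ^+ j * _]mulrC -mulrA; congr (_ * (_ * _)).
by congr (\det _); apply/matrixP => a b; rewrite !mxE.
Qed.

Lemma psi_perm n (w : 'I_n -> V) (p : 'S_n) :
  psi (codom (fun i => w (p i))) = psi (codom w) *~ (-1) ^+ p.
Proof.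
apply/funext => u; rewrite fctMz.
have [su|su] := eqVneq (size u) n; last first.
  have z (x : 'I_n -> V) : psi (codom x) u = 0.
    apply/eqP; apply: contraNT su => /eval_gen_supp[-> _].
    by rewrite size_codom card_ord.
  by rewrite !z mul0rz.
have -> : u = codom (tnth (Tuple (introT eqP su))) by rewrite codomE map_tnth_enum.
rewrite !eval_det; set M := \matrix_(i, j) _.
have -> : M = col_perm p (\matrix_(i, j) (tnth (Tuple (introT eqP su)) i == w j)%:R).
  by apply/matrixP => i j; rewrite !mxE.
by rewrite col_permE det_mulmx det_perm odd_permV -mulrzr intz.
Qed.

Lemma psi_supp s u : psi s u != 0 -> size u = size s /\ {subset u <= s}.
Proof.
move=> /eval_gen_supp[su sub]; split=> // v /sub[y ys].
by rewrite /delta; have [->|] := eqVneq v y.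
Qed.

Lemma psi_id n (w : 'I_n -> V) : injective w -> psi (codom w) (codom w) = 1.
Proof.
move=> wI; rewrite eval_det -[RHS](det1 _ n); congr (\det _).
by apply/matrixP => i j; rewrite !mxE (inj_eq wI).
Qed.

End CodomTuples.

Section ChainModel.
Variables (V : finType) (K : simplicial_complex V) (t : wtype) (mu nu : {set V} -> nat).
Variable m : V -> nat.
Hypothesis nu_gt0 : forall sigma, sigma \in (K : {set _}) -> (0 < nu sigma)%N.
Hypothesis nu_coef : forall sigma tau, sigma \in (K : {set _}) -> tau \in (K : {set _}) ->
  tau \subset sigma -> (wcoef t mu sigma tau * nu tau)%N = nu sigma.
Hypothesis nu_dvd : forall sigma (z : int), sigma \in (K : {set _}) ->
  ((nu sigma)%:Z %| z)%Z <-> forall v, v \in sigma -> ((m v)%:Z %| z)%Z.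
Local Notation psi s := (eval_vertices (@delta V) (gen s)).
Local Notation cochain := (seq V -> int).

Section Degree.
Variable n : nat.
Implicit Types (v w : osimplex K n) (x y : ochain K n).

Definition vertices w : seq V := codom (\val w).

Lemma osimplex_inj w : injective (\val w).
Proof. by case: w => w /= /andP[/injectiveP]. Qed.

Lemma vset_simplex w : vset (\val w) \in (K : {set _}).
Proof. by case: w => w /= /andP[]. Qed.

Lemma vset_vertices w : vset (\val w) = [set v in vertices w]%SET.
Proof.
apply/setP => z; rewrite !inE; apply/imsetP/codomP => [[i _ ->]|[i ->]]; last by exists i.
by exists i.
Qed.

Lemma size_vertices w : size (vertices w) = n.+1.
Proof. by rewrite size_codom card_ord. Qed.

Lemma uniq_vertices w : uniq (vertices w).
Proof. by rewrite map_inj_uniq ?enum_uniq //; apply: osimplex_inj. Qed.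

Lemma vertices_osimplex (u : seq V) : uniq u -> size u = n.+1 ->
  [set v in u]%SET \in (K : {set _}) -> exists w, vertices w = u.
Proof.
move=> uu su uK; pose f : {ffun 'I_n.+1 -> V} := [ffun i => tnth (Tuple (introT eqP su)) i].
have cf : codom f = u.
  rewrite (eq_codom (g := tnth (Tuple (introT eqP su)))); last by move=> i; rewrite ffunE.
  by rewrite codomE map_tnth_enum.
have fK : is_osimplex K f.
  apply/andP; split; first by rewrite [injectiveb f](_ : _ = uniq (codom f)) // cf.
  suff -> : vset f = [set v in u]%SET by [].
  by apply/setP => z; rewrite -cf !inE; apply/imsetP/codomP => [[i _ ->]|[i ->]]; exists i.
by exists (Sub f fK); rewrite /vertices SubK.
Qed.

Definition ocochain w : cochain := psi (vertices w) *~ (nu (vset (\val w)))%:Z.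

Lemma ocochain_perm w p : ocochain (osimplex_perm w p) = ocochain w *~ (-1) ^+ p.
Proof.
rewrite /ocochain vset_perm -mulrzA mulrC mulrzA; congr (_ *~ _).
rewrite -psi_perm; congr (eval_vertices _ (gen _)).
by apply: eq_codom => i; rewrite /= ffunE.
Qed.

Definition ocochains x : cochain := \sum_w ocochain w *~ x w.

Fact ocochains_zmod_morphism : zmod_morphism ocochains.
Proof.
move=> x y; rewrite /ocochains -sumrB; apply: eq_bigr => w _.
by rewrite !ffunE mulrzBr.
Qed.
HB.instance Definition _ :=
  GRing.isZmodMorphism.Build (ochain K n) cochain ocochains ocochains_zmod_morphism.

Lemma ocochains_obasis w : ocochains (obasis w) = ocochain w.
Proof.
rewrite /ocochains (bigD1 w) //= big1 ?addr0 ?ffunE ?eqxx // => v vw.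
by rewrite ffunE (negbTE vw).
Qed.

Lemma ocochains_orient x : x \in @orient_pred V K n -> ocochains x = 0.
Proof.
move=> /asboolP[a ->]; rewrite raddf_sum big1 // => -[w p] _.
by rewrite raddfMz /= raddfB /= raddfMz /= !ocochains_obasis ocochain_perm subrr mul0rz.
Qed.

Definition chain_cochain (c : chain K n) : cochain := ocochains (generic_quotient.repr c).

Lemma chain_cochain_class x : chain_cochain (chain_class x) = ocochains x.
Proof.
apply/eqP; rewrite -subr_eq0 -raddfB /=; apply/eqP/ocochains_orient.
by rewrite -chain_classE /chain_class reprK.
Qed.

Lemma chain_classP (c : chain K n) : exists x, c = chain_class x.
Proof. by exists (generic_quotient.repr c); rewrite /chain_class reprK. Qed.

Fact chain_cochain_zmod_morphism : zmod_morphism chain_cochain.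
Proof.
move=> c d; have [x ->] := chain_classP c; have [y ->] := chain_classP d.
by rewrite -chain_classB !chain_cochain_class raddfB.
Qed.
HB.instance Definition _ := GRing.isZmodMorphism.Build (chain K n) cochain
  chain_cochain chain_cochain_zmod_morphism.

Lemma ocochain_supp w u : ocochain w u != 0 ->
  [/\ uniq u, size u = n.+1 & [set v in u]%SET = vset (\val w)].
Proof.
rewrite /ocochain fctMz -mulrzr intz mulf_eq0 negb_or => /andP[pu _].
have [su sub] := psi_supp pu; have uu := alternating_uniq (alternating_eval _ _) pu.
split=> //; first by rewrite su size_vertices.
rewrite vset_vertices; apply/eqP; rewrite eqEcard; apply/andP; split.
  by apply/fintype.subsetP => z; rewrite !inE => /sub.
by rewrite !cardsE (card_uniqP uu) (card_uniqP (uniq_vertices w)) su.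
Qed.

Lemma ocochain_weighted w : weighted_cochain K m n.+1 (ocochain w).
Proof.
split; first by move=> s x y r; rewrite /ocochain !fctMz alternating_eval mulNrz.
move=> u ou; have [uu su us] := ocochain_supp ou.
split=> [//||v vu]; first by rewrite us vset_simplex.
rewrite /ocochain fctMz -mulrzr intz; apply: dvdz_mull.
have /(nu_dvd _ (vset_simplex w))/(_ v) := dvdzz (nu (vset (\val w)))%:Z.
by apply; rewrite -us inE.
Qed.

Lemma chain_cochain_weighted c : weighted_cochain K m n.+1 (chain_cochain c).
Proof.
apply: weighted_cochain_sum => w _; apply: weighted_cochainMz.
exact: ocochain_weighted.
Qed.

Definition same_vset w := fun v => vset (\val v) == vset (\val w).
(** One chosen orientation for each vertex set. Modulo the orientation relations the representatives
    generate all chains, and on them coefficients can be read off the alternating function. *)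
Definition rep w : osimplex K n := choose (same_vset w) w.

Lemma rep_vset w : vset (\val (rep w)) = vset (\val w).
Proof. by apply/eqP; apply: (chooseP (P := same_vset w)); rewrite /same_vset. Qed.

Lemma eq_rep v w : vset (\val v) = vset (\val w) -> rep v = rep w.
Proof.
move=> vw; rewrite /rep (eq_choose (Q := same_vset w)); last first.
  by move=> z; rewrite /same_vset vw.
by apply: choose_id; rewrite /same_vset ?vw.
Qed.

Lemma rep_perm w : exists p, w = osimplex_perm (rep w) p.
Proof.
have /tuple_permP[p e] : perm_eq (mktuple (\val w)) (mktuple (\val (rep w))).
  apply: uniq_perm; [exact: uniq_vertices | exact: uniq_vertices|] => z.
  by have /setP/(_ z) := rep_vset w; rewrite !vset_vertices !inE => ->.
exists p; apply/val_inj/ffunP => i; rewrite /= ffunE.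
have /(congr1 (fun r : n.+1.-tuple V => tnth r i)) := val_inj e.
by rewrite !tnth_mktuple.
Qed.

Lemma perm_rep w : perm_eq (vertices w) (vertices (rep w)).
Proof.
apply: uniq_perm; [exact: uniq_vertices | exact: uniq_vertices|] => z.
by have /setP/(_ z) := rep_vset w; rewrite !vset_vertices !inE => ->.
Qed.

Lemma rep_rep w : rep (rep w) = rep w.
Proof. exact/eq_rep/rep_vset. Qed.

Definition at_simplex v : ochain K n -> int := fun x => x v.
Fact at_simplex_zmod_morphism v : zmod_morphism (at_simplex v).
Proof. by move=> x y; rewrite /at_simplex !ffunE. Qed.
HB.instance Definition _ v := GRing.isZmodMorphism.Build (ochain K n) int
  (at_simplex v) (at_simplex_zmod_morphism v).

Lemma ochain_sumE (I : finType) (F : I -> osimplex K n) (k : I -> int) v :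
  (\sum_i obasis (F i) *~ k i) v = \sum_i (v == F i)%:R * k i.
Proof.
rewrite -[LHS]/(at_simplex v _) raddf_sum; apply: eq_bigr => i _.
by rewrite raddfMz /= -mulrzr intz /at_simplex ffunE.
Qed.

Lemma ochain_sum x : x = \sum_w obasis w *~ x w.
Proof.
apply/ffunP => v; rewrite (ochain_sumE id) (bigD1 v) //= eqxx mul1r big1 ?addr0 //.
by move=> w wv; rewrite eq_sym (negbTE wv) mul0r.
Qed.

Lemma ocochains_rep x w : (forall v, x v != 0 -> rep v = v) -> rep w = w ->
  ocochains x (vertices w) = (nu (vset (\val w)))%:Z * x w.
Proof.
move=> xr wr; rewrite /ocochains fct_sumE (bigD1 w) //= big1 ?addr0.
  rewrite fctMz /ocochain fctMz /vertices psi_id; last exact: osimplex_inj.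
  by rewrite -mulrzA intz.
move=> v vw; rewrite fctMz; have [->|xv] := eqVneq (x v) 0; first by rewrite mulr0z.
have [->|/ocochain_supp[_ _ e]] := eqVneq (ocochain v (vertices w)) 0.
  by rewrite mul0rz.
case/eqP: vw; rewrite -(xr _ xv) -wr; apply: eq_rep.
by rewrite -e vset_vertices.
Qed.

Lemma ochain_rep x : exists2 y, x - y \in @orient_pred V K n &
  forall w, y w != 0 -> rep w = w.
Proof.
have /choice[p pE] := rep_perm.
exists (\sum_w obasis (rep w) *~ ((-1) ^+ p w * x w)).
  rewrite {1}(ochain_sum x) -sumrB; apply: rpred_sum => w _.
  rewrite mulrzA -mulrzBl {1}(pE w); apply: rpredMz; exact: orient_relP.
move=> w; rewrite ochain_sumE => yw; apply/eqP; apply: contraNT yw => rw.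
apply/eqP/big1 => v _; have [e|e] := eqVneq w (rep v); last by rewrite mul0r.
by rewrite e rep_rep eqxx in rw.
Qed.

Lemma chain_cochain_inj c : chain_cochain c = 0 -> c = 0.
Proof.
have [x ->] := chain_classP c; have [y xy yr] := ochain_rep x.
have -> : chain_class x = chain_class y by apply/eqP; rewrite chain_classE.
rewrite chain_cochain_class => oy.
suff -> : y = 0 by apply: (raddf0 (GRing.Additive.clone _ _ (@chain_class V K n) _)).
apply/ffunP => w; rewrite ffunE; apply/eqP; apply: contraT => yw.
have /(congr1 (fun a : cochain => a (vertices w))) := oy.
rewrite ocochains_rep //; last exact: yr.
move/eqP; rewrite mulf_eq0 (negbTE yw) orbF.
by have := nu_gt0 (vset_simplex w); case: (nu _).
Qed.

(** The values of [a] on the representatives are divided by [nu], exactly so by [nu_dvd]; an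
    alternating function supported on simplices is determined by these values. *)
Lemma chain_cochain_surj a : weighted_cochain K m n.+1 a ->
  exists c, chain_cochain c = a.
Proof.
move=> wa; pose x : ochain K n :=
  [ffun w => if rep w == w then (a (vertices w) %/ (nu (vset (\val w)))%:Z)%Z else 0].
have xr v : x v != 0 -> rep v = v by rewrite ffunE; have [//|_] := eqVneq (rep v) v; rewrite eqxx.
exists (chain_class x); rewrite chain_cochain_class.
have wd : weighted_cochain K m n.+1 (ocochains x - a).
  by apply: weighted_cochainB => //; rewrite -chain_cochain_class; apply: chain_cochain_weighted.
apply/eqP; rewrite -subr_eq0; apply/eqP/funext => u; apply/eqP; apply: contraT => du.
have [ad dK] := wd; have [su uK _] := dK u du.
have [w wu] : exists w, vertices w = u.
  apply: vertices_osimplex => //; first exact: alternating_uniq ad du.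
  by apply: uK; rewrite -size_eq0 su.
case/eqP: du; rewrite -wu; apply: (alternating_perm ad (perm_rep w)).
rewrite !fctE ocochains_rep ?rep_rep // ffunE rep_rep eqxx mulrC divzK ?subrr //.
apply/(nu_dvd _ (vset_simplex _)) => v; rewrite vset_vertices inE => vr.
have [->|av] := eqVneq (a (vertices (rep w))) 0; first exact: dvdz0.
by have [_ /(_ _ av)[_ _]] := wa; apply.
Qed.

End Degree.

Lemma psi_fbdry n (w : 'I_n.+1 -> V) :
  fbdry (psi (codom w)) = \sum_j psi (codom (fun i => w (lift j i))) *~ (-1) ^+ j.
Proof.
rewrite -eval_tbdry; last by apply: supported_gen => y _; apply: sum_delta.
rewrite [tbdry _]icut_codom (raddf_sum (eval_vertices (@delta V))).
by apply: eq_bigr => j _; rewrite mulr1 raddfMz.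
Qed.

(** By [nu_coef], multiplying simplices by [nu] absorbs the weighted incidence coefficients and
    leaves the ordinary boundary. *)
Lemma chain_cochain_bdry n (c : chain K n.+1) :
  chain_cochain (bdry t mu c) = fbdry (chain_cochain c).
Proof.
have [x ->] := chain_classP c; rewrite bdry_class !chain_cochain_class.
rewrite /obdry {2}/ocochains !raddf_sum; apply: eq_bigr => w _.
rewrite (raddfMz (@ocochains n)) (raddfMz (@fbdry V)) /=; congr (_ *~ _).
rewrite /obdry_simplex (raddf_sum (@ocochains n)) /ocochain (raddfMz (@fbdry V)) /= psi_fbdry mulrz_suml.
apply: eq_bigr => j _; rewrite (raddfMz (@ocochains n)) /= ocochains_obasis /ocochain -!mulrzA.
have -> : vertices (osimplex_face w j) = codom (fun i => \val w (lift j i)).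
  by apply: eq_codom => i; rewrite /= ffunE.
congr (_ *~ _); rewrite mulrCA -PoszM; congr (_ * Posz _).
rewrite mulnC; apply: nu_coef; [exact: vset_simplex | exact: (vset_simplex (osimplex_face w j))|].
by apply/fintype.subsetP => z /imsetP[i _ ->]; rewrite /= ffunE; apply: imset_f.
Qed.

End ChainModel.

(** * Compactness *)

Section Topology.
Variable R : realType.
Local Open Scope classical_set_scope.

(** There are finitely many coordinates, so pointwise convergence is convergence in the maximum
    distance. *)
Lemma nbhs_near (V : finType) (y : {ptws V -> R}) (A : set {ptws V -> R}) :
  nbhs y A <-> exists2 d : R, 0 < d & forall z : V -> R, near d y z -> A z.
Proof.
split=> [yA|[d d0 dA]].
  pose F : set_system {ptws V -> R} :=
    filter_from [set d : R | 0 < d] (fun d => [set z : {ptws V -> R} | near d y z]).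
  have FF : Filter F.
    apply: filter_from_filter; first by exists 1 => /=.
    move=> d e d0 e0; exists (Num.min d e) => /=; first by rewrite lt_min d0.
    by move=> z yz; split; apply: near_le yz; rewrite ge_min lexx ?orbT.
  have Fy : {ptws, F --> y}.
    apply/(@pointwise_cvgP (discrete_topology V) R F y FF) => v.
    by apply/cvgrPdist_le => e e0; exists e.
  by have [d d0 dA] := Fy A yA; exists d => // z; apply: dA.
have H : nbhs y [set z : {ptws V -> R} | forall v, `|y v - z v| <= d].
  apply: (@filter_forall _ V (fun v (z : {ptws V -> R}) => `|y v - z v| <= d) (nbhs y)) => v.
  have yv : nbhs (y v : R) [set x : R | `|y v - x| <= d].
    by apply/nbhs_ballP; exists d => // x; rewrite /ball /= => /ltW.
  exact: (@proj_continuous V (fun=> R) v y _ yv).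
exact: (@filterS _ (nbhs y) _ [set z | forall v, `|y v - z v| <= d] A dA H).
Qed.

Lemma closed_realization (V : finType) (K : simplicial_complex V) :
  closed (realization (R := R) K).
Proof.
move=> y cy; have approx d : 0 < d -> exists2 z : V -> R, realization K z & near d y z.
  move=> d0; have /cy[z [zK yz]] : nbhs y [set z : {ptws V -> R} | near d y z].
    by apply/nbhs_near; exists d.
  by exists z.
have y0 v : 0 <= y v.
  rewrite leNgt; apply/negP => yv; have [z [z0 _ _] yz] := approx (- y v / 2) ltac:(lra).
  have := yz v; have := z0 v; rewrite ler_norml => ? /andP[]; lra.
have y1 : \sum_v y v = 1.
  apply/eqP; rewrite -subr_eq0 -normr_le0 leNgt; apply/negP; set e := `|_| => e0.
  have V0 : 0 < #|V|.+1%:R :> R by rewrite ltr0Sn.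
  have [z [_ z1 _] yz] := approx (e / #|V|.+1%:R) (divr_gt0 e0 V0).
  suff : e < e by rewrite ltxx.
  rewrite {1}/e -z1 -sumrB; apply: le_lt_trans (ler_norm_sum _ _ _) _.
  apply: le_lt_trans (ler_sum _ (fun v _ => yz v)) _.
  rewrite sumr_const -[_ *+ _]mulr_natl mulrA ltr_pdivrMr // mulrC ltr_pM2l //.
  by rewrite ltr_nat ltnS max_card.
(* A point within half the least positive coordinate of [y] is positive wherever [y] is, so the
   carrier of [y] is a face of a simplex of [K]. *)
split=> //; pose d := \big[Num.min/1]_(v in carrier y) y v.
have d0 : 0 < d by apply: lt_bigmin => // v; rewrite inE.
have [z [z0 z1 zK] yz] := approx (d / 2) (divr_gt0 d0 (ltr0Sn R 1)).
apply: (simplex_face zK); last exact: carrier_neq0.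
apply/fintype.subsetP => v vy; rewrite inE.
have dv : d <= y v by apply: bigmin_le_cond.
have := yz v; rewrite ler_norml => /andP[_]; lra.
Qed.

Lemma compact_realization (V : finType) (K : simplicial_complex V) :
  compact (realization (R := R) K).
Proof.
apply: (subclosed_compact (@closed_realization V K)
  (@tychonoff V (fun=> R) (fun=> `[0, 1]%classic) (fun=> @segment_compact R 0 1))).
move=> y yK v /=; rewrite in_itv /=; apply/andP; split; first by case: yK.
exact: realization_le1 yK.
Qed.

Lemma nbhs_subtype (X : topologicalType) (A : set X) (x : classical_sets.set_type A) (U : set (classical_sets.set_type A)) :
  nbhs x U -> exists2 W, nbhs (\val x) W & forall z : classical_sets.set_type A, W (\val z) -> U z.
Proof.
case=> _ [[W oW <-] Wx] sWU; exists W; last by move=> z; apply: sWU.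
exact: open_nbhs_nbhs.
Qed.

Definition coords (V : finType) (K : simplicial_complex V)
  (x : classical_sets.set_type (realization (R := R) K)) : V -> R :=
  (\val x : {ptws V -> R}).

Definition time (s : unit_interval R) : R := (\val s : R).

Section CompactCylinder.
Variables (V : finType) (K : simplicial_complex V).
Local Notation S := (classical_sets.set_type (realization (R := R) K)).
Local Notation I := (unit_interval R).
Implicit Types (x : S) (s : I).

Lemma coords_realization (x : S) : realization K (coords x).
Proof. exact: set_mem (valP x). Qed.

Lemma time_range (s : I) : 0 <= time s <= 1.
Proof. by have := set_mem (valP s); rewrite /= in_itv. Qed.

(** The Lebesgue number principle on the compact space |K| x [0,1]: a property inherited by smaller
    [d] and valid locally holds for one [d] everywhere. *)
Lemma cylinder_uniform (P : R -> S -> I -> Prop) :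
  (forall d e x s, e <= d -> P d x s -> P e x s) ->
  (forall x s, exists2 d, 0 < d & forall x' s',
     near d (coords x) (coords x') -> `|time s - time s'| <= d -> P d x' s') ->
  exists2 d, 0 < d & forall x s, P d x s.
Proof.
move=> Pmono Ploc.
have cC := compact_setX (@compact_realization V K) (@segment_compact R 0 1).
move/compact_near_coveringP: cC => cC.
pose Q (d : R) (p : {ptws V -> R} * R) :=
  forall (x : S) (s : I), coords x = p.1 -> time s = p.2 -> P d x s.
have [|d [d0 dQ]] := filter_ex (filterI (nbhs_right_gt 0) (cC R 0^'+ Q _ _)).
  move=> [y s] [yK sI].
  have [d d0 dP] := Ploc (exist _ y (mem_set yK)) (exist _ s (mem_set sI)).
  exists ([set p | near d y p.1 /\ `|s - p.2| <= d], [set e | e <= d]).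
    split=> /=; last exact: nbhs_right_le.
    exists ([set z | near d y z], [set u | `|s - u| <= d]); last by move=> [z u] [].
    split=> /=; first by apply/nbhs_near; exists d.
    by apply/nbhs_ballP; exists d => // u; rewrite /ball /= => /ltW.
  move=> [[z u] e] [/= [yz su] ed] x' s' /= xz su'; apply: (Pmono _ _ _ _ ed).
  by apply: dP => /=; rewrite ?xz ?su'.
exists d => // x s.
apply: (dQ (coords x, time s)) => //; split => /=; [exact: coords_realization | rewrite in_itv; exact: time_range].
Qed.

Variables (V' : finType) (K' : simplicial_complex V').
Local Notation S' := (classical_sets.set_type (realization (R := R) K')).
Variable h : S * I -> S'.
Hypothesis h_cont : continuous h.

Lemma cylinder_pointwise eps x s : 0 < eps -> exists2 d, 0 < d & forall x' s',
  near d (coords x) (coords x') -> `|time s - time s'| <= d ->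
  near eps (coords (h (x, s))) (coords (h (x', s'))).
Proof.
move=> e0; have nb : nbhs (h (x, s)) [set z : S' | near eps (coords (h (x, s))) (coords z)].
  have : nbhs (coords (h (x, s)) : {ptws V' -> R}) [set z : {ptws V' -> R} | near eps (coords (h (x, s))) z].
    by apply/nbhs_near; exists eps.
  exact: (@initial_continuous S' {ptws V' -> R} set_val).
have [[A B] [/= /nbhs_subtype[W nW WA] /nbhs_subtype[W2 nW2 W2B]] AB] := h_cont nb.
have /nbhs_near[d1 d10 dW] := nW.
have /nbhs_ballP[d2 /= d20 dW2] := nW2.
exists (Num.min d1 (d2 / 2)); first by rewrite lt_min d10 divr_gt0.
move=> x' s' xx' ss'; apply: (AB (x', s')); split=> /=.
  by apply/WA/dW; apply: near_le xx'; rewrite ge_min lexx.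
apply/W2B/dW2; rewrite /ball /=; apply: le_lt_trans ss' _.
by rewrite gt_min [d2 / 2 < d2]ltr_pdivrMr // ltr_pMr // ltr1n orbT.
Qed.

Lemma cylinder_continuity eps : 0 < eps -> exists2 d, 0 < d & forall x s x' s',
  near d (coords x) (coords x') -> `|time s - time s'| <= d ->
  near eps (coords (h (x, s))) (coords (h (x', s'))).
Proof.
move=> e0; pose P d x s := forall x' s', near d (coords x) (coords x') ->
  `|time s - time s'| <= d -> near eps (coords (h (x, s))) (coords (h (x', s'))).
apply: (@cylinder_uniform P).
  by move=> d e x s ed Pd x' s' xx ss; apply: Pd; [apply: near_le xx | apply: le_trans ed].
move=> x s; have [d d0 dP] := cylinder_pointwise x s (divr_gt0 e0 (ltr0Sn R 1)).
exists (d / 2); first by rewrite divr_gt0.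
have dd : d / 2 <= d by lra.
move=> x' s' xx' ss' x2 s2 x'x2 s's2.
have n1 := dP x' s' (near_le dd xx') (le_trans ss' dd).
have n2 : near (eps / 2) (coords (h (x, s))) (coords (h (x2, s2))).
  apply: dP; first by apply: near_le (near_trans xx' x'x2); lra.
  by apply: le_trans (ler_distD (time s') _ _) _; lra.
by apply: near_le (near_trans (near_sym n1) n2); lra.
Qed.

(** At each point the vertex [w] supplied by the hypothesis has a positive coordinate, which stays
    above half its value nearby; compactness makes the bound uniform for each of the finitely many
    [v]. *)
Lemma cylinder_lower_bound (m : V -> nat) (m' : V' -> nat) tau : 0 < tau ->
  (forall x s v, v \in carrier (coords x) ->
     exists2 w, w \in carrier (coords (h (x, s))) & (m' w %| m v)%N) ->
  exists2 tau', 0 < tau' & forall x s v, tau <= coords x v ->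
    exists2 w, tau' <= coords (h (x, s)) w & (m' w %| m v)%N.
Proof.
move=> t0 hw.
have /choice[f fP] : forall v, exists t, 0 < t /\ forall x s, tau <= coords x v ->
    exists2 w, t <= coords (h (x, s)) w & (m' w %| m v)%N.
  move=> v.
  suff [d d0 dP] : exists2 d, 0 < d & forall x s, tau <= coords x v ->
      exists2 w, d <= coords (h (x, s)) w & (m' w %| m v)%N by exists d.
  apply: cylinder_uniform => [d e x s ed Pd xv|x s].
    by have [w dw wv] := Pd xv; exists w => //; apply: le_trans dw.
  (* If coordinate [v] of [x] is below [tau], the premise fails on a whole neighbourhood. *)
  have [xv|xv] := ltP (coords x v) tau.
    exists ((tau - coords x v) / 2); first by rewrite divr_gt0 ?subr_gt0.
    by move=> x' s' /(_ v) + _ tx'; rewrite ler_norml => /andP[]; lra.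
  have [|w wc wv] := hw x s v; first by rewrite inE; lra.
  rewrite inE in wc.
  have [d d0 dP] := cylinder_pointwise x s (divr_gt0 wc (ltr0Sn R 1)).
  exists (Num.min d (coords (h (x, s)) w / 2)); first by rewrite lt_min d0 divr_gt0.
  move=> x' s' xx' ss' _; exists w => //.
  have := dP x' s'; move=> /(_ _ _ w) H.
  have /andP[_] : - (coords (h (x, s)) w / 2) <= coords (h (x, s)) w - coords (h (x', s')) w <=
      coords (h (x, s)) w / 2.
    rewrite -ler_norml; apply: H; first by apply: near_le xx'; rewrite ge_min lexx.
    by apply: le_trans ss' _; rewrite ge_min lexx.
  by rewrite ge_min => ?; apply/orP; right; lra.
exists (\big[Num.min/1]_v f v); first by apply: lt_bigmin => // v _; case: (fP v).
move=> x s v xv; have [_ /(_ x s xv)[w fw wv]] := fP v; exists w => //.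
by apply: le_trans fw; apply: bigmin_le.
Qed.

End CompactCylinder.

End Topology.

(** * Passage to the homology groups *)

Section QuotientIso.
Variables (Z Z' : zmodType) (S : zmodClosed Z) (S' : zmodClosed Z').
Variable phi : {additive Z -> Z'}.
Hypothesis phi_mem : forall z, (phi z \in S') = (z \in S).
Hypothesis phi_surj : forall z', exists z, phi z - z' \in S'.
Local Notation Q := (Quotient.quot S).
Local Notation Q' := (Quotient.quot S').

Definition quot_map (q : Q) : Q' := (\pi_Q' (phi (generic_quotient.repr q)))%qT.

Lemma quot_map_pi z : quot_map (\pi_Q z)%qT = (\pi_Q' (phi z))%qT.
Proof.
apply/eqP; rewrite /quot_map -Quotient.idealrBE -raddfB phi_mem.
by rewrite Quotient.idealrBE reprK.
Qed.

Lemma quot_piP (q : Q) : exists z, q = (\pi_Q z)%qT.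
Proof. by exists (generic_quotient.repr q); rewrite reprK. Qed.

Fact quot_map_zmod_morphism : zmod_morphism quot_map.
Proof.
move=> q r; have [x ->] := quot_piP q; have [y ->] := quot_piP r.
by rewrite -raddfB !quot_map_pi !raddfB.
Qed.
HB.instance Definition _ :=
  GRing.isZmodMorphism.Build Q Q' quot_map quot_map_zmod_morphism.

Lemma quotient_isomorphic : zmod_isomorphic Q Q'.
Proof.
exists quot_map.
have inj : injective quot_map.
  move=> q r; have [x ->] := quot_piP q; have [y ->] := quot_piP r.
  rewrite !quot_map_pi => /eqP; rewrite -Quotient.idealrBE -raddfB phi_mem.
  by rewrite Quotient.idealrBE => /eqP.
have /choice[g gP] : forall q' : Q', exists q : Q, quot_map q = q'.
  move=> q'; have [z zP] := phi_surj (generic_quotient.repr q').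
  exists (\pi_Q z)%qT; rewrite quot_map_pi -[q' in RHS]reprK.
  by apply/eqP; rewrite -Quotient.idealrBE.
by exists g => q; [apply: inj; apply: gP | apply: gP].
Qed.

End QuotientIso.

Section HomologyIso.
Variables (V : finType) (K : simplicial_complex V) (t : wtype) (mu nu : {set V} -> nat).
Variable m : V -> nat.
Hypothesis nu_gt0 : forall sigma, sigma \in (K : {set _}) -> (0 < nu sigma)%N.
Hypothesis nu_coef : forall sigma tau, sigma \in (K : {set _}) -> tau \in (K : {set _}) ->
  tau \subset sigma -> (wcoef t mu sigma tau * nu tau)%N = nu sigma.
Hypothesis nu_dvd : forall sigma (z : int), sigma \in (K : {set _}) ->
  ((nu sigma)%:Z %| z)%Z <-> forall v, v \in sigma -> ((m v)%:Z %| z)%Z.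

(** [fbdry] includes the augmentation while the differential out of degree 0 is zero, hence the
    disjunction. *)
Lemma mem_cycles n (c : chain K n) :
  (c \in cycle_pred (bdry_from K t mu n)) <-> (n = 0%N \/ fbdry (chain_cochain nu c) = 0).
Proof.
rewrite unfold_in; case: n c => [|n] c /=.
  by split=> _; [left | rewrite eqxx].
rewrite -(chain_cochain_bdry nu_coef).
split=> [/eqP->|[//|/(chain_cochain_inj nu_gt0)->//]].
by right; rewrite raddf0.
Qed.

Lemma mem_boundaries n (z : cycles (bdry_from K t mu n)) :
  (z \in boundary_pred (@bdry V K t mu n) (d0 := bdry_from K t mu n)) <->
  exists2 b, weighted_cochain K m n.+2 b & chain_cochain nu (\val z) = fbdry b.
Proof.
rewrite unfold_in; split=> [/asboolP[c cz]|[b wb e]].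
  exists (chain_cochain nu c); first exact: (chain_cochain_weighted nu_dvd).
  by rewrite -(chain_cochain_bdry nu_coef) cz.
have [c cb] := chain_cochain_surj nu_dvd wb; apply/asboolP; exists c.
apply/eqP; rewrite -subr_eq0; apply/eqP/(chain_cochain_inj nu_gt0).
by rewrite raddfB /= (chain_cochain_bdry nu_coef) cb e subrr.
Qed.

Lemma cycle_weighted n (z : cycles (bdry_from K t mu n)) :
  weighted_cycle n K m (chain_cochain nu (\val z)).
Proof.
by split; [exact: (chain_cochain_weighted nu_dvd) | apply/mem_cycles/(valP z)].
Qed.

Lemma weighted_cycle_surj n a : weighted_cycle n K m a ->
  exists z : cycles (bdry_from K t mu n), chain_cochain nu (\val z) = a.
Proof.
move=> [wa cyc]; have [c ca] := chain_cochain_surj nu_dvd wa.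
have cz : c \in cycle_pred (bdry_from K t mu n) by apply/mem_cycles; rewrite ca.
by exists (exist _ c cz).
Qed.

End HomologyIso.

Section WeightedHomologyIso.
Variables (V : finType) (K : simplicial_complex V) (t : wtype) (mu nu : {set V} -> nat).
Variable m : V -> nat.
Hypothesis nu_gt0 : forall sigma, sigma \in (K : {set _}) -> (0 < nu sigma)%N.
Hypothesis nu_coef : forall sigma tau, sigma \in (K : {set _}) -> tau \in (K : {set _}) ->
  tau \subset sigma -> (wcoef t mu sigma tau * nu tau)%N = nu sigma.
Hypothesis nu_dvd : forall sigma (z : int), sigma \in (K : {set _}) ->
  ((nu sigma)%:Z %| z)%Z <-> forall v, v \in sigma -> ((m v)%:Z %| z)%Z.
Variables (V' : finType) (K' : simplicial_complex V') (t' : wtype) (mu' nu' : {set V'} -> nat).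
Variable m' : V' -> nat.
Hypothesis nu'_gt0 : forall sigma, sigma \in (K' : {set _}) -> (0 < nu' sigma)%N.
Hypothesis nu'_coef : forall sigma tau, sigma \in (K' : {set _}) -> tau \in (K' : {set _}) ->
  tau \subset sigma -> (wcoef t' mu' sigma tau * nu' tau)%N = nu' sigma.
Hypothesis nu'_dvd : forall sigma (z : int), sigma \in (K' : {set _}) ->
  ((nu' sigma)%:Z %| z)%Z <-> forall v, v \in sigma -> ((m' v)%:Z %| z)%Z.

(** A cycle goes to the unique cycle whose alternating function is its image under [F]; uniqueness,
    from [chain_cochain_inj], makes this additive. *)
Lemma weighted_homology_isomorphic n
    (F : {additive (seq V -> int) -> (seq V' -> int)}) :
  (forall a, weighted_cycle n K m a -> weighted_cycle n K' m' (F a)) ->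
  (forall b, weighted_cochain K m n.+2 b ->
     exists2 b', weighted_cochain K' m' n.+2 b' & F (fbdry b) = fbdry b') ->
  (forall a b', weighted_cycle n K m a -> weighted_cochain K' m' n.+2 b' ->
     F a = fbdry b' -> exists2 b, weighted_cochain K m n.+2 b & a = fbdry b) ->
  (forall a', weighted_cycle n K' m' a' -> exists a b',
     [/\ weighted_cycle n K m a, weighted_cochain K' m' n.+2 b' & F a - a' = fbdry b']) ->
  zmod_isomorphic (weighted_homology K t mu n) (weighted_homology K' t' mu' n).
Proof.
move=> Fcyc Fbd Finj Fsurj.
have cw := cycle_weighted nu_gt0 nu_coef nu_dvd (n := n).
have /choice[phi phiP] : forall z : cycles (bdry_from K t mu n),
    exists z' : cycles (bdry_from K' t' mu' n),
    chain_cochain nu' (\val z') = F (chain_cochain nu (\val z)).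
  by move=> z; apply: (weighted_cycle_surj nu'_gt0 nu'_coef nu'_dvd); apply: Fcyc.
have phi_morph : zmod_morphism phi.
  move=> x y; apply: val_inj; apply/eqP; rewrite -subr_eq0; apply/eqP.
  have vB (u v : cycles (bdry_from K t mu n)) : chain_cochain nu (\val (u - v)) =
      chain_cochain nu (\val u) - chain_cochain nu (\val v) by rewrite !raddfB.
  have vB' (u v : cycles (bdry_from K' t' mu' n)) : chain_cochain nu' (\val (u - v)) =
      chain_cochain nu' (\val u) - chain_cochain nu' (\val v) by rewrite !raddfB.
  apply: (chain_cochain_inj nu'_gt0); rewrite (raddfB (@chain_cochain V' K' nu' n)) /=.
  by rewrite vB' !phiP vB raddfB subrr.
pose phiA : {additive cycles (bdry_from K t mu n) -> cycles (bdry_from K' t' mu' n)} :=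
  HB.pack phi (GRing.isZmodMorphism.Build _ _ phi phi_morph).
have memB := mem_boundaries nu_gt0 nu_coef nu_dvd (n := n).
have memB' := mem_boundaries nu'_gt0 nu'_coef nu'_dvd (n := n).
apply: (@quotient_isomorphic _ _ _ _ phiA) => [z|z'].
  apply/idP/idP => [/memB'[b' wb' e]|/memB[b wb e]].
    apply/memB; apply: (Finj _ b' (cw z) wb').
    by rewrite -e -phiP.
  have [b' wb' e'] := Fbd b wb; apply/memB'; exists b' => //.
  by rewrite -e' -e -phiP.
have [a [b' [wa wb' e]]] := Fsurj _ (cycle_weighted nu'_gt0 nu'_coef nu'_dvd z').
have [z za] := weighted_cycle_surj nu_gt0 nu_coef nu_dvd wa.
exists z; apply/memB'; exists b' => //.
by rewrite -e -za -phiP -raddfB.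
Qed.

End WeightedHomologyIso.

(** * From maps between realizations to maps of coordinate vectors *)

Section Extension.
Variable R : realType.
Variables (V : finType) (K : simplicial_complex V) (m : V -> nat).
Variables (V' : finType) (K' : simplicial_complex V') (m' : V' -> nat).
Local Notation S := (classical_sets.set_type (realization (R := R) K)).
Local Notation S' := (classical_sets.set_type (realization (R := R) K')).
Local Notation I := (unit_interval R).
Variable h : S * I -> S'.

Lemma coords_surj (y : V -> R) : realization K y -> exists x : S, coords x = y.
Proof. by move=> yK; exists (exist _ y (mem_set yK)). Qed.

Lemma time_surj (t : R) : 0 <= t <= 1 -> exists s : I, time s = t.
Proof.
move=> t01; have tI : (`[0, 1]%classic : set R) t by rewrite /= in_itv.
by exists (exist _ t (mem_set tI)).
Qed.

(** The transfer construction works with total functions on coordinate vectors; the value off the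
    cylinder is arbitrary. *)
Definition extend (t : R) (y : V -> R) : V' -> R :=
  if pselect (exists p : S * I, coords p.1 = y /\ time p.2 = t) is left e
  then coords (h (projT1 (cid e))) else fun=> 0.

Lemma extendE (x : S) (s : I) : extend (time s) (coords x) = coords (h (x, s)).
Proof.
rewrite /extend; case: pselect => [e|[]]; last by exists (x, s).
case: (cid e) => -[x' s'] /= [xx ss].
have -> : x' = x by apply: val_inj.
by have -> : s' = s by apply: val_inj.
Qed.

Lemma extend_into t : 0 <= t <= 1 -> maps_into K K' (extend t).
Proof.
move=> /time_surj[s <-] _ /coords_surj[x <-]; rewrite extendE.
exact: coords_realization.
Qed.

Hypothesis h_cont : continuous h.

Lemma extend_uniform : uniform_homotopy K extend.
Proof.
move=> eps e0; have [d d0 dP] := cylinder_continuity h_cont e0.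
exists d => // _ _ /time_surj[s <-] /time_surj[t <-] st _ _ /coords_surj[x <-] /coords_surj[z <-] xz.
by rewrite !extendE; apply: dP.
Qed.

(* The least common multiple of the weights m' on tau divides that of the weights m on
   sigma; if strong, the same for greatest common divisors. *)
Definition dominates (strong : bool) (sigma : {set V}) (tau : {set V'}) :=
  if strong then forall v, v \in sigma -> exists2 w, w \in tau & (m' w %| m v)%N
  else forall w, w \in tau -> exists2 v, v \in sigma & (m' w %| m v)%N.

Definition levels (strong : bool) (t : R) := if strong then 0 < t /\ t <= 1 else t = 1.

(** In the strong case a mass bound yields one large coordinate, and [cylinder_lower_bound] a large
    coordinate of the image whose weight divides the former weight. Otherwise mass 1 says that all
    weights of the carrier divide [d], and domination transports this exactly. *)
Lemma extend_mass strong :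
  (forall x s, dominates strong (carrier (coords x)) (carrier (coords (h (x, s))))) ->
  forall t, levels strong t -> exists2 t', levels strong t' &
    forall s, 0 <= s <= 1 -> maps_mass K m m' t t' (extend s).
Proof.
case: strong => [hd t [t0 t1]|hd t ->].
  have [t' t'0 tP] := cylinder_lower_bound h_cont (divr_gt0 t0 (ltr0Sn R #|V|)) hd.
  exists (Num.min t' 1).
    by split; [rewrite lt_min t'0 ltr01 | rewrite ge_min lexx orbT].
  move=> _ /time_surj[s <-] _ d /coords_surj[x <-] xd; rewrite extendE.
  have [v [vd xv]] := big_coord (coords_realization x) t0 xd.
  have [w hw wv] := tP x s v xv; have wd := dvdn_trans wv vd.
  rewrite ge_min; apply/orP; left; apply: (le_trans hw).
  rewrite /mass (bigD1 w) //= lerDl sumr_ge0 // => u _.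
  by case: (coords_realization (h (x, s))).
exists 1 => // _ /time_surj[s <-] _ d /coords_surj[x <-] xd; rewrite extendE.
have [x0 x1 _] := coords_realization x; have [h0 h1 _] := coords_realization (h (x, s)).
have dv v : v \in carrier (coords x) -> (m v %| d)%N.
  rewrite inE => xv; apply: contraTT xd => nv; rewrite -ltNge -x1 /mass.
  rewrite [ltRHS](bigID (fun v => (m v %| d)%N)) /= ltrDl (bigD1 v) //=.
  by rewrite ltr_pwDl // sumr_ge0.
rewrite -h1 /mass [leLHS](bigID (fun v => (m' v %| d)%N)) /= gerDl.
apply: sumr_le0 => w nw; rewrite leNgt; apply: contra nw => hw.
have [|v vx wv] := hd x s w; first by rewrite inE.
exact: dvdn_trans wv (dv v vx).
Qed.

End Extension.

(** * Divisible weights *)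

Section VertexWeights.
Variables (V : finType) (K : simplicial_complex V) (t : wtype) (xi : {set V} -> nat) (M : nat).
Hypothesis xi_div : is_divisible_weight K t xi.
Hypothesis M_gt0 : (0 < M)%N.
Hypothesis M_mult : forall v, [set v]%SET \in (K : {set _}) -> (xi [set v]%SET %| M)%N.

(* Weights in ascending form: a descending weight is replaced by its
   quotient into a common multiple M. *)
Definition ascending_form (sigma : {set V}) : nat :=
  if t is Ascending then xi sigma else (M %/ xi sigma)%N.

(** Elements of [V] that are not vertices get weight 1, so that positivity holds on all of [V]. *)
Definition vertex_weight (v : V) : nat :=
  if [set v]%SET \in (K : {set _}) then ascending_form [set v]%SET else 1%N.

Lemma vertex_in sigma v : sigma \in (K : {set _}) -> v \in sigma ->
  [set v]%SET \in (K : {set _}).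
Proof.
move=> sK vs; apply: (simplex_face sK); first by rewrite finset.sub1set.
by apply/set0Pn; exists v; rewrite inE.
Qed.

Lemma extreme_vertex sigma : sigma \in (K : {set _}) -> exists2 w, w \in sigma &
  xi sigma = xi [set w]%SET /\ forall v, v \in sigma ->
    if t is Ascending then (xi [set v]%SET %| xi [set w]%SET)%N
    else (xi [set w]%SET %| xi [set v]%SET)%N.
Proof.
move=> sK; have [[_ xi_mono] /(_ _ sK)[v0 [vs [_ sE pvs xiE]]]] := xi_div.
pose w := if t is Ascending then last v0 vs else v0.
have ws : w \in sigma by rewrite sE inE /w; case: (t); [exact: mem_last | exact: mem_head].
exists w => //; have e : xi sigma = xi [set w]%SET by rewrite xiE /w; case: (t).
split=> // v vs'; have := xi_mono _ _ sK (vertex_in sK vs').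
rewrite finset.sub1set vs' => /(_ isT); rewrite e.
by case: (t).
Qed.

Lemma xi_gt0 sigma : sigma \in (K : {set _}) -> (0 < xi sigma)%N.
Proof. by case: xi_div => -[pos _] _; apply: pos. Qed.

Lemma xi_M sigma : sigma \in (K : {set _}) -> (xi sigma %| M)%N.
Proof.
move=> sK; have [w ws [-> _]] := extreme_vertex sK.
exact/M_mult/(vertex_in sK ws).
Qed.

Lemma ascending_form_gt0 sigma : sigma \in (K : {set _}) -> (0 < ascending_form sigma)%N.
Proof.
move=> sK; rewrite /ascending_form; case: (t); first exact: xi_gt0.
by rewrite divn_gt0 ?xi_gt0 // dvdn_leq // xi_M.
Qed.

Lemma dvdn_divl a b : (0 < b)%N -> (a %| b)%N -> (b %| M)%N -> (M %/ b %| M %/ a)%N.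
Proof.
move=> b0 /dvdnP[c bE] /dvdnP[d ->]; rewrite bE in b0 *.
move: b0; rewrite muln_gt0 => /andP[c0 a0].
by rewrite mulnK ?muln_gt0 ?c0 // mulnA mulnK // dvdn_mulr.
Qed.

Lemma vertex_weight_top sigma : sigma \in (K : {set _}) -> exists2 w, w \in sigma &
  ascending_form sigma = vertex_weight w /\
  forall v, v \in sigma -> (vertex_weight v %| vertex_weight w)%N.
Proof.
move=> sK; have [w ws [e wv]] := extreme_vertex sK; exists w => //.
have vK v : v \in sigma -> [set v]%SET \in (K : {set _}) by apply: vertex_in.
split; first by rewrite /vertex_weight vK // /ascending_form e.
move=> v vs; rewrite /vertex_weight !vK // /ascending_form.
have := wv v vs; case: (t) => // wv'.
by apply: dvdn_divl => //; [apply/xi_gt0/vK | apply/xi_M/vK].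
Qed.

Lemma vertex_weight_gt0 v : (0 < vertex_weight v)%N.
Proof. by rewrite /vertex_weight; case: ifP => // /ascending_form_gt0. Qed.

Lemma vertex_weight_total sigma v w : sigma \in (K : {set _}) ->
  v \in sigma -> w \in sigma ->
  (vertex_weight v %| vertex_weight w)%N || (vertex_weight w %| vertex_weight v)%N.
Proof.
move=> sK vs ws; have vwK : [set v; w]%SET \in (K : {set _}).
  apply: (simplex_face sK); first by rewrite finset.subUset !finset.sub1set vs ws.
  by apply/set0Pn; exists v; rewrite !inE eqxx.
have [u] := vertex_weight_top vwK; rewrite !inE => /orP[/eqP->|/eqP->] [_ top].
  by apply/orP; right; apply: top; rewrite !inE eqxx orbT.
by apply/orP; left; apply: top; rewrite !inE eqxx.
Qed.

Lemma ascending_form_dvd sigma (z : int) : sigma \in (K : {set _}) ->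
  ((ascending_form sigma)%:Z %| z)%Z <->
  forall v, v \in sigma -> ((vertex_weight v)%:Z %| z)%Z.
Proof.
move=> sK; have [w ws [-> top]] := vertex_weight_top sK.
split=> [wz v /top vw|]; last by apply.
by apply: dvdz_trans wz; rewrite dvdzE.
Qed.

(** In the descending case, [xi tau / xi sigma] times [M / xi tau] is [M / xi sigma]. *)
Lemma ascending_form_coef sigma tau : sigma \in (K : {set _}) -> tau \in (K : {set _}) ->
  tau \subset sigma -> (wcoef t xi sigma tau * ascending_form tau)%N = ascending_form sigma.
Proof.
move=> sK tK ts; have [[_ mono] _] := xi_div; have := mono _ _ sK tK ts.
have := xi_M tK; have := xi_gt0 tK; have := xi_gt0 sK.
rewrite /wcoef /ascending_form; case: (t) => s0 t0 tM st; first by rewrite divnK.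
by rewrite mulnC muln_divA // divnK.
Qed.

End VertexWeights.

Section Domination.
Variables (V : finType) (K : simplicial_complex V) (mu : {set V} -> nat).
Variables (V' : finType) (K' : simplicial_complex V') (mu' : {set V'} -> nat).
Variables (t : wtype) (M : nat).
Hypotheses (mu_div : is_divisible_weight K t mu) (mu'_div : is_divisible_weight K' t mu').
Hypothesis M_mult : forall v, [set v]%SET \in (K : {set _}) -> (mu [set v]%SET %| M)%N.
Hypothesis M_mult' : forall v, [set v]%SET \in (K' : {set _}) -> (mu' [set v]%SET %| M)%N.
Local Notation dominates := (dominates (vertex_weight K t mu M) (vertex_weight K' t mu' M)).

Lemma ascending_form_le sigma tau : sigma \in (K : {set _}) -> tau \in (K' : {set _}) ->
  (if t is Ascending then (mu' tau %| mu sigma)%N else (mu sigma %| mu' tau)%N) ->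
  (ascending_form t mu' M tau %| ascending_form t mu M sigma)%N.
Proof.
move=> sK tK; rewrite /ascending_form.
have := xi_M mu'_div M_mult' tK; have := xi_gt0 mu'_div tK.
by case: (t) => // *; apply: dvdn_divl.
Qed.

Lemma dominates_lcm sigma tau : sigma \in (K : {set _}) -> tau \in (K' : {set _}) ->
  (if t is Ascending then (mu' tau %| mu sigma)%N else (mu sigma %| mu' tau)%N) ->
  dominates false sigma tau.
Proof.
move=> sK tK st w wt; have le := ascending_form_le sK tK st.
have [v vs [vE _]] := vertex_weight_top mu_div M_mult sK; exists v => //.
have [w' w't [w'E top]] := vertex_weight_top mu'_div M_mult' tK.
by rewrite -vE; apply: dvdn_trans le; rewrite w'E top.
Qed.

(** [xi] reads off the extreme vertex weight at the end opposite to the one seen by [mu]: in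
    ascending form, the least one. The vertex of [tau] attaining it therefore has a weight dividing
    those of all vertices of [sigma]. *)
Lemma dominates_gcd xi xi' sigma tau :
  is_divisible_weight K (opposite t) xi -> is_divisible_weight K' (opposite t) xi' ->
  (forall v, xi [set v]%SET = mu [set v]%SET) ->
  (forall v, xi' [set v]%SET = mu' [set v]%SET) ->
  sigma \in (K : {set _}) -> tau \in (K' : {set _}) -> xi' tau = xi sigma ->
  dominates true sigma tau.
Proof.
move=> xi_div xi'_div xiE xi'E sK tK st v vs.
have [w wt [wE _]] := extreme_vertex xi'_div tK; exists w => //.
have [v' _ [v'E ext]] := extreme_vertex xi_div sK.
have vK := vertex_in sK vs; have wK := vertex_in tK wt.
rewrite /vertex_weight vK wK; apply: ascending_form_le => //.
have := ext v vs; rewrite -v'E -st wE -!xi'E -!xiE.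
by case: (t).
Qed.

End Domination.

Lemma common_multiple (V : finType) (K : simplicial_complex V) t (mu : {set V} -> nat) :
  is_weight K t mu -> exists2 M, (0 < M)%N &
    forall v, [set v]%SET \in (K : {set _}) -> (mu [set v]%SET %| M)%N.
Proof.
move=> [mu_gt0 _]; exists (\prod_(v | [set v]%SET \in (K : {set _})) mu [set v]%SET).
  by apply: prodn_cond_gt0 => v; apply: mu_gt0.
by move=> v vK; rewrite (bigD1 v) //= dvdn_mulr.
Qed.

Section Continuity.
Variables A B C : topologicalType.

Lemma continuous_compose (u : A -> B) (v : B -> C) :
  continuous u -> continuous v -> continuous (v \o u).
Proof. by move=> uc vc x; apply: continuous_comp; [exact: uc | exact: vc]. Qed.

Lemma continuous_comp_fst (u : A -> B) : continuous u -> continuous (fun z : A * C => u z.1).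
Proof.
move=> uc z; apply: (@continuous_comp _ _ _ fst u); last exact: uc.
exact: (@cvg_fst A C (nbhs z.1) (nbhs z.2)).
Qed.

End Continuity.

Lemma continuous_cylinder (A B C : topologicalType) (u : A -> B) :
  continuous u -> continuous (fun z : A * C => (u z.1, z.2)).
Proof.
move=> uc z; apply: cvg_pair; first exact: continuous_comp_fst.
exact: (@cvg_snd A C (nbhs z.1) (nbhs z.2)).
Qed.

(** * Assembly for triangulated polyhedra *)

Section Triangulated.
Variables (R : realType) (t : wtype) (strong : bool) (X X' : topologicalType).
Variables (V : finType) (K : simplicial_complex V) (mu : {set V} -> nat).
Variables (V' : finType) (K' : simplicial_complex V') (mu' : {set V'} -> nat).
Hypotheses (mu_div : is_divisible_weight K t mu) (mu'_div : is_divisible_weight K' t mu').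
Variable M : nat.
Hypothesis M_gt0 : (0 < M)%N.
Hypothesis M_mult : forall v, [set v]%SET \in (K : {set _}) -> (mu [set v]%SET %| M)%N.
Hypothesis M_mult' : forall v, [set v]%SET \in (K' : {set _}) -> (mu' [set v]%SET %| M)%N.
Local Notation m := (vertex_weight K t mu M).
Local Notation m' := (vertex_weight K' t mu' M).
Local Notation S := (classical_sets.set_type (realization (R := R) K)).
Local Notation S' := (classical_sets.set_type (realization (R := R) K')).
Local Notation I := (unit_interval R).
Variables (p : X -> S) (q : S -> X) (p' : X' -> S') (q' : S' -> X').
Hypotheses (p_cont : continuous p) (q_cont : continuous q) (qK : cancel q p).
Hypotheses (p'_cont : continuous p') (q'_cont : continuous q') (q'K : cancel q' p').
Hypotheses (pK : cancel p q) (p'K : cancel p' q').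
Variables (f : X -> X') (g : X' -> X) (H : X * I -> X) (H' : X' * I -> X').
Hypotheses (f_cont : continuous f) (g_cont : continuous g)
  (H_cont : continuous H) (H'_cont : continuous H').
Hypotheses (H_ends : homotopy_ends H (g \o f) id) (H'_ends : homotopy_ends H' (f \o g) id).
Hypotheses
  (f_dom : forall x, dominates m m' strong (carrier (coords (p x))) (carrier (coords (p' (f x)))))
  (g_dom : forall x, dominates m' m strong (carrier (coords (p' x))) (carrier (coords (p (g x)))))
  (H_dom : forall x s,
     dominates m m strong (carrier (coords (p x))) (carrier (coords (p (H (x, s))))))
  (H'_dom : forall x s,
     dominates m' m' strong (carrier (coords (p' x))) (carrier (coords (p' (H' (x, s)))))).

Lemma triangulated_isomorphic n :
  zmod_isomorphic (weighted_homology K t mu n) (weighted_homology K' t mu' n).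
Proof.
(* Maps are treated as homotopies constant in time, so uniform continuity and mass bounds are proved
   once for both. *)
pose hf (z : S * I) := p' (f (q z.1)); pose hg (z : S' * I) := p (g (q' z.1)).
pose hH (z : S * I) := p (H (q z.1, z.2)); pose hH' (z : S' * I) := p' (H' (q' z.1, z.2)).
have hf_cont : continuous hf.
  exact: continuous_comp_fst (continuous_compose (continuous_compose q_cont f_cont) p'_cont).
have hg_cont : continuous hg.
  exact: continuous_comp_fst (continuous_compose (continuous_compose q'_cont g_cont) p_cont).
have hH_cont : continuous hH.
  exact: continuous_compose (continuous_compose (continuous_cylinder q_cont) H_cont) p_cont.
have hH'_cont : continuous hH'.
  exact: continuous_compose (continuous_compose (continuous_cylinder q'_cont) H'_cont) p'_cont.
have i0 : 0 <= (0 : R) <= 1 by rewrite lexx ler01.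
have i1 : 0 <= (1 : R) <= 1 by rewrite lexx ler01.
have [s0 s0E] := time_surj i0; have [s1 s1E] := time_surj i1.
have m_gt0 := vertex_weight_gt0 mu_div M_gt0 M_mult.
have m'_gt0 := vertex_weight_gt0 mu'_div M_gt0 M_mult'.
have m_total := vertex_weight_total mu_div M_mult.
have m'_total := vertex_weight_total mu'_div M_mult'.
have unif (W W' : finType) (L : simplicial_complex W) (L' : simplicial_complex W')
    (h : classical_sets.set_type (realization (R := R) L) * I ->
         classical_sets.set_type (realization (R := R) L')) :
    continuous h -> uniform_on L (extend h 0).
  move=> hc eps e0; have [d d0 dP] := extend_uniform hc e0; exists d => //.
  by apply: dP => //; rewrite subrr normr0 ltW.
have lev1 : levels strong (1 : R) by rewrite /levels; case: strong.
have lev_range (r : R) : levels strong r -> 0 < r /\ r <= 1.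
  by rewrite /levels; case: strong => // ->.
have lev_min (r s : R) : levels strong r -> levels strong s -> levels strong (Num.min r s).
  rewrite /levels; case: strong => [[r0 r1] [s0' _]|-> ->]; last by rewrite minxx.
  by rewrite lt_min r0 s0' ge_min r1.
have hf_dom x s : dominates m m' strong (carrier (coords x)) (carrier (coords (hf (x, s)))).
  by rewrite -{1}(qK x); apply: f_dom.
have hg_dom x s : dominates m' m strong (carrier (coords x)) (carrier (coords (hg (x, s)))).
  by rewrite -{1}(q'K x); apply: g_dom.
have hH_dom x s : dominates m m strong (carrier (coords x)) (carrier (coords (hH (x, s)))).
  by rewrite -{1}(qK x); apply: H_dom.
have hH'_dom x s : dominates m' m' strong (carrier (coords x)) (carrier (coords (hH' (x, s)))).
  by rewrite -{1}(q'K x); apply: H'_dom.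
have [||||||||F [F1 F2 F3 F4]] := @homology_equivalence R V K m m_gt0 m_total
  V' K' m' m'_gt0 m'_total (extend hf 0) (extend hg 0) (extend hH) (extend hH')
  (extend_into hf i0) (extend_into hg i0) (extend_into hH) (extend_into hH')
  (unif _ _ _ _ _ hf_cont) (unif _ _ _ _ _ hg_cont) (extend_uniform hH_cont)
  (extend_uniform hH'_cont) _ _ _ _ (@levels R strong) lev1 lev_range lev_min _ _ _ _ n.
- move=> _ /coords_surj[x <-]; rewrite -s0E !extendE.
  by rewrite /hH /hg /hf /=; have [/(_ s0E)-> _] := H_ends (q x) s0; rewrite /= p'K.
- move=> _ /coords_surj[x <-]; rewrite -s1E extendE.
  by rewrite /hH /=; have [_ /(_ s1E)->] := H_ends (q x) s1; rewrite qK.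
- move=> _ /coords_surj[x <-]; rewrite -s0E !extendE.
  by rewrite /hH' /hg /hf /=; have [/(_ s0E)-> _] := H'_ends (q' x) s0; rewrite /= pK.
- move=> _ /coords_surj[x <-]; rewrite -s1E extendE.
  by rewrite /hH' /=; have [_ /(_ s1E)->] := H'_ends (q' x) s1; rewrite q'K.
- by move=> r /(extend_mass hf_cont hf_dom)[r' r'l rP]; exists r' => //; apply: rP.
- by move=> r /(extend_mass hg_cont hg_dom)[r' r'l rP]; exists r' => //; apply: rP.
- exact: extend_mass hH_dom.
- exact: extend_mass hH'_dom.
apply: (@weighted_homology_isomorphic _ _ t mu (ascending_form t mu M) m _ _ _
  _ _ t mu' (ascending_form t mu' M) m' _ _ _ n F) => //.
- exact: ascending_form_gt0.
- exact: ascending_form_coef.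
- by move=> sigma z; apply: ascending_form_dvd.
- exact: ascending_form_gt0.
- exact: ascending_form_coef.
- by move=> sigma z; apply: ascending_form_dvd.
Qed.

End Triangulated.

Lemma carrier_in (R : realType) (V : finType) (K : simplicial_complex V)
    (x : classical_sets.set_type (realization (R := R) K)) : carrier (coords x) \in (K : {set _}).
Proof. by case: (coords_realization x). Qed.

Section WeightedPolyhedra.
Variables (R : realType) (t : wtype) (X X' : topologicalType).
Variables (lam : X -> nat) (lam' : X' -> nat).
Variables (V : finType) (K : simplicial_complex V) (xi : {set V} -> nat).
Variables (V' : finType) (K' : simplicial_complex V') (xi' : {set V'} -> nat).
Hypotheses (xi_div : is_divisible_weight K t xi) (xi'_div : is_divisible_weight K' t xi').
Hypotheses (K_triang : weighted_triangulation R lam K xi)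
  (K'_triang : weighted_triangulation R lam' K' xi').

(** One [M] must serve both complexes: for descending weights, quotients of [M] are compared across
    the maps. *)
Lemma common_multiple2 : exists M, [/\ (0 < M)%N,
  forall v, [set v]%SET \in (K : {set _}) -> (xi [set v]%SET %| M)%N &
  forall v, [set v]%SET \in (K' : {set _}) -> (xi' [set v]%SET %| M)%N].
Proof.
have [[w _] [w' _]] := (xi_div, xi'_div).
have [M M0 MK] := common_multiple w; have [M' M'0 M'K] := common_multiple w'.
exists (M * M')%N; split; first by rewrite muln_gt0 M0.
  by move=> v /MK; apply: dvdn_mulr.
by move=> v /M'K; apply: dvdn_mull.
Qed.

Lemma W_homotopy_isomorphic n : W_homotopy_equivalent R t lam lam' ->
  zmod_isomorphic (weighted_homology K t xi n) (weighted_homology K' t xi' n).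
Proof.
move=> [f [g [[fc fw] [gc gw] [H [[Hc Hw] He]] [H' [[H'c H'w] H'e]]]]].
have [p [q [pc qc pK qK pE]]] := K_triang; have [p' [q' [p'c q'c p'K q'K p'E]]] := K'_triang.
have [M [M0 MK MK']] := common_multiple2.
apply: (@triangulated_isomorphic R t false X X' V K xi V' K' xi' xi_div xi'_div M M0 MK MK'
  p q p' q' pc qc qK p'c q'c q'K pK p'K f g H H' fc gc Hc H'c He H'e).
- move=> x; apply: dominates_lcm; rewrite ?carrier_in //.
  by have := fw x; rewrite -pE -p'E; case: (t).
- move=> x; apply: dominates_lcm; rewrite ?carrier_in //.
  by have := gw x; rewrite -pE -p'E; case: (t).
- move=> x s; apply: dominates_lcm; rewrite ?carrier_in //.
  by have := Hw (x, s); rewrite /cylinder_weight -!pE; case: (t).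
- move=> x s; apply: dominates_lcm; rewrite ?carrier_in //.
  by have := H'w (x, s); rewrite /cylinder_weight -!p'E; case: (t).
Qed.

(** In terms of the ascending form of the inversion, the original weight of a simplex records the
    greatest common divisor of its vertex weights; preserving it gives the strong domination in both
    directions. *)
Lemma strong_W_homotopy_isomorphic n : strongly_W_homotopy_equivalent R t lam lam' ->
  zmod_isomorphic (weighted_homology K (opposite t) (inversion t xi) n)
    (weighted_homology K' (opposite t) (inversion t xi') n).
Proof.
move=> [f [g [[[fc _] fw] [[gc _] gw] [H [[Hc _] Hw He]] [H' [[H'c _] H'w H'e]]]]].
have [p [q [pc qc pK qK pE]]] := K_triang; have [p' [q' [p'c q'c p'K q'K p'E]]] := K'_triang.
have [M [M0 MK MK']] := common_multiple2.
have MKi v : [set v]%SET \in (K : {set _}) -> (inversion t xi [set v]%SET %| M)%N.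
  by rewrite inversion_set1; apply: MK.
have MK'i v : [set v]%SET \in (K' : {set _}) -> (inversion t xi' [set v]%SET %| M)%N.
  by rewrite inversion_set1; apply: MK'.
have div := inversionP xi_div; have div' := inversionP xi'_div.
have tt : opposite (opposite t) = t by case: (t).
have xE v : xi [set v]%SET = inversion t xi [set v]%SET by rewrite inversion_set1.
have x'E v : xi' [set v]%SET = inversion t xi' [set v]%SET by rewrite inversion_set1.
have xd : is_divisible_weight K (opposite (opposite t)) xi by rewrite tt.
have x'd : is_divisible_weight K' (opposite (opposite t)) xi' by rewrite tt.
apply: (@triangulated_isomorphic R (opposite t) true X X' V K _ V' K' _ div div' M M0 MKi MK'i
  p q p' q' pc qc qK p'c q'c q'K pK p'K f g H H' fc gc Hc H'c He H'e).
- move=> x; apply: (dominates_gcd div' MK'i xd x'd xE x'E); rewrite ?carrier_in //.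
  by rewrite pE p'E fw.
- move=> x; apply: (dominates_gcd div MKi x'd xd x'E xE); rewrite ?carrier_in //.
  by rewrite pE p'E gw.
- move=> x s; apply: (dominates_gcd div MKi xd xd xE xE); rewrite ?carrier_in //.
  by rewrite !pE Hw.
- move=> x s; apply: (dominates_gcd div' MK'i x'd x'd x'E x'E); rewrite ?carrier_in //.
  by rewrite !p'E H'w.
Qed.

End WeightedPolyhedra.

Theorem theorem6p19 (R : realType) (t : wtype) (X X' : topologicalType)
    (lam : X -> nat) (lam' : X' -> nat)
    (X_polyhedron : weighted_polyhedron R t lam)
    (X'_polyhedron : weighted_polyhedron R t lam')
    (XX' : W_homotopy_equivalent R t lam lam')
    (T : divisible_triangulation R t lam)
    (T' : divisible_triangulation R t lam') :
  [/\ t = Ascending ->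
        forall n, zmod_isomorphic (AW_homology T n) (AW_homology T' n),
      t = Descending ->
        forall n, zmod_isomorphic (DW_homology T n) (DW_homology T' n) &
      strongly_W_homotopy_equivalent R t lam lam' ->
        (forall n, zmod_isomorphic (AW_homology T n) (AW_homology T' n)) /\
        (forall n, zmod_isomorphic (DW_homology T n) (DW_homology T' n))].
Proof.
have weak n := W_homotopy_isomorphic (dt_divisible T) (dt_divisible T')
  (dt_triangulation T) (dt_triangulation T') n XX'.
have strong n := @strong_W_homotopy_isomorphic _ _ _ _ _ _ _ _ _ _ _ _
  (dt_divisible T) (dt_divisible T') (dt_triangulation T) (dt_triangulation T') n.
clear XX' X_polyhedron X'_polyhedron; case: t T T' weak strong => T T' weak strong.
  (* In ascending type AW-homology uses the given weight and DW-homology its inversion; in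
     descending type the two exchange. *)
  split=> [_ n|e|S]; [exact: (weak n) | discriminate e | split=> n].
    exact: (weak n).
  exact: (strong n S).
split=> [e|_ n|S]; [discriminate e | exact: (weak n) | split=> n].
  exact: (strong n S).
exact: (weak n).
Qed.
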